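(* Let $E$ be a Dedekind $\sigma$-complete Banach lattice. The following assertions are equivalent: (1) $E$ is reflexive. (2) Each positive weak Dunford–Pettis operator from $E$ into $E$ is uaw-Dunford–Pettis.
   Context: All operators are continuous linear operators. A net $(x_\alpha)$ in a Banach lattice $E$ is uaw-convergent to $x$ (written $x_\alpha\xrightarrow{uaw}x$) if $|x_\alpha-x|\wedge u\to 0$ weakly for every $u\in E_+$. An operator $T$ from a Banach lattice $E$ into a Banach space $X$ is uaw-Dunford–Pettis if for every norm bounded sequence $(x_n)$ in $E$ with $x_n\xrightarrow{uaw}0$ one has $\|Tx_n\|\to 0$. An operator $T:X\to Y$ between Banach spaces is weak Dunford–Pettis if $f_n(Tx_n)\to 0$ for every weakly null sequence $(x_n)$ in $X$ and every weakly null sequence $(f_n)$ in $Y'$. *)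

(* Defs.v *)
From HB Require Import structures.
From mathcomp Require Import all_boot all_order all_algebra.
From mathcomp Require Import all_classical all_reals all_analysis.
Set Implicit Arguments. Unset Strict Implicit. Unset Printing Implicit Defensive.
Import Order.TTheory GRing.Theory Num.Theory.
Import numFieldNormedType.Exports.
Local Open Scope classical_set_scope.
Local Open Scope ring_scope.

Section BanachLattice.
Variables (R : realType) (E : completeNormedModType R).

Record lattice_ops := LatticeOps {
  lle : E -> E -> Prop;
  ljoin : E -> E -> E }.

Variable L : lattice_ops.
Definition lmeet (x y : E) : E := - ljoin L (- x) (- y).
Definition labs (x : E) : E := ljoin L x (- x).

Definition is_banach_lattice : Prop :=
  [/\ (forall x, lle L x x),
      (forall x y, lle L x y -> lle L y x -> x = y) &
      (forall x y z, lle L x y -> lle L y z -> lle L x z)] /\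
  [/\ (forall x y z, lle L x y -> lle L (x + z) (y + z)),
      (forall (a : R) x y, 0 <= a -> lle L x y -> lle L (a *: x) (a *: y)),
      (forall x y, lle L x (ljoin L x y) /\ lle L y (ljoin L x y) /\
         (forall z, lle L x z -> lle L y z -> lle L (ljoin L x y) z)) &
      (forall x y, lle L (labs x) (labs y) -> `|x| <= `|y|)].

Definition dedekind_sigma_complete : Prop :=
  forall x : nat -> E, (exists u, forall n, lle L (x n) u) ->
    exists s, (forall n, lle L (x n) s) /\
              (forall u, (forall n, lle L (x n) u) -> lle L s u).

Definition is_linear_map (V W : lmodType R) (T : V -> W) : Prop :=
  forall (a : R) x y, T (a *: x + y) = a *: T x + T y.

Definition is_dual (f : E -> R) : Prop :=
  is_linear_map (f : E -> R^o) /\ continuous f.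

Definition dual_norm (f : E -> R) : R :=
  sup [set `|f x| | x in [set x : E | `|x| <= 1]].

Definition is_bidual (Phi : (E -> R) -> R) : Prop :=
  (forall (a : R) f g, is_dual f -> is_dual g ->
     Phi (fun x => a * f x + g x) = a * Phi f + Phi g) /\
  (exists C : R, forall f, is_dual f -> `|Phi f| <= C * dual_norm f).

Definition reflexive_space : Prop :=
  forall Phi, is_bidual Phi ->
    exists x : E, forall f, is_dual f -> Phi f = f x.

Definition weakly_cvg (x : nat -> E) (l : E) : Prop :=
  forall f, is_dual f -> (fun n => f (x n)) @ \oo --> f l.

Definition dual_weakly_null (f : nat -> E -> R) : Prop :=
  (forall n, is_dual (f n)) /\
  forall Phi, is_bidual Phi -> (fun n => Phi (f n)) @ \oo --> (0 : R).

Definition is_operator (T : E -> E) : Prop :=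
  is_linear_map T /\ continuous T.

Definition positive_op (T : E -> E) : Prop :=
  forall x, lle L 0 x -> lle L 0 (T x).

Definition weak_DP (T : E -> E) : Prop :=
  forall (x : nat -> E) (f : nat -> E -> R),
    weakly_cvg x 0 -> dual_weakly_null f ->
    (fun n => f n (T (x n))) @ \oo --> (0 : R).

Definition uaw_null (x : nat -> E) : Prop :=
  forall u, lle L 0 u -> weakly_cvg (fun n => lmeet (labs (x n)) u) 0.

Definition uaw_DP (T : E -> E) : Prop :=
  forall x : nat -> E, (exists M : R, forall n, `|x n| <= M) ->
    uaw_null x -> (fun n => `|T (x n)|) @ \oo --> (0 : R).

End BanachLattice.

(* Main.v *)
(* (1) => (2).  In a reflexive Banach lattice every weak cluster point of a
   bounded disjoint sequence is disjoint from each term, hence zero.  It follows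
   that each positive functional is small on [(|x_n| - k e)^+], uniformly in [n],
   for a suitable [e], so bounded uaw-null sequences are weakly null.  If
   [|T x_n| > e], functionals of norm one attaining [|T x_n|] have a subsequence
   that converges weakly, by reflexivity, and weak Dunford-Pettis fails on its
   differences with the limit.

   (2) => (1).  Disjoint sequences are uaw-null, so (2) is applied to three
   operators: rank one operators, so that bounded disjoint sequences are weakly
   null; [x |-> sum_n g_n(x) d_n] with [d] disjoint and order bounded, which
   factors through l^oo and makes such [d] norm null; the same series with [d]
   disjoint with bounded partial sums and [g_n] carried by [d_n].  By Rosenthal's
   disjointification the norm is then order continuous and bounded increasing
   sequences converge.  If [E] is not reflexive, James' construction gives [f_m]
   in the unit ball of the dual and a bounded [x_n] with [f_m(x_n) >= theta] for
   [m <= n] and [f_m(x_n) = 0] for [m > n].  Let [f = sum_m 2^-m |f_m|].  Convex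
   combinations [z_n] of the tails of [x] that almost minimise a strictly convex
   functional are Cauchy for the seminorm [f |.|], and a subsequence converges to
   some [zeta] when tested against every functional absolutely continuous with
   respect to [f].  Hence [f_m(zeta) >= theta] for all [m], whereas [zeta] lies in
   the closed subspace [{s : f_m(s) -> 0}], which contains every [z_n]. *)
Require Import Defs.
From HB Require Import structures.
From mathcomp Require Import all_boot all_order all_algebra.
From mathcomp Require Import all_classical all_reals all_analysis.
From mathcomp Require Import ring lra.
Set Implicit Arguments. Unset Strict Implicit. Unset Printing Implicit Defensive.
Import Order.TTheory GRing.Theory Num.Theory.
Import numFieldNormedType.Exports.
Local Open Scope classical_set_scope.
Local Open Scope ring_scope.

(** * The Hahn-Banach theorem *)

(** Each of the three operators is weak Dunford-Pettis for its own reason: a rank one operator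
    because its functional already sends weakly null sequences to zero, the second by the
    Dunford-Pettis property of l^oo, proved through exhaustive submeasures rather than a description
    of the dual of l^oo, the third by the Schur property of l^1. That [g_n] is carried by [d_n]
    makes [g_n(x)] tend to zero for each [x], and this is what makes a series with merely bounded
    partial sums converge.

    At that point [E] has two classical properties that together characterise reflexivity: bounded
    increasing sequences converge, and the dual norm is order continuous. The usual conclusion uses
    the band structure of the bidual. Here the seminorm [f |.|] plays the role of an L^1 norm, and
    minimising a strictly convex functional replaces the weak compactness of uniformly integrable
    sets. That functional is a Legendre transform because countable suprema of linear expressions
    exist in a Dedekind sigma-complete lattice. *)

Lemma history_choice (T : Type) (t0 : T) (P : nat -> (nat -> T) -> T -> Prop) :
  (forall n a, (forall i, (i < n)%N -> P i a (a i)) -> exists t, P n a t) ->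
  (forall n a b t, (forall i, (i < n)%N -> a i = b i) -> P n a t -> P n b t) ->
  exists a, forall n, P n a (a n).
Proof.
move=> Pex Pext.
have [F FP] : exists F : nat -> (nat -> T) -> T, forall n a,
    (forall i, (i < n)%N -> P i a (a i)) -> P n a (F n a).
  have H (na : nat * (nat -> T)) : exists t,
      (forall i, (i < na.1)%N -> P i na.2 (na.2 i)) -> P na.1 na.2 t.
    have [/Pex[t Pt]|nP] := pselect (forall i, (i < na.1)%N -> P i na.2 (na.2 i)).
      by exists t.
    by exists t0 => /nP.
  by have [F FP] := choice H; exists (fun n a => F (n, a)) => n a; exact: (FP (n, a)).
(* [b n] stores the first [n] choices and the default [t0] beyond them; since [P n] reads only the
   indices below [n], its property passes from [b n] to the diagonal [a]. *)
pose fix b n : nat -> T :=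
  if n is m.+1 then fun i => if i == m then F m (b m) else b m i else fun _ => t0.
pose a i := b i.+1 i.
have ba n i : (i < n)%N -> b n i = a i.
  elim: n => // n IH; rewrite ltnS leq_eqVlt => /predU1P[->//|ltin] /=.
  by rewrite (ltn_eqF ltin) IH.
exists a => n; elim/ltn_ind: n => n IH.
have aE : a n = F n (b n) by rewrite /a /= eqxx.
rewrite aE; apply: (Pext _ (b n)); first by move=> i; exact: ba.
apply: FP => i ltin; rewrite (ba _ _ ltin).
by apply: (Pext _ a); [move=> j ltji; rewrite ba //; exact: ltn_trans ltin|exact: IH].
Qed.

Section hahn_banach.
Variables (R : realType) (V : lmodType R) (D : V -> Prop).
Hypothesis D0 : D 0.
Hypothesis DS : forall a x y, D x -> D y -> D (a *: x + y).

(** Everything is relative to a subspace [D], because the continuous dual is handled as a predicate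
    inside the space of all functions [E -> R]. *)
Definition sublinear_on (p : V -> R) :=
  (forall x y, D x -> D y -> p (x + y) <= p x + p y) /\
  (forall t x, 0 <= t -> D x -> p (t *: x) = t * p x).

Definition linear_on (l : V -> R) :=
  forall a x y, D x -> D y -> l (a *: x + y) = a * l x + l y.

Let DZ a x : D x -> D (a *: x).
Proof. by move=> Dx; rewrite -[_ *: _]addr0; exact: DS. Qed.

Let DD x y : D x -> D y -> D (x + y).
Proof. by move=> Dx Dy; rewrite -[x]scale1r; exact: DS. Qed.

Let DN x : D x -> D (- x).
Proof. by rewrite -scaleN1r; exact: DZ. Qed.

Let sub0 p : sublinear_on p -> p 0 = 0.
Proof. by move=> [_ pZ]; rewrite -[in LHS](scale0r 0) pZ// mul0r. Qed.

Let subN p x : sublinear_on p -> D x -> - p (- x) <= p x.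
Proof.
move=> sp Dx; have := sp.1 _ _ Dx (DN Dx); rewrite subrr (sub0 sp); lra.
Qed.

Section cone.
Variables (p : V -> R) (K : V -> R -> Prop).
Hypothesis sp : sublinear_on p.
Hypothesis K0 : K 0 0.
Hypothesis KD : forall s r s' r', K s r -> K s' r' -> K (s + s') (r + r').
Hypothesis KZ : forall t s r, 0 <= t -> K s r -> K (t *: s) (t * r).
Hypothesis KDom : forall s r, K s r -> D s.
Hypothesis Kp : forall s r, K s r -> r <= p s.

(** A pair [(s, r)] of the cone [K] stands for the constraint [r <= l s]. A linear [l] below
    [cone_inf] is below [p] and meets every constraint, since the pair itself gives
    [cone_inf (- s) <= - r]. *)
Definition cone_inf x := inf [set z | exists s r, K s r /\ z = p (x + s) - r].

Let low x z : D x -> (exists s r, K s r /\ z = p (x + s) - r) -> - p (- x) <= z.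
Proof.
move=> Dx [s [r [Ksr ->]]]; have Ds := KDom Ksr.
have : p s <= p (- x) + p (x + s).
  by have := sp.1 _ _ (DN Dx) (DD Dx Ds); rewrite addKr.
have := Kp Ksr; lra.
Qed.

Let hinf x : D x -> has_inf [set z | exists s r, K s r /\ z = p (x + s) - r].
Proof.
move=> Dx; split; first by exists (p (x + 0) - 0), 0, 0.
by exists (- p (- x)) => z; exact: low.
Qed.

Lemma cone_inf_le x s r : D x -> K s r -> cone_inf x <= p (x + s) - r.
Proof. by move=> Dx Ksr; apply: ge_inf; [case: (hinf Dx)|exists s, r]. Qed.

Lemma cone_inf_lep x : D x -> cone_inf x <= p x.
Proof. by move=> Dx; rewrite -[x in p x]addr0 -[p _]subr0; exact: cone_inf_le. Qed.

Let cone_inf_adh x e : D x -> 0 < e -> exists s r, K s r /\ p (x + s) - r < cone_inf x + e.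
Proof.
by move=> Dx e0; have [_ [s [r [Ksr ->]]]] := inf_adherent e0 (hinf Dx); exists s, r.
Qed.

Lemma cone_inf_sublinear : sublinear_on cone_inf.
Proof.
split=> [x y Dx Dy|t x t0 Dx].
  apply/ler_addgt0Pr => e e0; have e20 : 0 < e / 2 by lra.
  have [s [r [Ksr xs]]] := cone_inf_adh Dx e20.
  have [s' [r' [Ksr' ys]]] := cone_inf_adh Dy e20.
  have := cone_inf_le (DD Dx Dy) (KD Ksr Ksr').
  have := sp.1 _ _ (DD Dx (KDom Ksr)) (DD Dy (KDom Ksr')).
  rewrite addrACA; lra.
have le t' x' : 0 < t' -> D x' -> cone_inf (t' *: x') <= t' * cone_inf x'.
  move=> t'0 Dx'; apply/ler_addgt0Pr => e e0.
  have [s [r [Ksr xs]]] := cone_inf_adh Dx' (divr_gt0 e0 t'0).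
  have := cone_inf_le (DZ t' Dx') (KZ (ltW t'0) Ksr).
  rewrite -scalerDr sp.2 ?(ltW t'0)//; last exact/DD/(KDom Ksr).
  move: xs; rewrite -(ltr_pM2l t'0) mulrBr mulrDr mulrCA divff ?gt_eqF// mulr1.
  by move=> /ltW + H; apply: le_trans.
move: t0; rewrite le_eqVlt => /predU1P[<-|t0].
  rewrite mul0r scale0r; apply/eqP; rewrite eq_le; apply/andP; split.
    by rewrite -(sub0 sp); exact: cone_inf_lep.
  apply: lb_le_inf; first by case: (hinf D0).
  by move=> z /(low D0); rewrite oppr0 (sub0 sp) oppr0.
apply/eqP; rewrite eq_le le//=.
have := le t^-1 (t *: x); rewrite invr_gt0 t0 scalerA mulVf ?gt_eqF// scale1r.
by move=> /(_ isT (DZ t Dx)); rewrite -(ler_pM2l t0) mulrA mulfV ?gt_eqF// mul1r.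
Qed.

End cone.

(** Zorn's lemma gives a minimal sublinear [q] below [p]. For the ray through [(y, q y)], [cone_inf]
    is a sublinear functional below [q], so minimality gives [q x <= q (x + y) - q y]. *)
Let linear_minorant p : sublinear_on p ->
  exists l, linear_on l /\ forall x, D x -> l x <= p x.
Proof.
move=> sp.
pose T := {q : V -> R | sublinear_on q /\ forall x, D x -> q x <= p x}.
pose Rl (q q' : T) := `[< forall x, D x -> sval q' x <= sval q x >].
have pT : sublinear_on p /\ forall x, D x -> p x <= p x by [].
have low (q : T) x : D x -> - p (- x) <= sval q x.
  move=> Dx; case: q => q /= [sq qp].
  by apply: le_trans (subN sq Dx); rewrite lerN2; apply/qp/DN.
have [||A Atot|[q [sq qp]] qmin] := @ZL_preorder T (exist _ p pT) Rl.
- by move=> q; apply/asboolP.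
- move=> q q' q'' /asboolP h /asboolP h'; apply/asboolP => x Dx.
  exact: le_trans (h' _ Dx) (h _ Dx).
- have [[q0 Aq0]|A0] := pselect (exists q, A q); last first.
    by exists (exist _ p pT) => q Aq; case: A0; exists q.
  pose m x := inf [set z | exists q, A q /\ z = sval q x].
  have hm x : D x -> has_inf [set z | exists q, A q /\ z = sval q x].
    move=> Dx; split; first by exists (sval q0 x), q0.
    by exists (- p (- x)) => _ [q [_ ->]]; exact: low.
  have m_le q x : A q -> D x -> m x <= sval q x.
    by move=> Aq Dx; apply: ge_inf; [case: (hm x Dx)|exists q].
  have m_adh x e : D x -> 0 < e -> exists q, A q /\ sval q x < m x + e.
    move=> Dx e0; have [_ [q [Aq ->]]] := inf_adherent e0 (hm x Dx).
    by exists q.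
  have sm : sublinear_on m /\ forall x, D x -> m x <= p x.
    split; last first.
      move=> x Dx; apply: le_trans (m_le q0 x Aq0 Dx) _.
      by case: (q0) => q /= [_]; exact.
    split=> [x y Dx Dy|t x t0 Dx].
      apply/ler_addgt0Pr => e e0; have e20 : 0 < e / 2 by lra.
      have [q [Aq qx]] := m_adh x _ Dx e20.
      have [q' [Aq' qy]] := m_adh y _ Dy e20.
      wlog /asboolP qq' : x y Dx Dy q q' Aq Aq' qx qy / Rl q q'.
        move=> H; have [?|?] := Atot _ _ Aq Aq'; first exact: (H x y _ _ q q').
        by rewrite addrC [m x + _]addrC; exact: (H y x _ _ q' q).
      have := m_le q' (x + y) Aq' (DD Dx Dy).
      have : sval q' (x + y) <= sval q' x + sval q' y.
        by case: (q') => r /= [[+ _] _]; apply.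
      have := qq' _ Dx; lra.
    have qZ (q : T) : sval q (t *: x) = t * sval q x.
      by case: q => q /= [[_ +] _]; apply.
    apply/eqP; rewrite eq_le; apply/andP; split.
      apply/ler_addgt0Pr => e e0.
      have t1 : 0 < t + 1 by rewrite ltr_wpDl.
      have [q [Aq qx]] := m_adh x _ Dx (divr_gt0 e0 t1).
      apply: le_trans (m_le q _ Aq (DZ t Dx)) _.
      rewrite qZ; apply: le_trans (_ : t * (m x + e / (t + 1)) <= _).
        by apply: ler_wpM2l => //; exact: ltW.
      rewrite mulrDr lerD2l mulrCA ger_pMr// ler_pdivrMr// mul1r; lra.
    apply: lb_le_inf; first by case: (hm _ (DZ t Dx)).
    by move=> _ [q [Aq ->]]; rewrite qZ ler_wpM2l// m_le.
  exists (exist _ m sm) => q Aq; apply/asboolP => x Dx /=; exact: m_le.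
have qsup x y : D x -> D y -> q x + q y <= q (x + y).
  move=> Dx Dy.
  pose K s r := exists t, [/\ 0 <= t, s = t *: y & r = t * q y].
  have K0 : K 0 0 by exists 0; rewrite scale0r mul0r.
  have KD s r s' r' : K s r -> K s' r' -> K (s + s') (r + r').
    move=> [t [t0 -> ->]] [t' [t'0 -> ->]]; exists (t + t').
    by rewrite addr_ge0// scalerDl mulrDl.
  have KZ t s r : 0 <= t -> K s r -> K (t *: s) (t * r).
    move=> t0 [t' [t'0 -> ->]]; exists (t * t').
    by rewrite mulr_ge0// scalerA mulrA.
  have KDom s r : K s r -> D s by move=> [t [_ -> _]]; exact: DZ.
  have Kq s r : K s r -> r <= q s by move=> [t [t0 -> ->]]; rewrite sq.2.
  have K1 : K y (q y) by exists 1; rewrite scale1r mul1r.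
  have sc := cone_inf_sublinear sq K0 KD KZ KDom Kq.
  have cle x' Dx' := @cone_inf_lep q K sq K0 KDom Kq x' Dx'.
  have cp x' : D x' -> cone_inf q K x' <= p x'.
    by move=> Dx'; exact: le_trans (cle _ Dx') (qp _ Dx').
  have /qmin/asboolP/(_ x Dx)/= : Rl (exist _ q (conj sq qp)) (exist _ _ (conj sc cp)).
    by apply/asboolP => x' Dx' /=; exact: cle.
  have := cone_inf_le sq K0 KDom Kq Dx K1; lra.
exists q; split=> // a x y Dx Dy.
have qD x' y' : D x' -> D y' -> q (x' + y') = q x' + q y'.
  by move=> Dx' Dy'; apply/eqP; rewrite eq_le sq.1//= qsup.
have qN x' : D x' -> q (- x') = - q x'.
  move=> Dx'; apply/eqP; rewrite -addr_eq0 -qD//; last exact: DN.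
  by rewrite addrC subrr (sub0 sq).
rewrite qD//; last exact: DZ.
have [a0|a0] := leP 0 a; first by rewrite sq.2.
rewrite -[a]opprK scaleNr qN; last exact: DZ.
by rewrite sq.2 ?mulNr// oppr_ge0 ltW.
Qed.

Theorem Mazur_Orlicz (p : V -> R) (K : V -> R -> Prop) :
  sublinear_on p -> K 0 0 ->
  (forall s r s' r', K s r -> K s' r' -> K (s + s') (r + r')) ->
  (forall t s r, 0 <= t -> K s r -> K (t *: s) (t * r)) ->
  (forall s r, K s r -> D s) ->
  (forall s r, K s r -> r <= p s) ->
  exists l, [/\ linear_on l, (forall x, D x -> l x <= p x) &
                forall s r, K s r -> r <= l s].
Proof.
move=> sp K0 KD KZ KDom Kp.
have [l [ll lc]] := linear_minorant (cone_inf_sublinear sp K0 KD KZ KDom Kp).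
exists l; split=> // [x Dx|s r Ksr].
  exact: le_trans (lc _ Dx) (cone_inf_lep sp K0 KDom Kp Dx).
have Ds := KDom _ _ Ksr; have Ns := DN Ds.
have := le_trans (lc _ Ns) (cone_inf_le sp K0 KDom Kp Ns Ksr).
rewrite addNr (sub0 sp).
have l0 : l 0 = 0 by have := ll (-1) _ _ D0 D0; rewrite scaler0 addr0; lra.
have := ll (-1) _ _ Ds D0; rewrite scaleN1r addr0 l0; lra.
Qed.

(** The graph of [phi] is a cone stable under negation, so the one-sided constraints become
    equalities. *)
Lemma dominated_extension (p : V -> R) (S : V -> Prop) (phi : V -> R) :
  sublinear_on p -> S 0 -> (forall a x y, S x -> S y -> S (a *: x + y)) ->
  (forall x, S x -> D x) ->
  (forall a x y, S x -> S y -> phi (a *: x + y) = a * phi x + phi y) ->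
  (forall x, S x -> phi x <= p x) ->
  exists l, [/\ linear_on l, (forall x, D x -> l x <= p x) &
                forall s, S s -> l s = phi s].
Proof.
move=> sp S0 SS SD phil phip.
have phi0 : phi 0 = 0 by have := phil (-1) _ _ S0 S0; rewrite scaler0 addr0; lra.
have SZ a x : S x -> S (a *: x) by move=> Sx; rewrite -[_ *: _]addr0; exact: SS.
have phiZ a x : S x -> phi (a *: x) = a * phi x.
  by move=> Sx; rewrite -[_ *: _]addr0 phil// phi0 addr0.
have [||||||l [ll lp lK]] := @Mazur_Orlicz p (fun s r => S s /\ r = phi s) => //.
- move=> s r s' r' [Ss ->] [Ss' ->].
  have := SS 1 _ _ Ss Ss'; have := phil 1 _ _ Ss Ss'.
  by rewrite scale1r mul1r.
- by move=> t s r _ [Ss ->]; rewrite phiZ//; split=> //; exact: SZ.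
- by move=> s r [/SD].
- by move=> s r [Ss ->]; exact: phip.
exists l; split=> // s Ss; apply/eqP; rewrite eq_le lK// andbT.
have := lK _ _ (conj (SZ (-1) _ Ss) erefl); rewrite phiZ//.
have l0 : l 0 = 0 by have := ll (-1) _ _ D0 D0; rewrite scaler0 addr0; lra.
have := ll (-1) _ _ (SD _ Ss) D0; rewrite addr0 l0; lra.
Qed.

(** The constraints are [t * c <= l (t *: v + x)] for [t >= 0] and [x] in [S]. For [t = 0] they make
    [l] nonnegative on a subspace, hence zero there. *)
Lemma separation_from_subspace (p : V -> R) (S : V -> Prop) (v : V) (c : R) :
  sublinear_on p -> S 0 -> (forall a x y, S x -> S y -> S (a *: x + y)) ->
  (forall x, S x -> D x) -> D v -> 0 < c -> (forall x, D x -> 0 <= p x) ->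
  (forall s, S s -> c <= p (v + s)) ->
  exists l, [/\ linear_on l, (forall x, D x -> l x <= p x),
                (forall s, S s -> l s = 0) & 0 < l v].
Proof.
move=> sp S0 SS SD Dv c0 p0 Sc.
have SZ a x : S x -> S (a *: x) by move=> Sx; rewrite -[_ *: _]addr0; exact: SS.
pose K s r := exists t x, [/\ 0 <= t, S x, s = t *: v + x & r = t * c].
have [||||||l [ll lp lK]] := @Mazur_Orlicz p K => //.
- by exists 0, 0; rewrite scale0r add0r mul0r.
- move=> s r s' r' [t [x [t0 Sx -> ->]]] [t' [x' [t'0 Sx' -> ->]]].
  exists (t + t'), (x + x'); split; first exact: addr_ge0.
  + by have := SS 1 _ _ Sx Sx'; rewrite scale1r.
  + by rewrite scalerDl addrACA.
  + by rewrite mulrDl.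
- move=> t s r t0 [t' [x [t'0 Sx -> ->]]]; exists (t * t'), (t *: x).
  split; [exact: mulr_ge0|exact: SZ| |by rewrite mulrA].
  by rewrite scalerDr scalerA.
- by move=> s r [t [x [_ Sx -> _]]]; apply: DS => //; exact: SD.
- move=> s r [t [x [+ Sx -> ->]]]; rewrite le_eqVlt => /predU1P[<-|t0].
    by rewrite mul0r scale0r add0r; exact/p0/SD.
  have -> : t *: v + x = t *: (v + t^-1 *: x).
    by rewrite scalerDr scalerA mulfV ?gt_eqF// scale1r.
  rewrite sp.2 ?(ltW t0)//; last by apply/DD => //; exact/SD/SZ.
  by rewrite ler_pM2l//; exact/Sc/SZ.
exists l; split=> // [s Ss|].
  have h s' : S s' -> 0 <= l s'.
    move=> Ss'; apply: lK; exists 0, s'; rewrite scale0r add0r mul0r; split=> //.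
  apply/eqP; rewrite eq_le h// andbT.
  have l0 : l 0 = 0 by have := ll (-1) _ _ D0 D0; rewrite scaler0 addr0; lra.
  have := h _ (SZ (-1) _ Ss); have := ll (-1) _ _ (SD _ Ss) D0.
  rewrite addr0 l0; lra.
apply: (lt_le_trans c0); apply: lK; exists 1, 0.
by rewrite scale1r addr0 mul1r.
Qed.

End hahn_banach.

(** Induction over varying domains: the hypothesis is applied on the kernel of the last functional,
    and a vector [v] outside this kernel determines the last coefficient. *)
Lemma linear_combination_of_kernels (R : realType) (V : lmodType R)
    (D : V -> Prop) (phi : nat -> V -> R) (psi : V -> R) n :
  D 0 -> (forall a x y, D x -> D y -> D (a *: x + y)) ->
  (forall i, linear_on D (phi i)) -> linear_on D psi ->
  (forall x, D x -> (forall i, (i < n)%N -> phi i x = 0) -> psi x = 0) ->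
  exists c : nat -> R, forall x, D x -> psi x = \sum_(i < n) c i * phi i x.
Proof.
elim: n D => [|n IH] D D0 DS lphi lpsi psi0.
  by exists (fun=> 0) => x Dx; rewrite big_ord0 psi0.
pose D' x := D x /\ phi n x = 0.
have l0 (l : V -> R) : linear_on D l -> l 0 = 0.
  by move=> ll; have := ll (-1) _ _ D0 D0; rewrite scaler0 addr0; lra.
have [||||x [Dx phix]|c cP] := IH D'.
- by split=> //; exact: l0.
- move=> a x y [Dx x0] [Dy y0]; split; first exact: DS.
  by rewrite lphi// x0 y0 mulr0 addr0.
- by move=> i a x y [Dx _] [Dy _]; exact: lphi.
- by move=> a x y [Dx _] [Dy _]; exact: lpsi.
- move=> phi0; apply: psi0 => // i; rewrite ltnS leq_eqVlt => /predU1P[->//|].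
  exact: phi0.
have [[v [Dv v0]]|nv] := pselect (exists v, D v /\ phi n v != 0); last first.
  exists c => x Dx; have x0 : phi n x = 0.
    by apply/eqP/negPn/negP => x0; apply: nv; exists x.
  by rewrite big_ord_recr /= x0 mulr0 addr0; exact: cP.
pose b := (psi v - \sum_(i < n) c i * phi i v) / phi n v.
exists (fun i => if i == n then b else c i) => x Dx.
rewrite big_ord_recr /= eqxx.
under eq_bigr => i _ do rewrite (ltn_eqF (ltn_ord i)).
pose t := - (phi n x / phi n v).
have D'x : D' (t *: v + x).
  by split; [exact: DS|rewrite lphi// /t mulNr divfK// addNr].
have E : t * psi v + psi x =
    t * \sum_(i < n) c i * phi i v + \sum_(i < n) c i * phi i x.
  rewrite -lpsi// cP// mulr_sumr -big_split/=.
  by apply: eq_bigr => i _; rewrite lphi//; ring.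
have -> : psi x = t * \sum_(i < n) c i * phi i v +
                  \sum_(i < n) c i * phi i x - t * psi v by rewrite -E; ring.
rewrite /t /b; field.
exact: v0.
Qed.

(** * Ultrafilter limits and dual spaces *)

Section free_ultralimit.
Variable R : realType.

(** Only this consequence of a free ultrafilter is kept: finitely many bounded sequences are
    simultaneously close to their limits at some arbitrarily late index. Linearity, bounds and the
    value on eventually constant sequences follow from it. *)
Lemma free_ultralimit : exists LIM : (nat -> R) -> R,
  forall (m N : nat) (a : nat -> nat -> R) (e : R), 0 < e ->
    (forall i, (i < m)%N -> exists C : R, forall n, `|a i n| <= C) ->
    exists n, (N <= n)%N /\ forall i, (i < m)%N -> `|a i n - LIM (a i)| < e.
Proof.
have [U [UU leU]] := ultraFilterLemma eventually_filter.
have Uge N : U [set n | (N <= n)%N] by apply: leU; exists N.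
pose conv (a : nat -> R) (p : R) := forall e : R, 0 < e -> U [set n | `|a n - p| < e].
have convex a : (exists C : R, forall n, `|a n| <= C) -> exists p, conv a p.
  move=> [C aC].
  have aK : (a @ U) [set` `[- C, C]].
    rewrite /fmap /=; apply: (@filterS _ _ _ setT) filterT => n _ /=.
    by rewrite in_itv /= -ler_norml.
  have [p [_ clp]] := @segment_compact R (- C) C (a @ U) _ aK.
  exists p => e e0; have [//|UC] := in_ultra_setVsetC [set n | `|a n - p| < e] UU.
  have [x [/= Ux Bx]] := clp [set y | ~ `|y - p| < e] (ball p e)
    (filterS (fun n h => h) UC) (nbhsx_ballx p _ e0).
  by case: Ux; rewrite distrC; exact: Bx.
have /choice[LIM LIMP] : forall a, exists p, (exists C : R, forall n, `|a n| <= C) -> conv a p.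
  move=> a; have [/convex[p cp]|h] := pselect (exists C : R, forall n, `|a n| <= C).
    by exists p.
  by exists 0 => /h.
exists LIM => m N a e e0 ab.
suff Um : U [set n | (N <= n)%N /\ forall i, (i < m)%N -> `|a i n - LIM (a i)| < e].
  by have [n [Nn nP]] := filter_ex Um; exists n.
elim: m ab => [|m IH] ab.
  by apply: filterS (Uge N) => n Nn; split.
have Im := LIMP _ (ab m (ltnSn m)) _ e0.
have {}IH := IH (fun i h => ab i (leqW h)).
apply: filterS (filterI Im IH) => n /= [nm [Nn nP]]; split=> // i.
by rewrite ltnS leq_eqVlt => /predU1P[->//|]; exact: nP.
Qed.

Definition ulim : (nat -> R) -> R := projT1 (cid free_ultralimit).

Lemma ulim_approx (m N : nat) (a : nat -> nat -> R) (e : R) : 0 < e ->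
    (forall i, (i < m)%N -> exists C : R, forall n, `|a i n| <= C) ->
    exists n, (N <= n)%N /\ forall i, (i < m)%N -> `|a i n - ulim (a i)| < e.
Proof. exact: (projT2 (cid free_ultralimit)). Qed.

Lemma ulim_linear (c : R) (a b : nat -> R) C C' :
  (forall n, `|a n| <= C) -> (forall n, `|b n| <= C') ->
  ulim (fun n => c * a n + b n) = c * ulim a + ulim b.
Proof.
move=> aC bC.
pose s i := if i is 0 then fun n => c * a n + b n else if i is 1 then a else b.
have sb i : (i < 3)%N -> exists C : R, forall n, `|s i n| <= C.
  case: i => [_|[_|[_|//]]]; [|by exists C|by exists C'].
  exists (`|c| * C + C') => n; apply: le_trans (ler_normD _ _) _.
  by rewrite normrM lerD// ler_wpM2l.
apply/eqP; rewrite -subr_eq0 -normr_le0; apply/ler_addgt0Pr => e e0.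
rewrite add0r; pose d := e / (`|c| + 2).
have cd : (`|c| + 2) * d = e by rewrite mulrC divfK// gt_eqF// ltr_wpDl.
have d0 : 0 < d by rewrite divr_gt0// ltr_wpDl.
have [n [_ nP]] := ulim_approx 0 d0 sb.
have := nP 0 isT; have /= h1 := nP 1 isT; have /= := nP 2 isT.
have : `|c * (a n - ulim a)| <= `|c| * d by rewrite normrM ler_wpM2l// ltW.
rewrite /= !(ler_norml, ltr_norml) => /andP[? ?] /andP[? ?] /andP[? ?].
apply/andP; split; lra.
Qed.

Lemma ulim_frequently (a : nat -> R) C e : 0 < e ->
  (forall n, `|a n| <= C) -> forall N, exists n, (N <= n)%N /\ `|a n - ulim a| < e.
Proof.
move=> e0 aC N; have [|n [Nn /(_ 0 isT)]] := @ulim_approx 1 N (fun=> a) e e0.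
  by move=> i _; exists C.
by exists n.
Qed.

End free_ultralimit.

Section linear_maps.
Variables (R : realType) (V W : lmodType R) (T : V -> W).
Hypothesis Tlin : is_linear_map T.

Lemma linear_map0 : T 0 = 0.
Proof. by have := Tlin (-1) 0 0; rewrite scaler0 addr0 scaleN1r addNr. Qed.

Lemma linear_mapD x y : T (x + y) = T x + T y.
Proof. by rewrite -[x]scale1r Tlin !scale1r. Qed.

Lemma linear_mapZ a x : T (a *: x) = a *: T x.
Proof. by rewrite -[_ *: x]addr0 Tlin linear_map0 addr0. Qed.

Lemma linear_mapN x : T (- x) = - T x.
Proof. by rewrite -scaleN1r linear_mapZ scaleN1r. Qed.

Lemma linear_mapB x y : T (x - y) = T x - T y.
Proof. by rewrite linear_mapD linear_mapN. Qed.

Lemma linear_map_sum (I : Type) (r : seq I) (P : pred I) (F : I -> V) :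
  T (\sum_(i <- r | P i) F i) = \sum_(i <- r | P i) T (F i).
Proof. by apply: big_morph; [exact: linear_mapD|exact: linear_map0]. Qed.

End linear_maps.

Lemma bounded_operator (R : realType) (V W : normedModType R) (T : V -> W) :
  is_linear_map T ->
  continuous T <-> exists C : R, 0 <= C /\ forall x, `|T x| <= C * `|x|.
Proof.
move=> Tlin; pose Tl : {linear V -> W} := HB.pack T (GRing.isLinear.Build _ _ _ _ T Tlin).
split=> [Tc|[C [C0 TC]]].
  have /linear_boundedP[r [_ rP]] : bounded_near Tl (nbhs 0).
    by apply: (@continuous_linear_bounded _ _ _ 0 Tl); exact: Tc.
  exists (`|r| + 1); split=> [|x]; first by rewrite addr_ge0.
  by apply: (rP (`|r| + 1)); rewrite (le_lt_trans (ler_norm r))// ltrDl.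
apply: (@bounded_linear_continuous _ _ _ Tl).
apply/linear_boundedP; exists C; split; first exact: num_real.
by move=> r Cr x /=; apply: le_trans (TC x) _; rewrite ler_wpM2r// ltW.
Qed.

Section duality.
Variables (R : realType) (E : completeNormedModType R).
Implicit Types (f g : E -> R) (x y : E).

Lemma is_dualP f : is_dual f <->
  is_linear_map (f : E -> R^o) /\ exists C : R, 0 <= C /\ forall x, `|f x| <= C * `|x|.
Proof.
split=> [[fl fc]|[fl fC]]; split=> //.
  exact: (@bounded_operator R E R^o f fl).1.
exact: (@bounded_operator R E R^o f fl).2.
Qed.

Lemma bounded_is_dual f C : 0 <= C -> (forall a x y, f (a *: x + y) = a * f x + f y) ->
  (forall x, `|f x| <= C * `|x|) -> is_dual f.
Proof. by move=> C0 fl fC; apply/is_dualP; split; [exact: fl|exists C]. Qed.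

Section dual_facts.
Variable f : E -> R.
Hypothesis Df : is_dual f.

Lemma dual0 : f 0 = 0. Proof. exact: (linear_map0 Df.1). Qed.
Lemma dualD x y : f (x + y) = f x + f y. Proof. exact: (linear_mapD Df.1). Qed.
Lemma dualZ a x : f (a *: x) = a * f x. Proof. exact: (linear_mapZ Df.1). Qed.
Lemma dualN x : f (- x) = - f x. Proof. exact: (linear_mapN Df.1). Qed.
Lemma dualB x y : f (x - y) = f x - f y. Proof. exact: (linear_mapB Df.1). Qed.
Lemma dual_sum (I : Type) (r : seq I) (P : pred I) (F : I -> E) :
  f (\sum_(i <- r | P i) F i) = \sum_(i <- r | P i) f (F i).
Proof. exact: (linear_map_sum Df.1). Qed.

Lemma dual_cvg (u : nat -> E) l : u @ \oo --> l -> (fun n => f (u n)) @ \oo --> f l.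
Proof. by move=> ul; apply: cvg_comp ul _; exact: Df.2. Qed.

Let norm_ub : has_sup [set `|f x| | x in [set x : E | `|x| <= 1]].
Proof.
split; first by exists `|f 0|, 0; rewrite //= normr0.
have [_ [C [C0 fC]]] := (is_dualP f).1 Df.
by exists C => _ [x /= x1 <-]; apply: le_trans (fC x) _; rewrite ler_piMr.
Qed.

Lemma dual_norm_ge0 : 0 <= dual_norm f.
Proof.
apply: le_trans (normr_ge0 (f 0)) (ub_le_sup norm_ub.2 _).
by exists 0; rewrite //= normr0.
Qed.

Lemma dual_normP x : `|f x| <= dual_norm f * `|x|.
Proof.
have [->|x0] := eqVneq x 0; first by rewrite dual0 !normr0 mulr0.
have nx : 0 < `|x| by rewrite normr_gt0.
rewrite -ler_pdivrMr//; apply: (ub_le_sup norm_ub.2).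
exists (`|x|^-1 *: x) => /=.
  by rewrite normrZ ger0_norm ?invr_ge0// mulVf// gt_eqF.
by rewrite dualZ normrM ger0_norm ?invr_ge0// mulrC.
Qed.

Lemma dual_norm_le C : (forall x, `|x| <= 1 -> `|f x| <= C) -> dual_norm f <= C.
Proof.
move=> fC; apply: sup_le_ub; first by case: norm_ub.
by move=> _ [x /= x1 <-]; exact: fC.
Qed.

Lemma dual_norm_adherent e : 0 < e -> exists x, `|x| <= 1 /\ dual_norm f - e < f x.
Proof.
move=> e0; have [_ [x /= x1 <-] fx] := sup_adherent e0 norm_ub.
have [h|h] := leP 0 (f x); first by exists x; rewrite -(ger0_norm h).
by exists (- x); rewrite normrN dualN -(ltr0_norm h).
Qed.

End dual_facts.

Lemma dual_comb a f g : is_dual f -> is_dual g -> is_dual (fun x => a * f x + g x).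
Proof.
move=> Df Dg; apply: (@bounded_is_dual _ (`|a| * dual_norm f + dual_norm g)).
- by rewrite addr_ge0 ?mulr_ge0 ?dual_norm_ge0.
- by move=> b x y; rewrite !(dualD Df) !(dualD Dg) (dualZ Df) (dualZ Dg); ring.
move=> x; apply: le_trans (ler_normD _ _) _.
rewrite normrM mulrDl -mulrA lerD ?ler_wpM2l//; exact: dual_normP.
Qed.

Lemma dual_zero : is_dual (fun _ : E => 0 : R).
Proof.
apply: (@bounded_is_dual _ 0) => // [a x y|x]; first by rewrite addr0 mulr0.
by rewrite normr0 mul0r.
Qed.

Lemma dual_scale a f : is_dual f -> is_dual (fun x => a * f x).
Proof.
move=> Df; have := dual_comb a Df dual_zero.
by under eq_fun => x do rewrite addr0.
Qed.

Lemma dual_sub f g : is_dual f -> is_dual g -> is_dual (fun x => f x - g x).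
Proof.
move=> Df Dg; have := dual_comb (-1) Dg Df.
by under eq_fun => x do rewrite mulN1r addrC.
Qed.

Lemma dual_norm_sublinear : sublinear_on (@is_dual R E : (E -> R^o) -> Prop) (@dual_norm R E).
Proof.
split=> [f g Df Dg|t f t0 Df].
  have Dfg : is_dual (f + g).
    by have := dual_comb 1 Df Dg; under eq_fun => x do rewrite mul1r.
  apply: (dual_norm_le Dfg) => x x1; apply: le_trans (ler_normD _ _) _.
  have := dual_normP Df x; have := dual_normP Dg x.
  have := ler_piMr (dual_norm_ge0 Df) x1; have := ler_piMr (dual_norm_ge0 Dg) x1; lra.
have Dt : is_dual (t *: f : E -> R^o) by exact: dual_scale.
have le s h : 0 <= s -> is_dual h -> dual_norm (s *: h : E -> R^o) <= s * dual_norm h.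
  move=> s0 Dh; have Ds : is_dual (s *: h : E -> R^o) by exact: dual_scale.
  apply: (dual_norm_le Ds) => x x1; rewrite normrM ger0_norm// ler_wpM2l//.
  by apply: le_trans (dual_normP Dh x) _; rewrite ler_piMr ?dual_norm_ge0.
apply/eqP; rewrite eq_le le//=.
have [tE|tn0] := eqVneq t 0.
  by rewrite {1}tE mul0r; exact: dual_norm_ge0.
have {}t0 : 0 < t by rewrite lt_def tn0.
rewrite mulrC -ler_pdivlMr// mulrC.
have -> : dual_norm f = dual_norm (t^-1 *: (t *: f) : E -> R^o).
  by rewrite scalerA mulVf ?gt_eqF// scale1r.
by apply: le => //; rewrite invr_ge0 ltW.
Qed.

Lemma sublinear_minorant_dual (l : E -> R) C :
  linear_on (fun=> True) l -> (forall x, l x <= C * `|x|) -> is_dual l.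
Proof.
move=> ll lC; have lin : is_linear_map (l : E -> R^o) by move=> a x y; exact: ll.
apply: (@bounded_is_dual _ `|C|) => // x.
rewrite ler_norml; apply/andP; split.
  have := lC (- x); rewrite (linear_mapN lin) normrN => h.
  by rewrite lerNl; apply: le_trans h _; rewrite ler_wpM2r// ler_norm.
by apply: le_trans (lC x) _; rewrite ler_wpM2r// ler_norm.
Qed.

Lemma functional_attaining (p : E -> R) (v : E) C :
  sublinear_on (fun=> True) p -> (forall x, p x <= C * `|x|) ->
  (forall t, 0 <= t -> - (t * p v) <= p (- (t *: v))) ->
  exists f, [/\ is_dual f, forall x, f x <= p x & f v = p v].
Proof.
move=> sp pC pv.
pose K s r := exists t, [/\ 0 <= t, s = t *: v & r = t * p v].
have [||||||||l [ll lp lK]] := @Mazur_Orlicz R E (fun=> True) _ _ p K => //.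
- by exists 0; rewrite scale0r mul0r.
- move=> s r s' r' [t [t0 -> ->]] [t' [t'0 -> ->]]; exists (t + t').
  by rewrite addr_ge0// scalerDl mulrDl.
- move=> t s r t0 [t' [t'0 -> ->]]; exists (t * t').
  by rewrite mulr_ge0// scalerA mulrA.
- by move=> s r [t [t0 -> ->]]; rewrite sp.2.
exists l; split; [|by move=> x; exact: lp|].
  by apply: (@sublinear_minorant_dual l C) => // x; exact: le_trans (lp x I) (pC x).
apply/eqP; rewrite eq_le lp//=; apply: lK; exists 1.
by rewrite scale1r mul1r.
Qed.

Lemma norm_sublinear : sublinear_on (fun=> True) (fun x : E => `|x|).
Proof. by split=> [x y _ _|t x t0 _]; [exact: ler_normD|rewrite normrZ ger0_norm]. Qed.

Lemma norming_functional (v : E) :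
  exists f, [/\ is_dual f, forall x, `|f x| <= `|x| & f v = `|v|].
Proof.
have [|t t0|f [Df fn fv]] := @functional_attaining _ v 1 norm_sublinear.
- by move=> x; rewrite mul1r.
- by rewrite normrN normrZ ger0_norm// lerNl (le_trans _ (mulr_ge0 t0 (normr_ge0 v)))// oppr_le0 mulr_ge0.
exists f; split=> // x; rewrite ler_norml fn andbT lerNl -(dualN Df) -normrN.
exact: fn.
Qed.

Lemma annihilator (S : E -> Prop) (v : E) (c : R) :
  S 0 -> (forall a x y, S x -> S y -> S (a *: x + y)) -> 0 < c ->
  (forall s, S s -> c <= `|v - s|) ->
  exists f, [/\ is_dual f, forall x, `|f x| <= `|x|, forall s, S s -> f s = 0 & 0 < f v].
Proof.
move=> S0 SS c0 Sc.
have [||||s Ss|l [ll lp lS lv]] :=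
  @separation_from_subspace R E (fun=> True) I (fun _ _ _ _ _ => I) _ S v c norm_sublinear S0 SS => //.
  rewrite -[s]opprK; apply: Sc; rewrite -scaleN1r -[_ *: _]addr0; exact: SS.
have Dl : is_dual l by apply: (@sublinear_minorant_dual l 1) => // x; rewrite mul1r; exact: lp.
exists l; split=> // x; rewrite ler_norml lp// andbT lerNl -(dualN Dl) -normrN.
exact: lp.
Qed.

End duality.

(** * Series and uniform boundedness *)

Section sequences_eps.
Variables (R : realType) (V : normedModType R).
Implicit Types (u : nat -> V) (l : V).

Lemma cvg_seqP u l : u @ \oo --> l <->
  forall e : R, 0 < e -> exists N, forall n, (N <= n)%N -> `|u n - l| <= e.
Proof.
split=> [/cvgrPdist_le h e e0|h].
  by have [N _ hN] := h e e0; exists N => n /hN /=; rewrite distrC.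
apply/cvgrPdist_le => e e0; have [N hN] := h e e0.
by exists N => // n /= /hN; rewrite distrC.
Qed.

Lemma cvg_seqZD (a : R) u l v l' : u @ \oo --> l -> v @ \oo --> l' ->
  (fun n => a *: u n + v n) @ \oo --> a *: l + l'.
Proof. by move=> ul vl; apply: cvgD => //; apply: cvgZ => //; exact: cvg_cst. Qed.

Lemma cvg_seq_unique u l l' : u @ \oo --> l -> u @ \oo --> l' -> l = l'.
Proof. by move=> ul ul'; apply: cvg_unique ul ul'; exact: norm_hausdorff. Qed.

End sequences_eps.

Section geometric.
Variable R : realType.

Lemma bounded_nat_absurd (C : R) : ~ forall j : nat, j%:R <= C.
Proof.
move=> h; have := h (Num.bound C).
by rewrite leNgt archi_boundP// (le_trans (ler0n _ 0) (h 0%N)).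
Qed.

Lemma half_pow_gt0 n : 0 < (2^-1 : R) ^+ n.
Proof. by rewrite exprn_gt0// invr_gt0. Qed.

Lemma half_pow_small (C e : R) : 0 < e -> exists N, forall n, (N <= n)%N -> C * 2^-1 ^+ n <= e.
Proof.
move=> e0.
have /cvg_seqP : (fun n => C * 2^-1 ^+ n) @ \oo --> (0 : R).
  by apply: cvg_geometric; rewrite ger0_norm ?invr_ge0// invf_lt1// ltr1n.
move=> /(_ e e0)[N hN]; exists N => n /hN; rewrite subr0 => h.
exact: le_trans (ler_norm _) h.
Qed.

Lemma half_powS n : (2^-1 : R) ^+ n = 2^-1 ^+ n.+1 + 2^-1 ^+ n.+1.
Proof. by rewrite exprS; field. Qed.

Lemma geometric_dist (V : normedModType R) (u : nat -> V) (K : R) :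
  (forall n, `|u n.+1 - u n| <= K * 2^-1 ^+ n) ->
  forall n m, (n <= m)%N -> `|u m - u n| <= 2 * K * 2^-1 ^+ n.
Proof.
move=> uK n m /subnK <-; set k := (m - n)%N.
suff : `|u (k + n)%N - u n| <= 2 * K * (2^-1 ^+ n - 2^-1 ^+ (k + n)).
  have K0 : 0 <= K.
    by have := le_trans (normr_ge0 _) (uK 0%N); rewrite expr0 mulr1.
  move=> h; apply: le_trans h _; apply: ler_wpM2l; first by rewrite mulr_ge0.
  by rewrite gerBl ltW// half_pow_gt0.
elim: k => [|k IH]; first by rewrite add0n !subrr normr0 mulr0.
have -> : u (k.+1 + n)%N - u n = (u (k + n).+1 - u (k + n)%N) + (u (k + n)%N - u n).
  by rewrite addSn addrA subrK.
apply: le_trans (ler_normD _ _) _; have := uK (k + n)%N.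
have -> : 2^-1 ^+ (k.+1 + n) = 2^-1 * 2^-1 ^+ (k + n) :> R by rewrite addSn exprS.
move: IH; move: (`|_|) => a; move: (`|_|) => b; set h := 2^-1 ^+ (k + n).
lra.
Qed.

End geometric.

Lemma cauchy_seq_cvg (R : realType) (V : completeNormedModType R) (u : nat -> V) :
  (forall e : R, 0 < e -> exists N, forall n m, (N <= n)%N -> (N <= m)%N ->
     `|u n - u m| <= e) -> exists l : V, u @ \oo --> l.
Proof.
move=> cu; suff /cvg_ex[l ul] : cvg (u @ \oo) by exists l.
apply/cauchy_cvgP; apply/cauchy_exP => e e0.
have e20 : 0 < e / 2 by rewrite divr_gt0.
have [N hN] := cu _ e20; exists (u N); exists N => // n /= Nn.
rewrite -ball_normE /=; apply: le_lt_trans (hN _ _ (leqnn N) Nn) _.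
by rewrite ltr_pdivrMr// ltr_pMr// ltr1n.
Qed.

Lemma geometric_cvg (R : realType) (V : completeNormedModType R) (u : nat -> V) (K : R) :
  (forall n, `|u n.+1 - u n| <= K * 2^-1 ^+ n) -> exists l : V, u @ \oo --> l.
Proof.
move=> uK; apply: cauchy_seq_cvg => e e0.
have [N hN] := half_pow_small (4 * K) e0; exists N => n m Nn Nm.
have -> : u n - u m = (u n - u N) - (u m - u N) by rewrite opprB addrA subrK.
apply: le_trans (ler_normB _ _) _.
have := hN N (leqnn N); have := geometric_dist uK Nn; have := geometric_dist uK Nm.
lra.
Qed.

Lemma cvg_norm_le (R : realType) (V : normedModType R) (u : nat -> V) l (C : R) :
  u @ \oo --> l -> (exists N, forall n, (N <= n)%N -> `|u n| <= C) -> `|l| <= C.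
Proof.
move=> /cvg_seqP ul [N hN]; apply/ler_addgt0Pr => e e0.
have [M hM] := ul _ e0.
have := hN _ (leq_maxl N M); have := hM _ (leq_maxr N M).
set m := maxn N M => h1 h2.
have -> : l = u m - (u m - l) by rewrite opprB addrC subrK.
by apply: le_trans (ler_normB _ _) _; rewrite lerD.
Qed.

Section uniform_boundedness.
Variable R : realType.

Lemma ler_norm_same_sign (x y : R) : 0 <= x * y -> `|y| <= `|x + y|.
Proof.
move=> xy; have [y0|y0|->] := ltgtP y 0; last by rewrite normr0.
  have x0 : x <= 0 by rewrite -(nmulr_lge0 _ y0).
  rewrite ltr0_norm// ler0_norm; lra.
have x0 : 0 <= x by rewrite -(pmulr_lge0 _ y0).
rewrite gtr0_norm// ger0_norm; lra.
Qed.

(* Choosing the signs of the terms one at a time keeps the partial sum of the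
   n-th row at least as large as its n-th term; the later terms are too small
   to compensate (A. Sokal's gliding-hump proof). *)
Lemma signed_series (b : nat -> nat -> R) (N : nat -> R) :
  (forall n i, `|b n i| <= N n) -> (forall n, 3 / 4 * N n <= `|b n n|) ->
  exists s : nat -> R, (forall i, `|s i| <= 4^-1 ^+ i) /\
    forall n m, (n < m)%N -> 4^-1 * 4^-1 ^+ n * N n <= `|\sum_(i < m) s i * b n i|.
Proof.
move=> bN bnn.
have q0 n : 0 < (4^-1 : R) ^+ n by rewrite exprn_gt0// invr_gt0.
pose P n (s : nat -> R) t := `|t| <= 4^-1 ^+ n /\
  4^-1 ^+ n * `|b n n| <= `|\sum_(i < n) s i * b n i + t * b n n|.
have [||s sP] := @history_choice R 0 P.
- rewrite /P => n s _; set S := \sum_(i < n) _.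
  have [h|h] := leP 0 (S * b n n).
    exists (4^-1 ^+ n); split; first by rewrite ger0_norm// ltW.
    rewrite -{1}(ger0_norm (ltW (q0 n))) -normrM ler_norm_same_sign//.
    by rewrite mulrCA mulr_ge0// ltW.
  exists (- 4^-1 ^+ n); split; first by rewrite normrN ger0_norm// ltW.
  rewrite -{1}(ger0_norm (ltW (q0 n))) -normrM -normrN -mulNr ler_norm_same_sign//.
  by rewrite mulrCA mulr_le0// ?oppr_le0 ltW.
- move=> n s s' t ss' [t1 t2]; split=> //; apply: le_trans t2 _.
  rewrite le_eqVlt; apply/orP; left; apply/eqP; congr (`|_ + _|).
  by apply: eq_bigr => i _; rewrite ss'.
exists s; split=> [i|n m nm]; first by case: (sP i).
have N0 : 0 <= N n by apply: le_trans (bN n n).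
have tail k : `|\sum_(i < k + n.+1) s i * b n i - \sum_(i < n.+1) s i * b n i| <=
    (4^-1 ^+ n - 4^-1 ^+ (k + n)) / 3 * N n.
  elim: k => [|k IH]; first by rewrite !add0n !subrr normr0 !mul0r.
  rewrite addSn big_ord_recr/= addrAC; apply: le_trans (ler_normD _ _) _.
  have : `|s (k + n.+1)%N * b n (k + n.+1)%N| <= 4^-1 ^+ (k + n).+1 * N n.
    rewrite normrM ler_pM// -addnS; by case: (sP (k + n.+1)%N).
  rewrite addSn !exprS; move: IH; set a := `|_|; set c := `|_|.
  set x := 4^-1 ^+ n; set y := 4^-1 ^+ (k + n) => h1 h2.
  apply: le_trans (lerD h1 h2) _; rewrite -mulrDl ler_wpM2r//; lra.
have := tail (m - n.+1)%N; rewrite subnK//.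
have [_] : P n s (s n) := sP n; rewrite /P; have := ler_wpM2l (ltW (q0 n)) (bnn n).
have -> : \sum_(i < n) s i * b n i + s n * b n n = \sum_(i < n.+1) s i * b n i.
  by rewrite big_ord_recr.
set A := \sum_(i < m) _; set B := \sum_(i < n.+1) _ => h1 h2 h3.
have h4 : `|B| <= `|A| + `|A - B|.
  by have := ler_normB A (A - B); rewrite opprB addrC subrK.
have h5 : (4^-1 ^+ n - 4^-1 ^+ (m - n.+1 + n)) / 3 * N n <= 4^-1 ^+ n / 3 * N n.
  by rewrite ler_wpM2r// ler_pM2r ?invr_gt0// gerBl ltW.
have : 0 <= 4^-1 ^+ n * N n by rewrite mulr_ge0// ltW.
move: h1 h2 h3 h4 h5; set x := 4^-1 ^+ n; move: (`|A|) (`|B|) (`|A - B|) => a b' c.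
set y := _ / 3 * _; nra.
Qed.

Lemma quarter_le_half i : (4^-1 : R) ^+ i <= 2^-1 ^+ i.
Proof. by rewrite lerXn2r ?nnegrE ?invr_ge0// lef_pV2 ?posrE// ler_nat. Qed.

Variable E : completeNormedModType R.

(** Otherwise some [f (k j)] have norm at least [j * 4 ^ j]. Their nearly norming vectors, summed
    with the coefficients of [signed_series], which are of size [4 ^ -j], give a point where
    [f (k j)] is at least [j / 4] in modulus. *)
Lemma dual_pointwise_bounded (f : nat -> E -> R) : (forall n, is_dual (f n)) ->
  (forall x, exists C : R, forall n, `|f n x| <= C) ->
  exists M : R, 0 <= M /\ forall n x, `|f n x| <= M * `|x|.
Proof.
move=> Df fb; apply: contrapT => nM.
have /choice[k kP] : forall j : nat, exists n, j%:R * 4 ^+ j <= dual_norm (f n).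
  move=> j; apply: contrapT => nj; apply: nM; exists (j%:R * 4 ^+ j).
  split=> [|n x]; first by rewrite mulr_ge0// exprn_ge0.
  apply: le_trans (dual_normP (Df n) x) _; rewrite ler_wpM2r//.
  by rewrite leNgt; apply/negP => /ltW h; apply: nj; exists n.
have Nk0 j : 0 <= dual_norm (f (k j)) by exact: dual_norm_ge0.
have /choice[y yP] : forall j, exists x, `|x| <= 1 /\ 3 / 4 * dual_norm (f (k j)) <= `|f (k j) x|.
  move=> j; have [N0|N0] := eqVneq (dual_norm (f (k j))) 0.
    by exists 0; rewrite normr0 N0 mulr0.
  have Np : 0 < dual_norm (f (k j)) / 4 by rewrite divr_gt0// lt_def N0 Nk0.
  have [x [x1 fx]] := dual_norm_adherent (Df (k j)) Np; exists x; split=> //.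
  apply: le_trans (ler_norm _); lra.
have [||s [s4 sP]] := @signed_series (fun j i => f (k j) (y i)) (fun j => dual_norm (f (k j))).
- move=> j i; apply: le_trans (dual_normP (Df _) _) _.
  by rewrite ler_piMr//; case: (yP i).
- by move=> j; case: (yP j).
have [x xl] : exists x : E, (fun m => \sum_(i < m) s i *: y i) @ \oo --> x.
  apply: (@geometric_cvg _ _ _ 1) => n; rewrite big_ord_recr/= addrAC subrr add0r.
  rewrite mul1r normrZ; apply: le_trans (quarter_le_half n).
  by apply: le_trans (s4 n); rewrite ler_piMr//; case: (yP n).
have [C xC] := fb x.
have big j : j%:R <= 4 * C.
  have h1 : 4^-1 * 4^-1 ^+ j * dual_norm (f (k j)) <= C + 0.
    apply/ler_addgt0Pr => e e0; rewrite addr0.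
    have /cvg_seqP/(_ e e0)[N hN] := dual_cvg (Df (k j)) xl.
    have := hN _ (leq_maxl N j.+1); rewrite /= (dual_sum (Df _)).
    under eq_bigr => i _ do rewrite (dualZ (Df _)).
    have := sP j _ (leq_maxr N j.+1); set S := \sum_(i < _) _ => h2 h3.
    apply: le_trans h2 _; rewrite -[S](subrK (f (k j) x)).
    by apply: le_trans (ler_normD _ _) _; rewrite addrC lerD.
  have h4 : j%:R = 4^-1 ^+ j * (j%:R * 4 ^+ j) :> R.
    by rewrite mulrCA -exprMn mulVf// expr1n mulr1.
  have h5 : 4^-1 ^+ j * (j%:R * 4 ^+ j) <= 4^-1 ^+ j * dual_norm (f (k j)).
    by rewrite ler_wpM2l ?exprn_ge0 ?invr_ge0.
  rewrite h4; lra.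
exact: (bounded_nat_absurd big).
Qed.

Lemma dual_geometric_series (h : nat -> E -> R) (s : nat -> R) :
  (forall i, is_dual (h i)) -> (forall i z, `|h i z| <= `|z|) ->
  (forall i, `|s i| <= 2^-1 ^+ i) ->
  exists f, is_dual f /\ forall z, (fun n => \sum_(i < n) s i * h i z) @ \oo --> f z.
Proof.
move=> Dh h1 s2.
have inc z n : `|\sum_(i < n.+1) s i * h i z - \sum_(i < n) s i * h i z| <= `|z| * 2^-1 ^+ n.
  by rewrite big_ord_recr/= addrAC subrr add0r normrM mulrC ler_pM.
have /choice[f fl] : forall z, exists l : R, (fun m => \sum_(i < m) s i * h i z) @ \oo --> l.
  by move=> z; apply: (@geometric_cvg R R^o _ `|z|); exact: inc.
exists f; split=> //; apply: (@bounded_is_dual _ _ _ 2) => // [a y z|z].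
  have lin m : a * (\sum_(i < m) s i * h i y) + \sum_(i < m) s i * h i z =
      \sum_(i < m) s i * h i (a *: y + z).
    rewrite mulr_sumr -big_split/=; apply: eq_bigr => i _.
    by rewrite (dualD (Dh i)) (dualZ (Dh i)); ring.
  have := @cvg_seqZD R R^o a _ _ _ _ (fl y) (fl z).
  have -> : (fun m => (a : R) *: ((\sum_(i < m) s i * h i y) : R^o) + (\sum_(i < m) s i * h i z : R^o))
     = (fun m => \sum_(i < m) s i * h i (a *: y + z)) by apply/funext => m; exact: lin.
  exact: (@cvg_seq_unique R R^o _ _ _ (fl (a *: y + z))).
apply: (@cvg_norm_le R R^o _ _ _ (fl z)); exists 0%N => n _.
have := @geometric_dist R R^o (fun m => \sum_(i < m) s i * h i z) `|z| (inc z) 0 n (leq0n n).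
by rewrite big_ord0 subr0 expr0 mulr1.
Qed.

(** The same hump with the roles exchanged: norming functionals of a rapidly growing subsequence are
    summed into one functional that is unbounded on it. *)
Lemma weakly_bounded (x : nat -> E) :
  (forall f, is_dual f -> exists C : R, forall n, `|f (x n)| <= C) ->
  exists M : R, 0 <= M /\ forall n, `|x n| <= M.
Proof.
move=> xb; apply: contrapT => nM.
have /choice[k kP] : forall j : nat, exists n, j%:R * 4 ^+ j <= `|x n|.
  move=> j; apply: contrapT => nj; apply: nM; exists (j%:R * 4 ^+ j).
  split=> [|n]; first by rewrite mulr_ge0// exprn_ge0.
  by rewrite leNgt; apply/negP => /ltW h; apply: nj; exists n.
have /choice[h hP] : forall j, exists f, [/\ is_dual f, forall z, `|f z| <= `|z| &
    f (x (k j)) = `|x (k j)|].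
  by move=> j; exact: norming_functional.
have [||s [s4 sP]] := @signed_series (fun j i => h i (x (k j))) (fun j => `|x (k j)|).
- by move=> j i; case: (hP i).
- move=> j; case: (hP j) => _ _ ->; rewrite normr_id ler_piMl//; lra.
have [|||f [Df fl]] := @dual_geometric_series h s.
- by move=> i; case: (hP i).
- by move=> i; case: (hP i).
- by move=> i; exact: le_trans (s4 i) (quarter_le_half i).
have [C fC] := xb f Df.
have big j : j%:R <= 4 * C.
  have h1 : 4^-1 * 4^-1 ^+ j * `|x (k j)| <= C + 0.
    apply/ler_addgt0Pr => e e0; rewrite addr0.
    have /(@cvg_seqP R R^o)/(_ e e0)[N hN] := fl (x (k j)).
    have := hN _ (leq_maxl N j.+1).
    have := sP j _ (leq_maxr N j.+1); set S := \sum_(i < _) _ => h2 h3.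
    apply: le_trans h2 _; rewrite -[S](subrK (f (x (k j)))).
    by apply: le_trans (ler_normD _ _) _; rewrite addrC lerD.
  have h4 : j%:R = 4^-1 ^+ j * (j%:R * 4 ^+ j) :> R.
    by rewrite mulrCA -exprMn mulVf// expr1n mulr1.
  have h5 : 4^-1 ^+ j * (j%:R * 4 ^+ j) <= 4^-1 ^+ j * `|x (k j)|.
    by rewrite ler_wpM2l ?exprn_ge0 ?invr_ge0.
  rewrite h4; lra.
exact: (bounded_nat_absurd big).
Qed.

End uniform_boundedness.

(** * Vector lattice inequalities *)

Section vector_lattice.
Variables (R : realType) (E : completeNormedModType R) (L : lattice_ops E).
Hypothesis HL : is_banach_lattice L.
Implicit Types x y z u : E.

Local Notation "x [<=] y" := (lle L x y) (at level 70, no associativity).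
Local Notation "x [\/] y" := (ljoin L x y) (at level 50, left associativity).
Local Notation "x [/\] y" := (lmeet L x y) (at level 48, left associativity).

Lemma lle_refl x : x [<=] x. Proof. by case: HL.1. Qed.
Lemma lle_anti x y : x [<=] y -> y [<=] x -> x = y. Proof. by case: HL.1 => _ + _; apply. Qed.
Lemma lle_trans y x z : x [<=] y -> y [<=] z -> x [<=] z.
Proof. by case: HL.1 => _ _; apply. Qed.
Lemma lle_addr z x y : x [<=] y -> x + z [<=] y + z.
Proof. by case: HL.2 => + _ _ _; apply. Qed.
Lemma lle_scale (a : R) x y : 0 <= a -> x [<=] y -> a *: x [<=] a *: y.
Proof. by case: HL.2 => _ + _ _; apply. Qed.
Lemma ljoinl x y : x [<=] x [\/] y. Proof. by case: HL.2 => _ _ /(_ x y)[]. Qed.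
Lemma ljoinr x y : y [<=] x [\/] y. Proof. by case: HL.2 => _ _ /(_ x y)[_ []]. Qed.
Lemma ljoin_lub x y z : x [<=] z -> y [<=] z -> x [\/] y [<=] z.
Proof. by case: HL.2 => _ _ /(_ x y)[_ [_ +]] _; apply. Qed.
Lemma lnorm_mono x y : labs L x [<=] labs L y -> `|x| <= `|y|.
Proof. by case: HL.2 => _ _ _; apply. Qed.

Lemma lle_add x y x' y' : x [<=] y -> x' [<=] y' -> x + x' [<=] y + y'.
Proof.
move=> xy xy'; apply: (@lle_trans (y + x')); first exact: lle_addr.
by rewrite ![y + _]addrC; exact: lle_addr.
Qed.

Lemma lle_addl x y : 0 [<=] y -> x [<=] x + y.
Proof. by move=> y0; rewrite -[X in X [<=] _]addr0; exact: lle_add (lle_refl x) y0. Qed.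

Lemma lle_addr0 x y : 0 [<=] y -> x [<=] y + x.
Proof. by rewrite addrC; exact: lle_addl. Qed.

Lemma ladd_ge0 x y : 0 [<=] x -> 0 [<=] y -> 0 [<=] x + y.
Proof. by move=> x0 y0; rewrite -[0]addr0; exact: lle_add. Qed.

Lemma lscale_ge0 (a : R) x : 0 <= a -> 0 [<=] x -> 0 [<=] a *: x.
Proof. by move=> a0 x0; rewrite -[0](scaler0 _ a); exact: lle_scale. Qed.

Lemma lle_subr_addr x y z : x [<=] y - z <-> x + z [<=] y.
Proof. by split=> [/(lle_addr z)|/(lle_addr (- z))]; rewrite ?subrK ?addrK. Qed.

Lemma lle_subl_addr x y z : x - y [<=] z <-> x [<=] z + y.
Proof. by split=> [/(lle_addr y)|/(lle_addr (- y))]; rewrite ?subrK ?addrK. Qed.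

Lemma lsub_ge0 x y : 0 [<=] y - x <-> x [<=] y.
Proof. by rewrite lle_subr_addr add0r. Qed.

Lemma lle_opp x y : x [<=] y -> - y [<=] - x.
Proof. by move=> /lsub_ge0 h; apply/lsub_ge0; rewrite opprK addrC. Qed.

Lemma lmeetl x y : x [/\] y [<=] x.
Proof. by rewrite -[X in _ [<=] X]opprK; exact/lle_opp/ljoinl. Qed.

Lemma lmeetr x y : x [/\] y [<=] y.
Proof. by rewrite -[X in _ [<=] X]opprK; exact/lle_opp/ljoinr. Qed.

Lemma lmeet_glb x y z : z [<=] x -> z [<=] y -> z [<=] x [/\] y.
Proof.
move=> zx zy; rewrite -[X in X [<=] _]opprK; apply: lle_opp.
by apply: ljoin_lub; exact: lle_opp.
Qed.

Lemma ljoin_addr x y z : (x [\/] y) + z = (x + z) [\/] (y + z).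
Proof.
have le x' y' z' : (x' + z') [\/] (y' + z') [<=] (x' [\/] y') + z'.
  by apply: ljoin_lub; apply: lle_addr; [exact: ljoinl|exact: ljoinr].
apply: lle_anti => //; apply/lle_subr_addr.
by have := le (x + z) (y + z) (- z); rewrite !addrK.
Qed.

Lemma ljoin_scale (a : R) x y : 0 < a -> a *: (x [\/] y) = (a *: x) [\/] (a *: y).
Proof.
move=> a0.
have le b x' y' : 0 < b -> (b *: x') [\/] (b *: y') [<=] b *: (x' [\/] y').
  by move=> b0; apply: ljoin_lub; apply: lle_scale (ltW b0) _; [exact: ljoinl|exact: ljoinr].
apply: lle_anti => //; last exact: le.
have a1 : 0 < a^-1 by rewrite invr_gt0.
have := lle_scale (ltW a0) (le _ (a *: x) (a *: y) a1).
by rewrite !scalerA !mulVf ?mulfV ?gt_eqF// !scale1r.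
Qed.

Lemma lmeet_scale (a : R) x y : 0 < a -> a *: (x [/\] y) = (a *: x) [/\] (a *: y).
Proof. by move=> a0; rewrite /lmeet scalerN ljoin_scale// !scalerN. Qed.

Lemma ljoinC x y : x [\/] y = y [\/] x.
Proof. by apply: lle_anti; apply: ljoin_lub; [exact: ljoinr|exact: ljoinl|exact: ljoinr|exact: ljoinl]. Qed.

Lemma ljoin_idPr x y : x [<=] y -> x [\/] y = y.
Proof. by move=> xy; apply: lle_anti (ljoinr _ _); exact: ljoin_lub (lle_refl _). Qed.

Lemma labs_ge x : x [<=] labs L x. Proof. exact: ljoinl. Qed.
Lemma labs_geN x : - x [<=] labs L x. Proof. exact: ljoinr. Qed.

Lemma lhalf_ge0 x : 0 [<=] x + x -> 0 [<=] x.
Proof.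
move=> /(lle_scale (ltW (half_pow_gt0 R 1))).
by rewrite expr1 scaler0 -mulr2n -[x *+ 2]scaler_nat scalerA mulVf// scale1r.
Qed.

Lemma labs_ge0 x : 0 [<=] labs L x.
Proof.
apply: lhalf_ge0; rewrite -[X in X [<=] _](subrr x).
by apply: lle_add; [exact: labs_ge|exact: labs_geN].
Qed.

Lemma labs_lub x y : x [<=] y -> - x [<=] y -> labs L x [<=] y.
Proof. exact: ljoin_lub. Qed.

Lemma labs_pos x : 0 [<=] x -> labs L x = x.
Proof.
move=> x0; apply: lle_anti (labs_ge _); apply: labs_lub; first exact: lle_refl.
by apply: (lle_trans _ x0); rewrite -oppr0; exact: lle_opp.
Qed.

Lemma lnorm_le x y : x [<=] y -> - x [<=] y -> `|x| <= `|y|.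
Proof.
move=> xy nxy; apply: lnorm_mono; apply: lle_trans (labs_ge _).
exact: labs_lub.
Qed.

Lemma lnorm_le_pos x y : 0 [<=] x -> x [<=] y -> `|x| <= `|y|.
Proof.
move=> x0 xy; apply: lnorm_le => //; apply: lle_trans (lle_trans x0 xy).
by rewrite -oppr0; exact: lle_opp.
Qed.

Lemma lnorm_abs x : `|labs L x| = `|x|.
Proof.
by apply/eqP; rewrite eq_le; apply/andP; split; apply: lnorm_mono;
  rewrite (labs_pos (labs_ge0 x)); exact: lle_refl.
Qed.

(** For a positive [y], the negative part of [x] is at most [labs (y - x)], so its norm is at most
    [|y - x|]. *)
Lemma lpos_closed x :
  (forall e : R, 0 < e -> exists y, 0 [<=] y /\ `|y - x| <= e) -> 0 [<=] x.
Proof.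
move=> h; suff n0 : (- x) [\/] 0 = 0.
  by have := ljoinl (- x) 0; rewrite n0 => /lle_opp; rewrite opprK oppr0.
apply/eqP; rewrite -normr_le0; apply/ler_addgt0Pr => e e0; rewrite add0r.
have [y [y0 yx]] := h e e0; apply: le_trans yx.
rewrite -(lnorm_abs (y - x)); apply: lnorm_le_pos; first exact: ljoinr.
apply: ljoin_lub (labs_ge0 _); apply: lle_trans (labs_ge _).
by rewrite -[X in X [<=] _]add0r; exact: lle_addr.
Qed.

Lemma lle_lim (a : nat -> E) x y : a @ \oo --> x ->
  (exists N, forall n, (N <= n)%N -> a n [<=] y) -> x [<=] y.
Proof.
move=> /cvg_seqP ax [N aN]; apply/lsub_ge0; apply: lpos_closed => e e0.
have [M aM] := ax e e0; exists (y - a (maxn N M)); split.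
  by apply/lsub_ge0/aN; exact: leq_maxl.
by rewrite opprB addrC addrA subrK distrC aM// leq_maxr.
Qed.

Lemma lge_lim (a : nat -> E) x y : a @ \oo --> x ->
  (exists N, forall n, (N <= n)%N -> y [<=] a n) -> y [<=] x.
Proof.
move=> /cvg_seqP ax [N aN]; apply/lsub_ge0; apply: lpos_closed => e e0.
have [M aM] := ax e e0; exists (a (maxn N M) - y); split.
  by apply/lsub_ge0/aN; exact: leq_maxl.
by rewrite opprB addrA subrK aM// leq_maxr.
Qed.

Lemma larchimedean x u : (forall e : R, 0 < e -> x [<=] e *: u) -> x [<=] 0.
Proof.
move=> h; rewrite -[x]opprK -oppr0; apply: lle_opp; apply: lpos_closed => e e0.
have d0 : 0 < e / (`|u| + 1) by rewrite divr_gt0// ltr_wpDl.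
exists (e / (`|u| + 1) *: u - x); split; first exact/lsub_ge0/h.
rewrite opprK subrK normrZ ger0_norm ?(ltW d0)// mulrAC ler_pdivrMr ?ltr_wpDl//.
by rewrite ler_wpM2l ?(ltW e0)// lerDl.
Qed.

(* Every vector lattice inequality between elements of an ideal with order
   unit [u] is detected by real lattice homomorphisms: a maximal order ideal
   avoiding [(c - e u)^+] is prime, so the quotient is totally ordered, and
   comparison with the multiples of [u] maps it to the reals. *)
Section representation.
Variables (u c : E).
Hypothesis u0 : 0 [<=] u.
Hypothesis cu : c [<=] u.
Hypothesis ncle0 : ~ c [<=] 0.

Let pos x := x [\/] 0.

Let pos_ge0 x : 0 [<=] pos x. Proof. exact: ljoinr. Qed.

Let gap : exists e, 0 < e /\ pos (c - e *: u) <> 0.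
Proof.
apply: contrapT => h; apply: ncle0; apply: (@larchimedean _ u) => e e0.
apply: contrapT => ce; apply: h; exists e; split=> // p0; apply: ce.
apply/lsub_ge0; rewrite -opprB -oppr0; apply: lle_opp; rewrite -p0; exact: ljoinl.
Qed.

Let order_ideal (I : E -> Prop) :=
  (forall x y, I x -> I y -> I (x + y)) /\
  (forall x y, I x -> 0 [<=] y -> y [<=] x -> I y).

Let ideal_scale I a x : order_ideal I -> 0 <= a -> 0 [<=] x -> I 0 -> I x -> I (a *: x).
Proof.
move=> [ID Ile] a0 x0 I0 Ix.
have In n : I (n%:R *: x).
  by elim: n => [|n IH]; [rewrite scale0r|rewrite -addn1 natrD scalerDl scale1r; exact: ID].
apply: (Ile _ _ (In (Num.bound a))); first exact: lscale_ge0.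
apply/lsub_ge0; rewrite -scalerBl -[0](scaler0 _ ((Num.bound a)%:R - a)).
by apply: lle_scale => //; rewrite subr_ge0 ltW// archi_boundP.
Qed.

(** If neither [a] nor [b] belongs to a maximal ideal [I] avoiding [c0], adjoining either of them
    captures [c0]: [c0 [<=] p + n a] and [c0 [<=] q + m b] with [p], [q] in [I]. Then [c0 - (p + q)]
    is at most [(n + m) (a [/\] b) = 0], which puts [c0] in [I]. *)
Let prime_ideal c0 : 0 [<=] c0 -> c0 <> 0 -> exists I, [/\ order_ideal I, I 0, ~ I c0 &
  forall x y, 0 [<=] x -> 0 [<=] y -> x [/\] y = 0 -> I x \/ I y].
Proof.
move=> c00 c0n.
pose P (I : set E) := [/\ order_ideal I, forall x, I x -> 0 [<=] x & ~ I c0].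
have [F FP Ftot|I [[[ID Ile] Ipos Ic0] Imax]] := @Zorn_bigcup E P.
  split=> [|x [I FI Ix]|[I FI Ic0]].
  - split=> [x y [I FI Ix] [J FJ Jy]|x y [I FI Ix] y0 yx].
      have [IJ|JI] := Ftot _ _ FI FJ.
        by exists J => //; have [[JD _] _ _] := FP _ FJ; apply: JD => //; exact: IJ.
      by exists I => //; have [[ID _] _ _] := FP _ FI; apply: ID => //; exact: JI.
    by exists I => //; have [[_ Ile] _ _] := FP _ FI; exact: Ile Ix y0 yx.
  - by have [_ + _] := FP _ FI; apply.
  - by have [_ _] := FP _ FI.
have I0 : I 0.
  apply: contrapT => nI0.
  have Ie x : ~ I x by move=> Ix; apply: nI0; apply: Ile Ix (lle_refl 0) (Ipos _ Ix).
  apply: (Imax [set 0]); first by split=> [x /Ie//|h]; apply: nI0; apply: h.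
  split=> [|x ->|]; [|exact: lle_refl|by move=> h; apply: c0n].
  split=> [x y -> ->|x y -> y0 y0']; first by rewrite /= addr0.
  by apply: lle_anti.
exists I; split=> // a b a0 b0 ab; apply: contrapT => /not_orP[nIa nIb].
pose J d : set E := [set y | 0 [<=] y /\ exists p n, I p /\ y [<=] p + n%:R *: d].
have gen d : 0 [<=] d -> ~ I d -> J d c0.
  move=> d0 nId; apply: contrapT => nJ; apply: (Imax (J d)).
    split=> [x Ix|h].
      by split; [exact: Ipos|exists x, 0%N; rewrite scale0r addr0; split=> //; exact: lle_refl].
    apply: nId; apply: h; split=> //; exists 0, 1%N.
    by rewrite scale1r add0r; split=> //; exact: lle_refl.
  split=> [|x []//|//]; split.
    move=> x y [x0 [p [n [Ip xp]]]] [y0 [q [m [Iq yq]]]]; split.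
      by rewrite -[0]addr0; exact: lle_add.
    exists (p + q), (n + m)%N; split; first exact: ID.
    by rewrite natrD scalerDl addrACA; exact: lle_add.
  move=> x y [x0 [p [n [Ip xp]]]] y0 yx; split=> //.
  by exists p, n; split=> //; exact: lle_trans xp.
have [_ [p [n [Ip cp]]]] := gen a a0 nIa.
have [_ [q [m [Iq cq]]]] := gen b b0 nIb.
apply: Ic0; apply: (Ile (p + q)) => //; first exact: ID.
have wide d k p' r : 0 [<=] d -> (k <= n + m)%N -> 0 [<=] r ->
    c0 [<=] p' + k%:R *: d -> c0 - (p' + r) [<=] (n + m)%:R *: d.
  move=> d0 kl r0 cp'; apply/lle_subl_addr; apply: lle_trans cp' _.
  rewrite addrC -[p']addr0; apply: lle_add; last by rewrite addr0 -[X in X [<=] _]addr0; apply: lle_add => //; exact: lle_refl.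
  apply/lsub_ge0; rewrite -scalerBl -[0](scaler0 _ ((n + m)%:R - k%:R)).
  by apply: lle_scale => //; rewrite subr_ge0 ler_nat.
have ca := wide _ _ _ _ a0 (leq_addr m n) (Ipos _ Iq) cp.
have := wide _ _ _ _ b0 (leq_addl n m) (Ipos _ Ip) cq; rewrite [q + p]addrC => cb.
have [nm0|nm0] := posnP (n + m)%N.
  by move: ca; rewrite nm0 scale0r => /lle_subl_addr; rewrite add0r.
rewrite -[p + q]add0r; apply/lle_subl_addr.
rewrite -(scaler0 _ (n + m)%:R) -ab lmeet_scale ?ltr0n//.
exact: lmeet_glb.
Qed.

Let lpos_add x y : pos (x + y) [<=] pos x + pos y.
Proof.
apply: ljoin_lub; first by apply: lle_add; exact: ljoinl.
by rewrite -[0]addr0; apply: lle_add; exact: ljoinr.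
Qed.

Let lpos_opp z : pos (- z) = pos z - z.
Proof. by rewrite /pos ljoin_addr subrr add0r ljoinC. Qed.

Let lpos_disjoint x y : pos (x - y) [/\] pos (y - x) = 0.
Proof.
rewrite -[y - x]opprB lpos_opp; set z := x - y.
rewrite /lmeet opprB -{1}[- pos z]add0r -ljoin_addr [0 [\/] z]ljoinC -/(pos z).
by rewrite subrr oppr0.
Qed.

(** A relation and not a function, because elements outside the ideal generated by [u] need not have
    a value: [rho x r] says that modulo [I] the element [x] lies between [(r - d) *: u] and
    [(r + d) *: u] for every [d > 0]. *)
Lemma real_representation : exists rho : E -> R -> Prop,
  [/\ forall x, x [<=] u -> - x [<=] u -> exists r, rho x r,
      forall a b x y r s, rho x r -> rho y s -> rho (a *: x + b *: y) (a * r + b * s),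
      forall x y r s, rho x r -> rho y s -> rho (x [\/] y) (Num.max r s),
      forall x y r s, rho x r -> rho y s -> x [<=] y -> r <= s &
      forall r, rho c r -> 0 < r].
Proof.
have [e [e0 ce]] := gap.
have [I [Iideal I0 nIc Iprime]] := prime_ideal (pos_ge0 (c - e *: u)) ce.
have [ID Ile] := Iideal.
pose le x y := I (pos (x - y)).
have le_total x y : le x y \/ le y x.
  by apply: Iprime (lpos_disjoint x y); exact: pos_ge0.
have le_of x y : x [<=] y -> le x y.
  move=> xy; rewrite /le (_ : pos _ = 0)//; apply: ljoin_idPr.
  by apply/lle_subl_addr; rewrite add0r.
have le_trans' x y z : le x y -> le y z -> le x z.
  move=> xy yz; apply: Ile (ID _ _ xy yz) (pos_ge0 _) _.
  by rewrite -[x - z](subrKA y); exact: lpos_add.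
have le_add x y x' y' : le x y -> le x' y' -> le (x + x') (y + y').
  move=> xy xy'; apply: Ile (ID _ _ xy xy') (pos_ge0 _) _.
  by rewrite opprD addrACA; exact: lpos_add.
have le_scale a x y : 0 <= a -> le x y -> le (a *: x) (a *: y).
  rewrite le_eqVlt => /predU1P[<- _|a0 xy]; first by rewrite !scale0r; exact/le_of/lle_refl.
  rewrite /le -scalerBr /pos -[0](scaler0 _ a) -ljoin_scale//.
  by apply: ideal_scale => //; [exact: ltW|exact: pos_ge0].
have le_opp x y : le x y -> le (- y) (- x) by rewrite /le opprK addrC.
(* The element [u] is not in [I]: otherwise the positive part of [c - e *: u], which is below [u],
   would be in [I] too. *)
have le_u a b : le (a *: u) (b *: u) -> a <= b.
  move=> h; rewrite leNgt; apply/negP => ab; apply: nIc.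
  have Iu : I u.
    have ab0 : 0 < a - b by rewrite subr_gt0.
    have abu : 0 [<=] (a - b) *: u.
      by apply: lscale_ge0 => //; exact: ltW.
    move: h; rewrite /le -scalerBl /pos ljoinC ljoin_idPr// => h.
    rewrite -[u]scale1r -(@mulVf _ (a - b)) ?gt_eqF// -scalerA.
    by apply: ideal_scale => //; rewrite invr_ge0 ltW.
  apply: Ile Iu (pos_ge0 _) _; apply: ljoin_lub => //.
  apply: (lle_trans _ cu); apply/lle_subl_addr; rewrite -[X in X [<=] _]addr0.
  apply: lle_add; first exact: lle_refl.
  by apply: lscale_ge0 => //; exact: ltW.
pose rho x r := forall d, 0 < d -> le ((r - d) *: u) x /\ le x ((r + d) *: u).
exists rho; split.
- move=> x xu nxu.
  pose A := [set t | le (t *: u) x].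
  have A1 : A (-1) by apply: le_of; rewrite scaleN1r -[x]opprK; exact: lle_opp.
  have ub t : A t -> t <= 1.
    move=> At; apply: le_u; apply: le_trans' At _.
    by rewrite scale1r; exact: le_of.
  have supA : has_sup A by split; [exists (-1)|exists 1].
  exists (sup A) => d d0; split.
    have [t At tA] := sup_adherent d0 supA; apply: le_trans' At; apply: le_of.
    apply/lsub_ge0; rewrite -scalerBl -[0](scaler0 _ (t - (sup A - d))).
    by apply: lle_scale => //; rewrite subr_ge0 ltW.
  have [//|h] := le_total x ((sup A + d) *: u).
  by have := ub_le_sup supA.2 h; rewrite gerDl leNgt d0.
- have scale a x r : rho x r -> rho (a *: x) (a * r).
    move=> xr d d0; have [->|an0] := eqVneq a 0.
      rewrite scale0r mul0r; split; apply: le_of; rewrite ?sub0r ?add0r ?scaleNr.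
        by rewrite -oppr0; apply/lle_opp/lscale_ge0 => //; exact: ltW.
      by apply: lscale_ge0 => //; exact: ltW.
    have d'0 : 0 < d / `|a| by rewrite divr_gt0// normr_gt0.
    have [h1 h2] := xr _ d'0.
    have [a0|a0] := leP 0 a.
      have aE : a * (d / `|a|) = d by rewrite ger0_norm// mulrC divfK.
      have := le_scale a _ _ a0 h1; have := le_scale a _ _ a0 h2.
      by rewrite !scalerA mulrDr mulrBr aE.
    have aE : a * (d / `|a|) = - d by rewrite ltr0_norm// invrN mulrN mulrC mulNr divfK.
    have na0 : 0 <= - a by rewrite oppr_ge0 ltW.
    have := le_opp _ _ (le_scale _ _ _ na0 h1); have := le_opp _ _ (le_scale _ _ _ na0 h2).
    by rewrite !scalerA !scaleNr !mulNr !scaleNr !opprK mulrDr mulrBr aE opprK.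
  have add x y r s : rho x r -> rho y s -> rho (x + y) (r + s).
    move=> xr ys d d0; have d20 : 0 < d / 2 by rewrite divr_gt0.
    have [h1 h2] := xr _ d20; have [h3 h4] := ys _ d20.
    have -> : r + s - d = (r - d / 2) + (s - d / 2) by field.
    have -> : r + s + d = (r + d / 2) + (s + d / 2) by field.
    by rewrite !scalerDl -!scalerDl scalerDl [(r + d / 2 + _) *: _]scalerDl; split; exact: le_add.
  by move=> a b x y r s xr ys; apply: add; exact: scale.
- have le_join x y z : le x z -> le y z -> le (x [\/] y) z.
    move=> xz yz; apply: Ile (ID _ _ xz yz) (pos_ge0 _) _.
    have p0 := pos_ge0; apply: ljoin_lub; last exact: ladd_ge0.
    apply/lle_subl_addr; apply: ljoin_lub; apply/lle_subl_addr.
      exact: lle_trans (ljoinl _ _) (lle_addl _ _).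
    exact: lle_trans (ljoinl _ _) (lle_addr0 _ _).
  have le_mono a b : a <= b -> le (a *: u) (b *: u).
    move=> ab; apply: le_of; apply/lsub_ge0.
    by rewrite -scalerBl; apply: lscale_ge0 => //; rewrite subr_ge0.
  move=> x y r s xr ys d d0.
  have [xr1 xr2] := xr d d0; have [ys1 ys2] := ys d d0; split.
    have [rs|sr] := leP r s; first by apply: le_trans' ys1 _; exact/le_of/ljoinr.
    by apply: le_trans' xr1 _; exact/le_of/ljoinl.
  apply: le_join; first by apply: le_trans' xr2 _; apply: le_mono; rewrite lerD2r le_max lexx.
  by apply: le_trans' ys2 _; apply: le_mono; rewrite lerD2r le_max lexx orbT.
- move=> x y r s xr ys xy; apply/ler_addgt0Pr => d d0.
  have d20 : 0 < d / 2 by rewrite divr_gt0.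
  have := le_u _ _ (le_trans' _ _ _ (xr _ d20).1 (le_trans' _ _ _ (le_of _ _ xy) (ys _ d20).2)).
  lra.
- move=> r cr; apply: (lt_le_trans e0); apply/ler_addgt0Pr => d d0.
  apply: le_u; apply: le_trans' (cr d d0).2.
  by have [|//] := le_total c (e *: u).
Qed.

End representation.

(** Syntax for reflection: a term is evaluated in [E] and, through a real valuation of its atoms, in
    [R]. *)
Inductive lterm :=
| LVar of nat | LZero | LAdd of lterm & lterm | LOpp of lterm
| LScale of R & lterm | LJoin of lterm & lterm | LMeet of lterm & lterm | LAbs of lterm.

Fixpoint leval (env : seq E) (t : lterm) : E :=
  match t with
  | LVar i => nth 0 env i
  | LZero => 0
  | LAdd s t => leval env s + leval env t
  | LOpp t => - leval env t
  | LScale a t => a *: leval env t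
  | LJoin s t => leval env s [\/] leval env t
  | LMeet s t => leval env s [/\] leval env t
  | LAbs t => labs L (leval env t)
  end.

Fixpoint reval (env : nat -> R) (t : lterm) : R :=
  match t with
  | LVar i => env i
  | LZero => 0
  | LAdd s t => reval env s + reval env t
  | LOpp t => - reval env t
  | LScale a t => a * reval env t
  | LJoin s t => Num.max (reval env s) (reval env t)
  | LMeet s t => Num.min (reval env s) (reval env t)
  | LAbs t => Num.max (reval env t) (- reval env t)
  end.

Fixpoint limplies (env : seq E) (hyps : seq (lterm * lterm)) (s t : lterm) : Prop :=
  if hyps is h :: hyps' then
    leval env h.1 [<=] leval env h.2 -> limplies env hyps' s t
  else leval env s [<=] leval env t.

Fixpoint rimplies (env : nat -> R) (hyps : seq (lterm * lterm)) (s t : lterm) : Prop :=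
  if hyps is h :: hyps' then
    reval env h.1 <= reval env h.2 -> rimplies env hyps' s t
  else reval env s <= reval env t.

(** If the conclusion fails, [c] is not below zero, and a single homomorphism, on the ideal
    generated by [c] and the atoms, preserves all the hypotheses while making the value of [s]
    strictly larger than that of [t]. *)
Theorem lattice_transfer (env : seq E) (hyps : seq (lterm * lterm)) (s t : lterm) :
  (forall rho, rimplies rho hyps s t) -> limplies env hyps s t.
Proof.
pose c := leval env s - leval env t.
suff main : ~ c [<=] 0 -> exists rho, forall t', forall t'',
    (leval env t' [<=] leval env t'' -> reval rho t' <= reval rho t'') /\
    (reval rho s <= reval rho t -> False).
  move=> h.
  have [/lle_subl_addr|/main[rho rhoP]] := pselect (c [<=] 0).
    rewrite add0r => st; elim: hyps {h} => //= h hyps IH _; exact: IH.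
  have nst := (rhoP s t).2; have {}rhoP := fun t' t'' => (rhoP t' t'').1.
  have := h rho; clear h; elim: hyps => [|h' hyps IH] /=; first by move=> /nst.
  by move=> h'' /rhoP /h''; exact: IH.
move=> nc.
pose u := labs L c + \sum_(x <- env) labs L x.
have sum0 (l : seq E) : 0 [<=] \sum_(x <- l) labs L x.
  elim: l => [|y l IH]; first by rewrite big_nil; exact: lle_refl.
  by rewrite big_cons; apply: ladd_ge0 => //; exact: labs_ge0.
have cu : labs L c [<=] u.
  exact: lle_addl.
have u0 : 0 [<=] u by apply: ladd_ge0 => //; exact: labs_ge0.
have [rho [rhoex rholin rhomax rhomono rhoc]] :=
  real_representation u0 (lle_trans (labs_ge c) cu) nc.
have rho0 : rho 0 0.
  have [||r r0] := rhoex 0; rewrite ?oppr0//.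
  by have := rholin 0 0 0 0 r r r0 r0; rewrite !scale0r !mul0r !addr0.
have envu i : labs L (nth 0 env i) [<=] u.
  have : labs L (nth 0 env i) [<=] \sum_(x <- env) labs L x.
    elim: (env) i => [i|y l IH [|i]]; rewrite ?big_cons /=.
    - by rewrite nth_nil big_nil labs_pos; exact: lle_refl.
    - exact: lle_addl.
    - exact: lle_trans (IH i) (lle_addr0 _ (labs_ge0 y)).
  by move=> h; exact: lle_trans h (lle_addr0 _ (labs_ge0 c)).
have /choice[r rP] : forall i, exists r, rho (nth 0 env i) r.
  move=> i; apply: rhoex; apply: lle_trans (envu i); [exact: labs_ge|exact: labs_geN].
have rhoN x a : rho x a -> rho (- x) (- a).
  by move=> xa; have := rholin (-1) 0 _ _ _ _ xa xa; rewrite scaleN1r scale0r mulN1r mul0r !addr0.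
have ev t' : rho (leval env t') (reval r t').
  elim: t' => [i||t1 h1 t2 h2|t1 h1|a t1 h1|t1 h1 t2 h2|t1 h1 t2 h2|t1 h1] //=.
  - by have := rholin 1 1 _ _ _ _ h1 h2; rewrite !scale1r !mul1r.
  - exact: rhoN.
  - by have := rholin a 0 _ _ _ _ h1 h1; rewrite scale0r mul0r !addr0.
  - exact: rhomax.
  - rewrite -[Num.min _ _]opprK oppr_min; apply: (rhoN); apply: rhomax; exact: rhoN.
  - by apply: rhomax => //; exact: rhoN.
exists r => t' t''; split=> [h|h]; first exact: rhomono (ev _) (ev _) h.
suff /rhoc : rho c (reval r s - reval r t) by rewrite subr_gt0 ltNge h.
by have := rholin 1 (-1) _ _ _ _ (ev s) (ev t); rewrite !scale1r !scaleN1r mul1r mulN1r.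
Qed.

End vector_lattice.

(** * Deciding lattice inequalities by reflection *)

Lemma real_max_case (R : realType) (P : R -> Prop) (a b : R) :
  (a <= b -> P b) -> (b <= a -> P a) -> P (Num.max a b).
Proof. by move=> h1 h2; case: (leP a b) => [/h1|/ltW/h2]. Qed.

Lemma real_min_case (R : realType) (P : R -> Prop) (a b : R) :
  (a <= b -> P a) -> (b <= a -> P b) -> P (Num.min a b).
Proof. by move=> h1 h2; case: (leP a b) => [/h1|/ltW/h2]. Qed.

(* The same atom may occur with several convertible algebraic instances, hence
   comparison up to unification. *)
Ltac lattice_index x l :=
  match l with
  | x :: _ => constr:(0%N)
  | ?y :: _ => let _ := match constr:(tt) with _ => unify x y end in constr:(0%N)
  | _ :: ?l' => let n := lattice_index x l' in constr:(S n)
  end.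

Ltac lattice_atoms L env t :=
  lazymatch t with
  | (?a + ?b)%R => let e := lattice_atoms L env a in lattice_atoms L e b
  | (- ?a)%R => lattice_atoms L env a
  | (_ *: ?a)%R => lattice_atoms L env a
  | ljoin L ?a ?b => let e := lattice_atoms L env a in lattice_atoms L e b
  | lmeet L ?a ?b => let e := lattice_atoms L env a in lattice_atoms L e b
  | labs L ?a => lattice_atoms L env a
  | 0%R => env
  | _ => match constr:(tt) with
         | _ => let _ := lattice_index t env in env
         | _ => constr:(t :: env)
         end
  end.

Ltac lattice_reify R L env t :=
  lazymatch t with
  | (?a + ?b)%R => let s := lattice_reify R L env a in let s' := lattice_reify R L env b in
                   constr:(@LAdd R s s')
  | (- ?a)%R => let s := lattice_reify R L env a in constr:(@LOpp R s)
  | (?c *: ?a)%R => let s := lattice_reify R L env a in constr:(@LScale R c s)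
  | ljoin L ?a ?b => let s := lattice_reify R L env a in let s' := lattice_reify R L env b in
                     constr:(@LJoin R s s')
  | lmeet L ?a ?b => let s := lattice_reify R L env a in let s' := lattice_reify R L env b in
                     constr:(@LMeet R s s')
  | labs L ?a => let s := lattice_reify R L env a in constr:(@LAbs R s)
  | 0%R => constr:(@LZero R)
  | _ => let n := lattice_index t env in constr:(@LVar R n)
  end.

Ltac lattice_goal_atoms L env G :=
  lazymatch G with
  | lle L ?a ?b -> ?G' =>
      let e := lattice_atoms L env a in let e' := lattice_atoms L e b in
      lattice_goal_atoms L e' G'
  | lle L ?a ?b => let e := lattice_atoms L env a in lattice_atoms L e b
  end.

Ltac lattice_goal_hyps R L env G :=
  lazymatch G with
  | lle L ?a ?b -> ?G' =>
      let s := lattice_reify R L env a in let s' := lattice_reify R L env b in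
      let l := lattice_goal_hyps R L env G' in constr:((s, s') :: l)
  | lle L _ _ => constr:(@nil (lterm R * lterm R))
  end.

Ltac lattice_goal_concl G :=
  lazymatch G with
  | lle _ _ _ -> ?G' => lattice_goal_concl G'
  | _ => constr:(G)
  end.

Ltac lattice_real :=
  let rho := fresh "rho" in
  intro rho; cbn [rimplies reval fst snd];
  repeat match goal with
  | |- context [rho ?i] => generalize (rho i); intro
  end;
  repeat match goal with
  | |- context [@Order.max ?d ?T ?a ?b] =>
      pattern (@Order.max d T a b);
      match goal with |- ?P _ => refine (@real_max_case _ P a b _ _); cbv beta end
  | |- context [@Order.min ?d ?T ?a ?b] =>
      pattern (@Order.min d T a b);
      match goal with |- ?P _ => refine (@real_min_case _ P a b _ _); cbv beta end
  end.

(* Real hypotheses are irrelevant here and slow lra down. *)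
Ltac lattice_clear := repeat match goal with H : is_true _ |- _ => clear H end.

(* Reduces [lle L a1 b1 -> ... -> lle L s t] to the same implication between
   real numbers. *)
Ltac lattice_reduce :=
  lazymatch goal with
  | HL : @is_banach_lattice ?R ?E ?L |- ?G =>
      let env := lattice_goal_atoms L (@nil E) G in
      let hyps := lattice_goal_hyps R L env G in
      lazymatch lattice_goal_concl G with
      | lle L ?a ?b =>
          let s := lattice_reify R L env a in let t := lattice_reify R L env b in
          refine (@lattice_transfer R E L HL env hyps s t _); lattice_clear; lattice_real
      end
  end.

Ltac lattice := first
  [ lattice_reduce; intros; lra
  | lazymatch goal with HL : is_banach_lattice _ |- _ = _ => apply: (lle_anti HL) end;
    lattice_reduce; intros; lra ].

(** * Positive functionals *)

Section banach_lattice.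
Variables (R : realType) (E : completeNormedModType R) (L : lattice_ops E).
Hypothesis HL : is_banach_lattice L.
Implicit Types (x y z u : E) (f g : E -> R).

Local Notation "x [<=] y" := (lle L x y) (at level 70, no associativity).
Local Notation "x [\/] y" := (ljoin L x y) (at level 50, left associativity).
Local Notation "x [/\] y" := (lmeet L x y) (at level 48, left associativity).
Local Notation labs := (labs L).

Lemma lsum_ge0 n (a : nat -> E) : (forall i, 0 [<=] a i) -> 0 [<=] \sum_(i < n) a i.
Proof.
move=> a0; elim: n => [|n IH]; first by rewrite big_ord0; exact: lle_refl.
by rewrite big_ord_recr/=; exact: ladd_ge0.
Qed.

Lemma lsum_le n (a b : nat -> E) : (forall i, (i < n)%N -> a i [<=] b i) ->
  \sum_(i < n) a i [<=] \sum_(i < n) b i.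
Proof.
elim: n => [|n IH] ab; first by rewrite !big_ord0; exact: lle_refl.
rewrite !big_ord_recr/=; apply: lle_add => //; last exact: ab.
by apply: IH => i h; apply: ab; exact: leqW.
Qed.

Lemma lsum_ge_term n (a : nat -> E) i : (forall i, 0 [<=] a i) -> (i < n)%N ->
  a i [<=] \sum_(j < n) a j.
Proof.
move=> a0; elim: n => // n IH; rewrite ltnS leq_eqVlt big_ord_recr/= => /predU1P[->|/IH h].
  by apply: lle_addr0 => //; exact: lsum_ge0.
by apply: (lle_trans HL h); exact: lle_addl.
Qed.

Lemma lscale_mono (a b : R) x : a <= b -> 0 [<=] x -> a *: x [<=] b *: x.
Proof.
by move=> ab x0; apply/(lsub_ge0 HL); rewrite -scalerBl; apply: lscale_ge0 => //; rewrite subr_ge0.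
Qed.

Lemma labs_scale (a : R) x : labs (a *: x) = `|a| *: labs x.
Proof.
have [->|a0] := eqVneq a 0.
  by rewrite normr0 !scale0r; lattice.
have {}a0 : 0 < `|a| by rewrite normr_gt0.
rewrite {2}/Defs.labs ljoin_scale// scalerN.
have [h|h] := leP 0 a; first by rewrite ger0_norm.
by rewrite ltr0_norm// !scaleNr opprK /Defs.labs ljoinC.
Qed.

Lemma lnorm_abs_le x y : labs x [<=] y -> `|x| <= `|y|.
Proof. by move=> xy; apply: (lnorm_le HL); move: xy; lattice. Qed.

Lemma labs_sum n (a : nat -> E) : labs (\sum_(i < n) a i) [<=] \sum_(i < n) labs (a i).
Proof.
elim: n => [|n IH]; first by rewrite !big_ord0; lattice.
by rewrite !big_ord_recr/=; move: IH; lattice.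
Qed.

Definition positive_dual f := is_dual f /\ forall x, 0 [<=] x -> 0 <= f x.

Lemma pdual_mono f (pf : positive_dual f) x y : x [<=] y -> f x <= f y.
Proof. by move=> /(lsub_ge0 HL) /pf.2; rewrite (dualB pf.1) subr_ge0. Qed.

Lemma pdual_abs f (pf : positive_dual f) x : `|f x| <= f (labs x).
Proof.
rewrite ler_norml lerNl -(dualN pf.1) !(pdual_mono pf)//; lattice.
Qed.

Lemma pdual_le_norm f (pf : positive_dual f) x : f x <= dual_norm f * `|x|.
Proof. exact: le_trans (ler_norm _) (dual_normP pf.1 x). Qed.

Lemma lpos_norm_sublinear : sublinear_on (fun=> True) (fun x : E => `|x [\/] 0|).
Proof.
split=> [x y _ _|t x t0 _].
  apply: le_trans (ler_normD _ _); apply: (lnorm_le_pos HL) => //; lattice.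
move: t0; rewrite le_eqVlt => /predU1P[<-|t0].
  by rewrite scale0r mul0r (_ : 0 [\/] 0 = 0) ?normr0//; lattice.
by rewrite -[0 in LHS](scaler0 _ t) -ljoin_scale// normrZ gtr0_norm.
Qed.

Lemma lnorm_pos x : `|x [\/] 0| <= `|x|.
Proof. by rewrite -(lnorm_abs HL x); apply: (lnorm_le_pos HL) => //; lattice. Qed.

Lemma positive_minorant (p : E -> R) v : sublinear_on (fun=> True) p ->
  (forall x, 0 <= p x <= `|x [\/] 0|) ->
  exists f, [/\ positive_dual f, forall x, f x <= p x & f v = p v].
Proof.
move=> sp p01.
have p0 x : 0 <= p x by case/andP: (p01 x).
have pn x : p x <= `|x [\/] 0| by case/andP: (p01 x).
have [|t t0|f [Df fp fv]] := @functional_attaining R E p v 1 sp.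
- by move=> x; rewrite mul1r; exact: le_trans (pn x) (lnorm_pos x).
- by apply: le_trans (p0 _); rewrite oppr_le0 mulr_ge0.
exists f; split=> //; split=> // x x0.
have := fp (- x); rewrite (dualN Df) => h.
have := le_trans h (pn (- x)); rewrite (_ : - x [\/] 0 = 0) ?normr0 ?oppr_le0//.
by move: x0; clear -HL; move=> x0; apply: (lle_anti HL); move: x0; lattice.
Qed.

Lemma positive_norming v : 0 [<=] v ->
  exists f, [/\ positive_dual f, forall x, `|f x| <= `|x| & f v = `|v|].
Proof.
move=> v0.
have [|f [pf fp fv]] := @positive_minorant _ v lpos_norm_sublinear.
  by move=> x; rewrite normr_ge0 lexx.
exists f; split=> //; last first.
  by rewrite fv; congr (`|_|); apply: (lle_anti HL); move: v0; lattice.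
move=> x; rewrite ler_norml lerNl -(dualN pf.1).
by rewrite (le_trans (fp _) (lnorm_pos _)) -normrN (le_trans (fp _) (lnorm_pos _)).
Qed.

(** Kantorovich's extension by differences: if [x = y - z] with [y] and [z] positive, then [(x [\/]
    0) + z = (- x [\/] 0) + y], so the value does not depend on the decomposition. *)
Lemma cone_extension (W : lmodType R) (phi : E -> W) :
  (forall x y, 0 [<=] x -> 0 [<=] y -> phi (x + y) = phi x + phi y) ->
  (forall a x, 0 <= a -> 0 [<=] x -> phi (a *: x) = a *: phi x) ->
  exists F : E -> W, is_linear_map F /\ forall x, 0 [<=] x -> F x = phi x.
Proof.
move=> phiD phiZ.
pose F x := phi (x [\/] 0) - phi (- x [\/] 0).
have phi0 : phi 0 = 0 by rewrite -[0 in LHS](scale0r 0) phiZ ?scale0r//; exact: lle_refl.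
have FE x y z : x = y - z -> 0 [<=] y -> 0 [<=] z -> F x = phi y - phi z.
  move=> xyz y0 z0.
  have E1 : (x [\/] 0) + z = (- x [\/] 0) + y.
    have -> : y = x + z by rewrite xyz subrK.
    lattice.
  have p0 w : 0 [<=] w [\/] 0 by exact: ljoinr.
  have := congr1 phi E1; rewrite !phiD// => E2.
  by rewrite /F; apply/eqP; rewrite subr_eq addrAC -[_ == _]subr_eq opprK E2 addrC.
have Fpos x : 0 [<=] x -> F x = phi x.
  by move=> x0; rewrite (FE x x 0) ?phi0 ?subr0//; exact: lle_refl.
have xE x : x = (x [\/] 0) - (- x [\/] 0) by lattice.
have p0 w : 0 [<=] w [\/] 0 by exact: ljoinr.
have FD x y : F (x + y) = F x + F y.
  rewrite (FE (x + y) ((x [\/] 0) + (y [\/] 0)) ((- x [\/] 0) + (- y [\/] 0))).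
  - by rewrite !phiD// /F opprD addrACA.
  - by rewrite {1}(xE x) {1}(xE y) opprD addrACA.
  - exact: ladd_ge0.
  - exact: ladd_ge0.
have FN x : F (- x) = - F x by rewrite /F opprK opprB.
have FZ a x : 0 <= a -> F (a *: x) = a *: F x.
  move=> a0; rewrite (FE _ (a *: (x [\/] 0)) (a *: (- x [\/] 0))).
  - by rewrite !phiZ// /F scalerBr.
  - by rewrite -scalerBr -xE.
  - exact: lscale_ge0.
  - exact: lscale_ge0.
exists F; split=> // a x y; rewrite FD; congr (_ + _).
have [a0|a0] := leP 0 a; first exact: FZ.
by rewrite -[a]opprK !(scaleNr (- a)) FN FZ// oppr_ge0 ltW.
Qed.

Lemma positive_bounded_dual f C : 0 <= C -> is_linear_map (f : E -> R^o) ->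
  (forall x, 0 [<=] x -> 0 <= f x <= C * `|x|) -> positive_dual f.
Proof.
move=> C0 fl fC.
have f0 x : 0 [<=] x -> 0 <= f x by move=> /fC/andP[].
split=> //; apply: (@bounded_is_dual _ _ _ C) => // x.
have mono x' y' : x' [<=] y' -> f x' <= f y'.
  by move=> /(lsub_ge0 HL)/f0; rewrite (linear_mapB fl) subr_ge0.
have := fC _ (labs_ge0 HL x); rewrite (lnorm_abs HL) => /andP[_]; apply: le_trans.
rewrite ler_norml lerNl -(linear_mapN fl) !mono//; lattice.
Qed.

(** The modulus of [f] by the Riesz-Kantorovich formula, the supremum of [f] over the interval from
    [- y] to [y]. The last clause is its minimality; it transfers absolute continuity from [f] to
    its modulus. *)
Lemma functional_modulus f C : is_dual f -> 0 <= C -> (forall x, `|f x| <= C * `|x|) ->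
  exists g, [/\ positive_dual g, forall x, `|f x| <= g (labs x),
    forall x, `|g x| <= C * `|x| &
    forall y e, 0 [<=] y -> (forall h, labs h [<=] y -> f h <= e) -> g y <= e].
Proof.
move=> Df C0 fC.
pose q y := sup [set f h | h in [set h | labs h [<=] y]].
have hs y : 0 [<=] y -> has_sup [set f h | h in [set h | labs h [<=] y]].
  move=> y0; split; first by exists (f 0), 0 => //=; move: y0; lattice.
  exists (C * `|y|) => _ [h /= hy <-]; apply: le_trans (ler_norm _) _.
  by apply: le_trans (fC h) _; rewrite ler_wpM2l//; exact: lnorm_abs_le.
have q_ge y h : labs h [<=] y -> f h <= q y.
  move=> hy; apply: (ub_le_sup (hs y _).2); last by exists h.
  by move: hy; lattice.
have q_le y e : 0 [<=] y -> (forall h, labs h [<=] y -> f h <= e) -> q y <= e.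
  by move=> y0 he; apply: (sup_le_ub (hs y y0).1) => _ [h /= hy <-]; exact: he.
have qD x y : 0 [<=] x -> 0 [<=] y -> q (x + y) = q x + q y.
  move=> x0 y0; have xy0 : 0 [<=] x + y by exact: ladd_ge0.
  apply/eqP; rewrite eq_le; apply/andP; split.
    apply: (q_le) => // h hxy.
    (* Riesz decomposition: [a] is [h] truncated to the interval from [- x] to [x], and the
       remainder has modulus at most [y]. *)
    pose a := (h [/\] x) [\/] - x.
    have ha : labs a [<=] x by move: x0; rewrite /a; lattice.
    have hb : labs (h - a) [<=] y by move: x0 y0 hxy; rewrite /a; lattice.
    rewrite -[h](subrK a) (dualD Df) addrC; apply: lerD; exact: q_ge.
  rewrite -lerBrDr; apply: (q_le) => // h hx; rewrite lerBrDr -lerBrDl.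
  apply: (q_le) => // k ky; rewrite lerBrDl -(dualD Df).
  by apply: (q_ge); move: hx ky; lattice.
have qZ a x : 0 <= a -> 0 [<=] x -> q (a *: x) = a *: (q x : R^o).
  have le b y : 0 < b -> 0 [<=] y -> q (b *: y) <= b * q y.
    move=> b0 y0; apply: (q_le) => [|h hby]; first by apply: lscale_ge0 => //; exact: ltW.
    rewrite mulrC -ler_pdivrMr// mulrC -(dualZ Df); apply: (q_ge).
    rewrite labs_scale gtr0_norm ?invr_gt0//.
    have := lle_scale HL _ hby => /(_ b^-1); rewrite invr_ge0 => /(_ (ltW b0)).
    by rewrite scalerA mulVf ?gt_eqF// scale1r.
  move=> a0 x0; suff : q (a *: x) = a * q x by []; move: a0; rewrite le_eqVlt => /predU1P[<-|a0].
    rewrite scale0r mul0r; apply/eqP; rewrite eq_le; apply/andP; split.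
      apply: (q_le) => [|h h0]; first exact: lle_refl.
      have -> : h = 0 by apply: (lle_anti HL); move: h0; lattice.
      by rewrite (dual0 Df).
    by rewrite -{1}(dual0 Df); apply: (q_ge); lattice.
  apply/eqP; rewrite eq_le le//=.
  have ai : 0 < a^-1 by rewrite invr_gt0.
  have ax0 : 0 [<=] a *: x by apply: lscale_ge0 => //; exact: ltW.
  have := le _ _ ai ax0; rewrite scalerA mulVf ?gt_eqF// scale1r.
  by rewrite -(ler_pM2l a0) mulrA mulfV ?gt_eqF// mul1r.
have [g [gl gq]] := @cone_extension R^o q qD qZ.
have g01 x : 0 [<=] x -> 0 <= g x <= C * `|x|.
  move=> x0; rewrite gq//; apply/andP; split.
    by rewrite -{1}(dual0 Df); apply: (q_ge); move: x0; lattice.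
  apply: (q_le) => // h hx; apply: le_trans (ler_norm _) _.
  by apply: le_trans (fC h) _; rewrite ler_wpM2l//; exact: lnorm_abs_le.
have pg := positive_bounded_dual C0 gl g01.
exists g; split=> //.
- move=> x; rewrite gq; last exact: labs_ge0.
  rewrite ler_norml lerNl -(dualN Df) !q_ge//; lattice.
- move=> x; apply: le_trans (pdual_abs pg x) _.
  by have /andP[_] := g01 _ (labs_ge0 HL x); rewrite (lnorm_abs HL).
- by move=> y e y0 he; rewrite gq//; exact: (q_le).
Qed.

End banach_lattice.

(** * Disjoint sequences *)

Section real_sequences.
Variable R : realType.

Lemma increasing_bounded_cauchy (u : nat -> R) C :
  (forall n, u n <= u n.+1) -> (forall n, u n <= C) ->
  forall e, 0 < e -> exists N, forall n m, (N <= n)%N -> (n <= m)%N -> u m - u n <= e.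
Proof.
move=> uS uC e e0.
have /cvg_ex[l /(@cvg_seqP R R^o) ul] : cvgn u.
  apply: nondecreasing_is_cvgn; first exact/nondecreasing_seqP.
  by exists C => _ [n _ <-].
have e20 : 0 < e / 2 by rewrite divr_gt0.
have [N hN] := ul _ e20; exists N => n m Nn nm.
have := hN _ Nn; have := hN _ (leq_trans Nn nm); rewrite !ler_norml.
by move=> /andP[? ?] /andP[? ?]; lra.
Qed.

Lemma partial_sums_tail (a : nat -> R) C : (forall i, 0 <= a i) ->
  (forall N, \sum_(i < N) a i <= C) ->
  forall e, 0 < e -> exists N, forall n m, (N <= n)%N -> (n <= m)%N ->
    \sum_(i < m) a i - \sum_(i < n) a i <= e.
Proof.
move=> a0 aC; apply: (@increasing_bounded_cauchy (fun N => \sum_(i < N) a i) C) => // n.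
by rewrite big_ord_recr/= lerDl.
Qed.

Lemma bounded_sums_terms_to0 (a : nat -> R) C : (forall i, 0 <= a i) ->
  (forall N, \sum_(i < N) a i <= C) ->
  forall e, 0 < e -> exists N, forall n, (N <= n)%N -> a n <= e.
Proof.
move=> a0 aC e e0; have [N hN] := partial_sums_tail a0 aC e0; exists N => n Nn.
by have := hN _ _ Nn (leqnSn n); rewrite big_ord_recr/= addrAC subrr add0r.
Qed.

Variable E : completeNormedModType R.

Lemma dual_sum_bound (y : nat -> E) C (f : E -> R) : is_dual f ->
  (forall (s : nat -> R) N, (forall i, `|s i| <= 1) -> `|\sum_(i < N) s i *: y i| <= C) ->
  forall N, \sum_(i < N) `|f (y i)| <= dual_norm f * C.
Proof.
move=> Df yC N.
have -> : \sum_(i < N) `|f (y i)| = f (\sum_(i < N) Num.sg (f (y i)) *: y i).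
  by rewrite (dual_sum Df); apply: eq_bigr => i _; rewrite (dualZ Df) normrEsg.
apply: le_trans (ler_norm _) _; apply: le_trans (dual_normP Df _) _.
rewrite ler_wpM2l ?dual_norm_ge0//; apply: (yC (fun i => Num.sg (f (y i)))) => i.
by rewrite normr_sg lern1 leq_b1.
Qed.

Lemma weakly_null_eps (x : nat -> E) : weakly_cvg x 0 <->
  forall f, is_dual f -> forall e, 0 < e -> exists N, forall n, (N <= n)%N -> `|f (x n)| <= e.
Proof.
split=> [xw f Df e e0|h f Df].
  have /(@cvg_seqP R R^o)/(_ e e0)[N hN] := xw f Df.
  by exists N => n /hN; rewrite (dual0 Df) subr0.
apply/(@cvg_seqP R R^o) => e e0; have [N hN] := h f Df e e0.
by exists N => n /hN; rewrite (dual0 Df) subr0.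
Qed.

Lemma cvg0_eps (a : nat -> R) : a @ \oo --> (0 : R) <->
  forall e, 0 < e -> exists N, forall n, (N <= n)%N -> `|a n| <= e.
Proof.
split=> [/(@cvg_seqP R R^o) h e /h[N hN]|h].
  by exists N => n /hN; rewrite subr0.
by apply/(@cvg_seqP R R^o) => e /h[N hN]; exists N => n /hN; rewrite subr0.
Qed.

End real_sequences.

Section disjoint_sequences.
Variables (R : realType) (E : completeNormedModType R) (L : lattice_ops E).
Hypothesis HL : is_banach_lattice L.
Implicit Types (x y z u : E) (f g : E -> R) (d : nat -> E).

Local Notation "x [<=] y" := (lle L x y) (at level 70, no associativity).
Local Notation "x [\/] y" := (ljoin L x y) (at level 50, left associativity).
Local Notation "x [/\] y" := (lmeet L x y) (at level 48, left associativity).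
Local Notation labs := (labs L).

(** The terms are positive, so [[<=] 0] amounts to a zero meet; this form is a hypothesis that the
    [lattice] tactic accepts. *)
Definition disjoint_seq d := (forall n, 0 [<=] d n) /\
  forall n m, (n < m)%N -> d n [/\] d m [<=] 0.

Lemma disjoint_sum_meet d N m : disjoint_seq d -> (N <= m)%N ->
  (\sum_(i < N) d i) [/\] d m [<=] 0.
Proof.
move=> [d0 dd]; elim: N => [_|N IH Nm].
  by rewrite big_ord0; move: (d0 m); lattice.
rewrite big_ord_recr/=; move: (IH (ltnW Nm)) (dd _ _ Nm) (lsum_ge0 HL N d0) (d0 N) (d0 m).
set s := \sum_(i < N) _; lattice.
Qed.

Lemma disjoint_sum_le d N u : disjoint_seq d -> 0 [<=] u ->
  (forall n, (n < N)%N -> d n [<=] u) ->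
  \sum_(i < N) d i [<=] u.
Proof.
move=> dd u0; elim: N => [|N IH] du; first by rewrite big_ord0.
have {}IH := IH (fun n nN => du n (leqW nN)).
rewrite big_ord_recr/=; move: IH (disjoint_sum_meet dd (leqnn N)) (du N (ltnSn N)).
set s := \sum_(i < N) _; lattice.
Qed.

Lemma signed_sum_le d (s : nat -> R) (S : R) N : (forall i, 0 [<=] d i) ->
  (forall i, (i < N)%N -> `|s i| <= S) -> labs (\sum_(i < N) s i *: d i) [<=] S *: \sum_(i < N) d i.
Proof.
move=> d0 sS; apply: (lle_trans HL (@labs_sum _ _ _ HL N (fun i => s i *: d i))).
rewrite scaler_sumr; apply: (@lsum_le _ _ _ HL N (fun i => labs (s i *: d i)) (fun i => S *: d i)).
move=> i iN; rewrite (labs_scale HL) (labs_pos HL (d0 i)).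
by apply: lscale_mono => //; exact: sS.
Qed.

Lemma signed_sum_norm_le d (s : nat -> R) C N : (forall i, 0 [<=] d i) ->
  (forall i, `|s i| <= 1) -> `|\sum_(i < N) d i| <= C -> `|\sum_(i < N) s i *: d i| <= C.
Proof.
move=> d0 s1; apply: le_trans; apply: (lnorm_abs_le HL).
by rewrite -[X in _ [<=] X]scale1r; exact: signed_sum_le.
Qed.

(** Sums of disjoint elements below [u] stay below [u], so the numbers [|f (d n)|] have bounded
    sums. *)
Lemma disjoint_dual_to0 d u f : disjoint_seq d -> (forall n, d n [<=] u) -> is_dual f ->
  forall e, 0 < e -> exists N, forall n, (N <= n)%N -> `|f (d n)| <= e.
Proof.
move=> dd du Df; have [d0 _] := dd.
have u0 : 0 [<=] u by exact: lle_trans (d0 0%N) (du 0%N).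
apply: (@bounded_sums_terms_to0 _ (fun i => `|f (d i)|) (dual_norm f * `|u|)) => // N.
apply: dual_sum_bound => // s M s1; apply: signed_sum_norm_le => //.
by apply: (lnorm_le_pos HL); [exact: lsum_ge0|exact: disjoint_sum_le].
Qed.

Lemma disjoint_uaw_null d : disjoint_seq d -> uaw_null L d.
Proof.
move=> [d0 dd] u u0; apply/weakly_null_eps => f Df.
apply: (@disjoint_dual_to0 _ u) => //; last by move=> n; lattice.
split=> [n|n m nm]; first by move: (d0 n) u0; lattice.
by rewrite !(labs_pos HL (d0 _)); move: (dd n m nm) (d0 n) (d0 m) u0; lattice.
Qed.

(** The sum of the [2^-n *: x n] places all the terms in one principal ideal, so that they can be
    truncated by multiples of a single element. *)
Lemma dominating_element (x : nat -> E) M : (forall n, 0 [<=] x n) -> (forall n, `|x n| <= M) ->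
  exists e, 0 [<=] e /\ forall n, x n [<=] 2 ^+ n *: e.
Proof.
move=> x0 xM; pose s n := \sum_(i < n) 2^-1 ^+ i *: x i.
have t0 i : 0 [<=] 2^-1 ^+ i *: x i.
  by apply: lscale_ge0 => //; exact/ltW/half_pow_gt0.
have [e se] : exists e : E, s @ \oo --> e.
  apply: (@geometric_cvg _ _ _ M) => n; rewrite /s big_ord_recr/= addrAC subrr add0r.
  by rewrite normrZ (gtr0_norm (half_pow_gt0 _ _)) mulrC ler_wpM2r// ltW// half_pow_gt0.
exists e; split.
  by apply: (lge_lim HL se); exists 0%N => n _; exact: (lsum_ge0 HL n t0).
move=> n; have h : 2^-1 ^+ n *: x n [<=] e.
  apply: (lge_lim HL se); exists n.+1 => m nm.
  exact: (@lsum_ge_term _ _ _ HL m (fun i => 2^-1 ^+ i *: x i)).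
have := @lle_scale _ _ _ HL (2 ^+ n) _ _ (exprn_ge0 n (ler0n _ 2)) h.
by rewrite scalerA -exprMn mulfV// expr1n scale1r.
Qed.

(** The second factor is [t^-1] times the negative part of [b - t *: a], hence below that negative
    part, and the first is the positive part. *)
Lemma disjoint_cut a b (t : R) : 1 <= t ->
  ((b - t *: a) [\/] 0) [/\] ((a - t^-1 *: b) [\/] 0) [<=] 0.
Proof.
move=> t1; have t0 : 0 < t by exact: lt_le_trans t1.
have le : (a - t^-1 *: b) [\/] 0 [<=] (t *: a - b) [\/] 0.
  have -> : a - t^-1 *: b = t^-1 *: (t *: a - b).
    by rewrite scalerBr scalerA mulVf ?gt_eqF// scale1r.
  rewrite -[0 in X in X [<=] _](scaler0 _ t^-1) -ljoin_scale ?invr_gt0//.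
  rewrite -[X in _ [<=] X]scale1r; apply: lscale_mono => //; last exact: ljoinr.
  by rewrite invf_le1.
by move: le; set v := _ *: b; move: (t *: a) (a - v) => {}a c; lattice.
Qed.

(* Otherwise [f] stays away from zero on a bounded disjoint sequence built from
   the terms of [x] on which it fails. *)
Lemma uniform_truncation f (x : nat -> E) (e : E) M : positive_dual L f ->
  (forall d, disjoint_seq d -> (forall n, `|d n| <= M) ->
     forall r, 0 < r -> exists N, forall n, (N <= n)%N -> f (d n) <= r) ->
  (forall n, 0 [<=] x n) -> (forall n, `|x n| <= M) -> 0 [<=] e ->
  (forall n, exists C, x n [<=] C *: e) ->
  forall r, 0 < r -> exists k : nat, forall n, f ((x n - k%:R *: e) [\/] 0) <= r.
Proof.
move=> pf fdis x0 xM e0 xe r r0; apply: contrapT => nk.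
have {}nk k : exists n, r < f ((x n - k%:R *: e) [\/] 0).
  apply: contrapT => nn; apply: nk; exists k => n; rewrite leNgt; apply/negP => h.
  by apply: nn; exists n.
have q0 n : 0 < (2^-1 : R) ^+ n := half_pow_gt0 R n.
pose S n (a : nat -> nat) := \sum_(i < n) x (a i).
have [||a aP] := @history_choice nat 0%N
    (fun n a t => r < f ((x t - 4 ^+ n *: S n a) [\/] 0)).
- move=> n a _.
  have [C SC] : exists C, S n a [<=] C *: e.
    elim: n => [|n [C IH]]; first by exists 0; rewrite /S big_ord0 scale0r; exact: lle_refl.
    have [C' xC'] := xe (a n); exists (C + C').
    by rewrite /S big_ord_recr/= scalerDl; exact: lle_add.
  pose k := Num.bound (`|4 ^+ n * C|); have [t nt] := nk k; exists t.
  apply: (lt_le_trans nt); apply: (pdual_mono HL pf).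
  have : 4 ^+ n *: S n a [<=] k%:R *: e.
    apply: (lle_trans HL (@lle_scale _ _ _ HL (4 ^+ n) _ _ (exprn_ge0 n (ler0n _ 4)) SC)).
    rewrite scalerA; apply: lscale_mono => //.
    by apply: le_trans (ler_norm _) _; apply: ltW; exact: archi_boundP.
  by move: (_ *: S n a) (_ *: e) => v w; lattice.
- by move=> n a b t ab; rewrite /S; under eq_bigr do rewrite ab//.
pose y n := x (a n); have y0 n : 0 [<=] y n by exact: x0.
have [e' [e'0 ye']] := dominating_element y0 (fun n => xM (a n)).
(* For [i < n], [4 ^ n *: S n a] removes the multiple [4 ^ n *: y i] from [y n], while [2^-i *: e']
   removes at least [4 ^ -n *: y n] from [y i], because [y n [<=] 2 ^ n *: e']. This is the
   situation of [disjoint_cut] with [t = 4 ^ n]. *)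
pose d n := (y n - 4 ^+ n *: S n a - 2^-1 ^+ n *: e') [\/] 0.
have Sge i n : (i < n)%N -> y i [<=] S n a.
  by move=> h; exact: (@lsum_ge_term _ _ _ HL n y).
have Sge0 n : 0 [<=] 4 ^+ n *: S n a.
  by apply: lscale_ge0; rewrite ?exprn_ge0//; exact: (lsum_ge0 HL n y0).
have qe0 n : 0 [<=] 2^-1 ^+ n *: e' by apply: lscale_ge0 => //; exact: ltW.
have dd : disjoint_seq d.
  split=> [n|i n ltin]; first exact: ljoinr.
  have h1 : d n [<=] (y n - 4 ^+ n *: y i) [\/] 0.
    have : 4 ^+ n *: y i [<=] 4 ^+ n *: S n a.
      by apply: lle_scale; rewrite ?exprn_ge0//; exact: Sge.
    move: (qe0 n); rewrite /d; move: (_ *: S n a) (_ *: e') (_ *: y i) => u v w; lattice.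
  have h2 : d i [<=] (y i - (4 ^+ n)^-1 *: y n) [\/] 0.
    have : (4 ^+ n)^-1 *: y n [<=] 2^-1 ^+ i *: e'.
      have p4 : 0 <= (4 ^+ n)^-1 :> R by rewrite invr_ge0 exprn_ge0.
      apply: (lle_trans HL (@lle_scale _ _ _ HL _ _ _ p4 (ye' n))).
      rewrite scalerA; apply: lscale_mono => //.
      have -> : (4 ^+ n)^-1 * 2 ^+ n = 2^-1 ^+ n :> R.
        by rewrite -exprVn -exprMn; congr (_ ^+ n); field.
      by apply: ler_wiXn2l; [rewrite invr_ge0|rewrite invf_le1// ler1n|exact: ltnW].
    move: (Sge0 i); rewrite /d; move: (_ *: S i a) (_ *: e') (_ *: y n) => u v w; lattice.
  have := @disjoint_cut (y i) (y n) (4 ^+ n) _; rewrite exprn_ege1 ?ler1n// => /(_ isT).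
  move: h1 h2; move: (_ [\/] 0) (_ [\/] 0) (d i) (d n) => u v w z; lattice.
have dM n : `|d n| <= M.
  apply: le_trans (xM (a n)); apply: (lnorm_le_pos HL); first exact: ljoinr.
  move: (y0 n) (qe0 n) (Sge0 n); rewrite /d -/(y n).
  by move: (_ *: S n a) (_ *: e') => u v; lattice.
have r20 : 0 < r / 2 by rewrite divr_gt0.
have [N hN] := fdis d dd dM _ r20.
have r40 : 0 < r / 4 by rewrite divr_gt0.
have [N' hN'] := half_pow_small (f e') r40.
pose n := maxn N N'.
have := hN n (leq_maxl _ _); have := hN' n (leq_maxr _ _); have := aP n.
have : f ((y n - 4 ^+ n *: S n a) [\/] 0) <= f (d n) + f (2^-1 ^+ n *: e').
  rewrite -(dualD pf.1); apply: (pdual_mono HL pf).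
  move: (qe0 n); rewrite /d; move: (_ *: e') (_ *: S n a) => u v; lattice.
rewrite (dualZ pf.1) -/(y n); lra.
Qed.

End disjoint_sequences.

(** * Operators on reflexive Banach lattices *)

Lemma increasing_subsequence (P : nat -> Prop) : (forall N, exists n, (N <= n)%N /\ P n) ->
  exists phi : nat -> nat, (forall i, P (phi i)) /\ forall i j, (i < j)%N -> (phi i < phi j)%N.
Proof.
move=> /choice[h hP]; pose fix phi i := if i is j.+1 then h (phi j).+1 else h 0%N.
exists phi; split=> [[|i]|]; [exact: (hP _).2|exact: (hP _).2|].
move=> i j; elim: j => // j IH; rewrite ltnS leq_eqVlt.
have h1 : (phi j < phi j.+1)%N by exact: (hP (phi j).+1).1.
by move=> /predU1P[->//|/IH h2]; exact: ltn_trans h2 h1.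
Qed.

Lemma increasing_ge_id (phi : nat -> nat) i :
  (forall i j, (i < j)%N -> (phi i < phi j)%N) -> (i <= phi i)%N.
Proof. by move=> inc; elim: i => // i IH; apply: (leq_ltn_trans IH); exact: inc. Qed.

Section ultralimit_order.
Variable R : realType.

Lemma ulim_norm_le (a : nat -> R) C : (forall n, `|a n| <= C) -> `|ulim a| <= C.
Proof.
move=> aC; apply/ler_addgt0Pr => e e0.
have [n [_ an]] := ulim_frequently e0 aC 0%N.
have -> : ulim a = a n - (a n - ulim a) by rewrite opprB addrC subrK.
by apply: le_trans (ler_normB _ _) _; rewrite lerD// ltW.
Qed.

Lemma ulim_eventually_ge (a : nat -> R) c C N : (forall n, `|a n| <= C) ->
  (forall n, (N <= n)%N -> c <= a n) -> c <= ulim a.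
Proof.
move=> aC ca; apply/ler_addgt0Pr => e e0.
have [n [Nn]] := ulim_frequently e0 aC N; have := ca n Nn.
by rewrite ltr_norml => h1 /andP[h2 h3]; lra.
Qed.

Lemma ulim_eventually_cst (a : nat -> R) c C N : (forall n, `|a n| <= C) ->
  (forall n, (N <= n)%N -> a n = c) -> ulim a = c.
Proof.
move=> aC ac; apply/eqP; rewrite eq_sym -subr_eq0 -normr_le0; apply/ler_addgt0Pr => e e0.
by have [n [Nn]] := ulim_frequently e0 aC N; rewrite ac// add0r; exact: ltW.
Qed.

End ultralimit_order.

Section reflexive_spaces.
Variables (R : realType) (E : completeNormedModType R).

Lemma closure_of_annihilator (S : E -> Prop) x :
  S 0 -> (forall a x y, S x -> S y -> S (a *: x + y)) ->
  (forall g, is_dual g -> (forall z, `|g z| <= `|z|) -> (forall s, S s -> g s = 0) -> g x <= 0) ->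
  forall e : R, 0 < e -> exists s, S s /\ `|x - s| <= e.
Proof.
move=> S0 SS gx e e0; apply: contrapT => nS.
have [s Ss|g [Dg g1 gS gx0]] := @annihilator R E S x e S0 SS e0.
  by rewrite leNgt; apply/negP => /ltW h; apply: nS; exists s.
by have := gx g Dg g1 gS; rewrite leNgt gx0.
Qed.

Lemma dual_subspace0 : is_dual (0 : E -> R^o). Proof. exact: dual_zero. Qed.

Lemma dual_subspaceS (a : R) (u v : E -> R^o) : is_dual u -> is_dual v -> is_dual (a *: u + v).
Proof. exact: dual_comb. Qed.

Lemma sublinear_minorant_bidual (l : (E -> R^o) -> R) C : 0 <= C ->
  linear_on (@is_dual R E : (E -> R^o) -> Prop) l ->
  (forall f, is_dual f -> l f <= C * dual_norm f) -> is_bidual l.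
Proof.
move=> C0 ll lC; split=> [a f g Df Dg|]; first exact: ll.
exists C => f Df; rewrite ler_norml lC// andbT.
have Dn : is_dual (-1 *: f : E -> R^o) by exact: (dual_scale (-1)).
have := lC _ Dn.
have l0 : l 0 = 0.
  by have := ll (-1) _ _ dual_subspace0 dual_subspace0; rewrite scaler0 addr0; lra.
have := ll (-1) _ _ Df dual_subspace0; rewrite addr0 l0 addr0 mulN1r => ->.
rewrite lerNl => h; apply: (le_trans _ h); rewrite lerN2; apply: ler_wpM2l => //.
apply: (dual_norm_le Dn) => x x1; rewrite (_ : (-1 *: f : E -> R^o) x = - f x) ?normrN; last exact: mulN1r.
apply: le_trans (dual_normP Df x) _; rewrite ler_piMr// dual_norm_ge0//.
Qed.

Hypothesis Erefl : reflexive_space E.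

(** Weak compactness of balls along a fixed ultrafilter: the ultralimit of [f (x n)] is a bidual
    functional of [f], so reflexivity represents it by a point. *)
Lemma reflexive_ulim (x : nat -> E) M : (forall n, `|x n| <= M) ->
  exists z, forall f, is_dual f -> f z = ulim (fun n => f (x n)).
Proof.
move=> xM; have fb f : is_dual f -> forall n, `|f (x n)| <= M * dual_norm f.
  move=> Df n; apply: le_trans (dual_normP Df _) _; rewrite mulrC.
  by rewrite ler_wpM2r ?dual_norm_ge0.
have [|z zP] := Erefl (Phi := fun f => ulim (fun n => f (x n))); last first.
  by exists z => f /zP.
split=> [a f g Df Dg|]; first exact: ulim_linear (fb _ Df) (fb _ Dg).
by exists M => f Df; apply: ulim_norm_le; exact: fb.
Qed.

Lemma rational_approx (c e : R) : 0 < e -> exists q : rat, `|c - ratr q| <= e.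
Proof.
move=> e0; have ce : c - e < c + e by lra.
have [q] := rat_in_itvoo ce; rewrite in_itv /= => /andP[h1 h2]; exists q.
by rewrite ler_norml; apply/andP; split; lra.
Qed.

(** Separability of [E] is not assumed. The subsequence is chosen to converge at countably many
    [y j], each nearly norming one rational combination of the [f i]. The points [x] of convergence
    form a closed subspace [S], and a functional vanishing on [S] turns out to be zero. *)
Lemma reflexive_dual_subsequence (f : nat -> E -> R) : (forall n, is_dual (f n)) ->
  (forall n x, `|f n x| <= `|x|) ->
  exists (k : nat -> nat) (l : E -> R), [/\ forall i, (i <= k i)%N, is_dual l &
    forall x e, 0 < e -> exists N, forall i, (N <= i)%N -> `|f (k i) x - l x| <= e].
Proof.
move=> Df f1.
pose l x := ulim (fun n => f n x).
have Dl : is_dual l.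
  apply: (@bounded_is_dual _ _ _ 1) => // [a x y|x].
    rewrite /l -(ulim_linear a (fun n => f1 n x) (fun n => f1 n y)).
    by congr ulim; apply/funext => n; rewrite (dualD (Df n)) (dualZ (Df n)).
  by rewrite mul1r; apply: ulim_norm_le => n; exact: f1.
have l1 x : `|l x| <= `|x| by apply: ulim_norm_le => n; exact: f1.
pose comb n (c : nat -> R) x := \sum_(i < n) c i * f i x.
have Dcomb n c : is_dual (comb n c).
  elim: n => [|n IH].
    by rewrite (_ : comb 0%N c = fun=> 0); [exact: dual_zero|apply/funext => x; rewrite /comb big_ord0].
  rewrite (_ : comb n.+1 c = fun x => c n * f n x + comb n c x); first exact: dual_comb.
  by apply/funext => x; rewrite /comb big_ord_recr/= addrC.
pose rat_comb j := if unpickle j is Some s then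
  comb (size s) (fun i => ratr (nth 0 s i : rat)) else comb 0%N (fun=> 0).
have Drat j : is_dual (rat_comb j) by rewrite /rat_comb; case: unpickle.
have /choice[y yP] : forall j, exists x, `|x| <= 1 /\ dual_norm (rat_comb j) <= 2 * rat_comb j x.
  move=> j; have [N0|N0] := eqVneq (dual_norm (rat_comb j)) 0.
    by exists 0; rewrite normr0 N0 (dual0 (Drat j)) mulr0.
  have Np : 0 < dual_norm (rat_comb j) / 2 by rewrite divr_gt0// lt_def N0 dual_norm_ge0.
  by have [x [x1 fx]] := dual_norm_adherent (Drat j) Np; exists x; split=> //; lra.
have /choice[k kP] : forall i : nat, exists n, (i <= n)%N /\
    forall j, (j < i)%N -> `|f n (y j) - l (y j)| < 2^-1 ^+ i.
  move=> i; apply: (@ulim_approx R i i (fun j n => f n (y j))) => [|j _].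
    exact: half_pow_gt0.
  by exists `|y j| => n; exact: f1.
have ki i : (i <= k i)%N by case: (kP i).
exists k, l; split=> // x.
pose S x := forall e, 0 < e -> exists N, forall i, (N <= i)%N -> `|f (k i) x - l x| <= e.
have S0 : S 0.
  by move=> e e0; exists 0%N => i _; rewrite (dual0 (Df _)) (dual0 Dl) subrr normr0 ltW.
have SS a u v : S u -> S v -> S (a *: u + v).
  move=> Su Sv e e0; have e1 : 0 < e / (`|a| + 1) / 2 by rewrite !divr_gt0// ltr_wpDl.
  have e2 : 0 < e / 2 by rewrite divr_gt0.
  have [N hN] := Su _ e1; have [N' hN'] := Sv _ e2; exists (maxn N N') => i.
  rewrite geq_max => /andP[/hN h1 /hN' h2].
  rewrite !(dualD (Df _)) !(dualD Dl) !(dualZ (Df _)) !(dualZ Dl).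
  have -> : a * f (k i) u + f (k i) v - (a * l u + l v) =
    a * (f (k i) u - l u) + (f (k i) v - l v) by ring.
  apply: le_trans (ler_normD _ _) _; rewrite normrM.
  have : `|a| * `|f (k i) u - l u| <= (`|a| + 1) * (e / (`|a| + 1) / 2).
    by apply: ler_pM => //; rewrite lerDl.
  have -> : (`|a| + 1) * (e / (`|a| + 1) / 2) = e / 2.
    by field; rewrite gt_eqF// ltr_wpDl.
  lra.
have Sy j : S (y j).
  move=> e e0; have [N hN] := half_pow_small 1 e0; exists (maxn N j.+1) => i.
  rewrite geq_max => /andP[Ni ji]; have := (kP i).2 j ji; have := hN i Ni.
  rewrite mul1r => h1 h2; exact: le_trans (ltW h2) h1.
have Sclosed z : (forall e : R, 0 < e -> exists s, S s /\ `|z - s| <= e) -> S z.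
  move=> h e e0; have e3 : 0 < e / 3 by rewrite divr_gt0.
  have [s [Ss zs]] := h _ e3; have [N hN] := Ss _ e3; exists N => i /hN h1.
  have -> : f (k i) z - l z = f (k i) (z - s) + (f (k i) s - l s) - l (z - s).
    by rewrite (dualB (Df _)) (dualB Dl); ring.
  have h2 := le_trans (f1 (k i) (z - s)) zs; have h3 := le_trans (l1 (z - s)) zs.
  apply: le_trans (ler_normB _ _) _; have := ler_normD (f (k i) (z - s)) (f (k i) s - l s).
  lra.
apply: Sclosed; apply: closure_of_annihilator => // g Dg g1 gS.
(* [g] kills the common kernel of the [f n], so by reflexivity it lies in the
   norm closure of their span; a rational combination close to [g] almost
   attains its norm at some [y j], where [g] vanishes. *)
suff small e : 0 < e -> dual_norm g <= 6 * e.
  apply/ler_addgt0Pr => e e0; rewrite add0r.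
  have e7 : 0 < e / (6 * (`|x| + 1)) by rewrite divr_gt0// mulr_gt0// ltr_wpDl.
  apply: le_trans (ler_norm _) _; apply: le_trans (dual_normP Dg x) _.
  have hx : 0 < `|x| + 1 by rewrite ltr_wpDl.
  have h2 : 6 * (e / (6 * (`|x| + 1))) * (`|x| + 1) = e by field; rewrite gt_eqF.
  rewrite -[leRHS]h2.
  apply: ler_pM; rewrite ?dual_norm_ge0 ?lerDl//; exact: small.
move=> e0.
pose W (w : E -> R^o) := exists n c, w = comb n c.
have [[n [c nc]]|nW] := pselect (exists n c, dual_norm (fun z => g z - comb n c z) <= e).
  have d0 : 0 < e / n.+1%:R by rewrite divr_gt0.
  have /choice[q qP] : forall i, exists q : rat, `|c i - ratr q| <= e / n.+1%:R.
    by move=> i; exact: rational_approx.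
  pose j := pickle (mkseq q n).
  have rE z : rat_comb j z = \sum_(i < n) ratr (q i) * f i z.
    rewrite /rat_comb pickleK /comb size_mkseq; apply: eq_bigr => i _.
    by rewrite nth_mkseq.
  have close z : `|z| <= 1 -> `|rat_comb j z - g z| <= 2 * e.
    move=> z1.
    have h1 : `|rat_comb j z - comb n c z| <= e.
      rewrite rE /comb -sumrB; apply: le_trans (ler_norm_sum _ _ _) _.
      apply: le_trans (_ : \sum_(i < n) e / n.+1%:R <= _).
        apply: ler_sum => i _; rewrite -mulrBl normrM -[leRHS]mulr1.
        by apply: ler_pM => //; [rewrite distrC|exact: le_trans (f1 i z) z1].
      rewrite sumr_const card_ord -[leLHS]mulr_natr mulrAC ler_pdivrMr//.
      by rewrite ler_pM2l// ler_nat.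
    have h2 : `|g z - comb n c z| <= e.
      have Dgc : is_dual (fun z => g z - comb n c z) by exact: dual_sub.
      apply: le_trans (dual_normP Dgc z) _; rewrite -[leRHS]mulr1.
      by apply: ler_pM => //; exact: dual_norm_ge0.
    have -> : rat_comb j z - g z = (rat_comb j z - comb n c z) - (g z - comb n c z) by ring.
    by apply: le_trans (ler_normB _ _) _; lra.
  have [y1 yj] := yP j; have := close _ y1; rewrite gS// subr0 => h3.
  have h4 := le_trans (ler_norm _) h3.
  apply: (dual_norm_le Dg) => z z1.
  have := dual_normP (Drat j) z; have := close z z1 => h5 h6.
  have h7 : dual_norm (rat_comb j) * `|z| <= 4 * e.
    rewrite -[leRHS]mulr1; apply: ler_pM; rewrite ?dual_norm_ge0//; lra.
  have -> : g z = rat_comb j z - (rat_comb j z - g z) by ring.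
  by apply: le_trans (ler_normB _ _) _; lra.
exfalso.
have DW w : W w -> is_dual w by move=> [n [c ->]]; exact: Dcomb.
have WS a u v : W u -> W v -> W (a *: u + v).
  move=> [n [c ->]] [n' [c' ->]].
  exists (maxn n n'), (fun i => a * (if (i < n)%N then c i else 0) + (if (i < n')%N then c' i else 0)).
  have wide m m' (b : nat -> R) z : (m <= m')%N ->
      comb m b z = \sum_(i < m') (if (i < m)%N then b i else 0) * f i z.
    move=> mm; rewrite /comb (big_ord_widen _ (fun i => b i * f i z) mm) big_mkcond/=.
    by apply: eq_bigr => i _; case: ifP; rewrite ?mul0r.
  apply/funext => z; rewrite [RHS]/comb.
  have -> : (a *: comb n c + comb n' c' : E -> R^o) z = a * comb n c z + comb n' c' z by [].
  have E1 : a * comb n c z + comb n' c' z = \sum_(i < maxn n n')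
      (a * (if (i < n)%N then c i else 0) + (if (i < n')%N then c' i else 0)) * f i z.
    rewrite (wide _ _ _ _ (leq_maxl n n')) (wide _ _ _ _ (leq_maxr n n')) mulr_sumr -big_split/=.
    by apply: eq_bigr => i _; ring.
  exact: E1.
have W0 : W 0 by exists 0%N, (fun=> 0); apply/funext => z; rewrite /comb big_ord0.
have [u Du|w [n [c ->]]|L [LL Lp LW Lg]] := @separation_from_subspace R (E -> R^o) (@is_dual R E)
  dual_subspace0 dual_subspaceS (@dual_norm R E) W g e (dual_norm_sublinear E) W0 WS DW Dg e0.
- exact: dual_norm_ge0.
- have -> : (g : E -> R^o) + comb n c = (fun z => g z - comb n (fun i => - c i) z).
    apply/funext => z; rewrite [LHS]/(g z + comb n c z) /comb -sumrN; congr (_ + _).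
    by apply: eq_bigr => i _; rewrite mulNr opprK.
  by rewrite leNgt; apply/negP => /ltW h; apply: nW; exists n, (fun i => - c i).
have [|z zP] := Erefl (Phi := L).
  by apply: (@sublinear_minorant_bidual L 1) => // u Du; rewrite mul1r; exact: Lp.
have Wf i : W (f i).
  exists i.+1, (fun j => (j == i)%:R); apply/funext => u.
  rewrite /comb big_ord_recr/= eqxx mul1r big1 ?add0r// => j _.
  by rewrite (ltn_eqF (ltn_ord j)) mul0r.
have fz i : f i z = 0 by rewrite -zP// LW.
have Sz : S z.
  move=> r r0; exists 0%N => i _; rewrite fz sub0r normrN (_ : l z = 0) ?normr0 ?ltW//.
  by apply: (@ulim_eventually_cst _ _ 0 0 0%N) => // n; rewrite fz// normr0.
by move: Lg; rewrite zP// gS// ltxx.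
Qed.

End reflexive_spaces.

Section reflexive_lattices.
Variables (R : realType) (E : completeNormedModType R) (L : lattice_ops E).
Hypothesis HL : is_banach_lattice L.
Hypothesis Erefl : reflexive_space E.
Implicit Types (x y z u : E) (f g : E -> R) (d : nat -> E).

Local Notation "x [<=] y" := (lle L x y) (at level 70, no associativity).
Local Notation "x [\/] y" := (ljoin L x y) (at level 50, left associativity).
Local Notation "x [/\] y" := (lmeet L x y) (at level 48, left associativity).
Local Notation labs := (labs L).

Lemma meet_scale0 (c : R) x y : 0 <= c -> 0 [<=] x -> 0 [<=] y -> x [/\] y [<=] 0 ->
  (c *: x) [/\] y [<=] 0.
Proof.
move=> c0 x0 y0 xy; have h1 : c *: x [<=] (c + 1) *: x by apply: lscale_mono; rewrite ?lerDl.
have h2 : y [<=] (c + 1) *: y.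
  by rewrite -[X in X [<=] _]scale1r; apply: lscale_mono; rewrite ?lerDr.
have c1 : 0 < c + 1 by rewrite ltr_wpDl.
have : (c + 1) *: (x [/\] y) [<=] (c + 1) *: 0 by apply: lle_scale => //; exact: ltW.
rewrite scaler0 lmeet_scale//; move: h1 h2.
move: (_ *: x) (_ *: x) (_ *: y) => u v w; lattice.
Qed.

Lemma disjoint_complement_subspace y : 0 [<=] y ->
  let S x := labs x [/\] y [<=] 0 in
  S 0 /\ forall a u v, S u -> S v -> S (a *: u + v).
Proof.
move=> y0 S; split; first by move: y0; rewrite /S; lattice.
move=> a u v; rewrite /S => Su Sv.
have : (`|a| *: labs u) [/\] y [<=] 0 by apply: meet_scale0 => //; exact: labs_ge0.
by rewrite -labs_scale//; move: y0 Sv; move: (a *: u) => w; lattice.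
Qed.

Lemma disjoint_complement_closed y x : 0 [<=] y ->
  (forall e : R, 0 < e -> exists s, labs s [/\] y [<=] 0 /\ `|x - s| <= e) ->
  labs x [/\] y [<=] 0.
Proof.
move=> y0 h; suff -> : labs x [/\] y = 0 by exact: lle_refl.
apply/eqP; rewrite -normr_le0; apply/ler_addgt0Pr => e e0; rewrite add0r.
have [s [sy xs]] := h e e0; apply: le_trans xs; rewrite -(lnorm_abs HL (x - s)).
by apply: (lnorm_le_pos HL); move: y0 sy; lattice.
Qed.

(* A weak cluster point of a bounded disjoint sequence is disjoint from each
   term, hence from their closed span, which contains it. *)
Lemma reflexive_disjoint_dual_to0 d f M : disjoint_seq L d -> (forall n, `|d n| <= M) ->
  positive_dual L f -> forall e, 0 < e -> exists N, forall n, (N <= n)%N -> f (d n) <= e.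
Proof.
move=> [d0 dd] dM pf e e0; apply: contrapT => nN.
have [|phi [phie phiS]] := @increasing_subsequence (fun n => e < f (d n)).
  move=> N; apply: contrapT => nn; apply: nN; exists N => n Nn.
  by rewrite leNgt; apply/negP => h; apply: nn; exists n.
pose c n := d (phi n).
have cM n : `|c n| <= M by exact: dM.
have [x xP] := reflexive_ulim Erefl cM.
have gM g : (forall z, `|g z| <= `|z|) -> forall n, `|g (c n)| <= M.
  by move=> g1 n; exact: le_trans (g1 _) (cM n).
have xc i : labs x [/\] c i [<=] 0.
  have [S0 SS] := disjoint_complement_subspace (d0 (phi i)).
  apply: disjoint_complement_closed; first exact: d0.
  apply: closure_of_annihilator => // g Dg g1 gS; rewrite xP//.
  rewrite (@ulim_eventually_cst _ _ 0 M i.+1)//; first exact: gM.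
  move=> n ltin; apply: gS; have := dd _ _ (phiS _ _ ltin).
  by move: (d0 (phi i)) (d0 (phi n)); rewrite /c; lattice.
have xx : labs x [/\] labs x [<=] 0.
  have [S0 SS] := disjoint_complement_subspace (labs_ge0 HL x).
  apply: disjoint_complement_closed; first exact: labs_ge0.
  apply: closure_of_annihilator => // g Dg g1 gS; rewrite xP//.
  rewrite (@ulim_eventually_cst _ _ 0 M 0%N)//; first exact: gM.
  move=> n _; apply: gS; move: (xc n) (d0 (phi n)); rewrite /c; lattice.
have x0 : x = 0 by apply: (lle_anti HL); move: xx; lattice.
have : e <= ulim (fun n => f (c n)).
  apply: (@ulim_eventually_ge _ _ _ (dual_norm f * M) 0%N) => [n|n _]; last exact/ltW/phie.
  apply: le_trans (dual_normP pf.1 _) _; rewrite ler_wpM2l//.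
  exact: dual_norm_ge0 pf.1.
by rewrite -xP ?x0 ?(dual0 pf.1) ?leNgt ?e0//; exact: pf.1.
Qed.

End reflexive_lattices.

Section uaw_null_weakly_null.
Variables (R : realType) (E : completeNormedModType R) (L : lattice_ops E).
Hypothesis HL : is_banach_lattice L.

(** For a Banach lattice this is equivalent to order continuity of the dual norm. Positive
    functionals suffice, since the modulus dominates any other. *)
Definition dual_order_continuous := forall (d : nat -> E) (f : E -> R) M,
  disjoint_seq L d -> (forall n, `|d n| <= M) -> positive_dual L f ->
  forall e, 0 < e -> exists N, forall n, (N <= n)%N -> f (d n) <= e.

Hypothesis Eoc : dual_order_continuous.

Lemma uaw_null_weakly_null (x : nat -> E) M : (forall n, `|x n| <= M) ->
  uaw_null L x -> weakly_cvg x 0.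
Proof.
move=> xM xu; apply/weakly_null_eps => f Df e e0.
have [g [pg fg _ _]] := functional_modulus HL Df (dual_norm_ge0 Df) (dual_normP Df).
have ax0 n : lle L 0 (labs L (x n)) by exact: labs_ge0.
have axM n : `|labs L (x n)| <= M by rewrite lnorm_abs.
have [u [u0 xu2]] := dominating_element HL ax0 axM.
have e20 : 0 < e / 2 by rewrite divr_gt0.
have [||k kP] := @uniform_truncation _ _ _ HL g _ u M pg _ ax0 axM u0 _ _ e20.
- by move=> d dd dM; exact: Eoc pg.
- by move=> n; exists (2 ^+ n).
have ku0 : lle L 0 (k%:R *: u) by apply: lscale_ge0.
have /weakly_null_eps/(_ g pg.1 _ e20)[N hN] := xu _ ku0.
exists N => n Nn; apply: le_trans (fg _) _.
have -> : labs L (x n) = lmeet L (labs L (x n)) (k%:R *: u) + ljoin L (labs L (x n) - k%:R *: u) 0.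
  by move: (_ *: u) => v; lattice.
rewrite (dualD pg.1); have := kP n; have := hN n Nn; rewrite ler_norml => /andP[_].
lra.
Qed.

End uaw_null_weakly_null.

Theorem reflexive_weak_DP_uaw_DP (R : realType) (E : completeNormedModType R)
    (L : lattice_ops E) (T : E -> E) : is_banach_lattice L -> reflexive_space E ->
  is_operator T -> weak_DP T -> uaw_DP L T.
Proof.
move=> HL Erefl [Tl Tc] TDP x [M xM] xu.
have Eoc : dual_order_continuous L.
  by move=> d f M' dd dM pf; exact: reflexive_disjoint_dual_to0 dM pf.
have /weakly_null_eps xw := uaw_null_weakly_null HL Eoc xM xu.
apply/cvg0_eps => e e0; apply: contrapT => nN.
have [|phi [phie phiS]] := @increasing_subsequence (fun n => e < `|T (x n)|).
  move=> N; apply: contrapT => nn; apply: nN; exists N => n Nn; rewrite normr_id.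
  by rewrite leNgt; apply/negP => h; apply: nn; exists n.
have /choice[f fP] : forall i, exists f, [/\ is_dual f, forall z, `|f z| <= `|z| &
    f (T (x (phi i))) = `|T (x (phi i))|].
  by move=> i; exact: norming_functional.
have Df i : is_dual (f i) by case: (fP i).
have [|k [l [ki Dl fl]]] := reflexive_dual_subsequence Erefl Df.
  by move=> i; case: (fP i).
pose y i := x (phi (k i)).
have yN N i : (N <= i)%N -> (N <= phi (k i))%N.
  move=> Ni; apply: (leq_trans Ni); apply: (leq_trans (ki i)).
  exact: increasing_ge_id.
have yw : weakly_cvg y 0.
  apply/weakly_null_eps => g Dg r r0; have [N hN] := xw g Dg r r0.
  by exists N => i Ni; apply: hN; exact: yN.
have fw : dual_weakly_null (fun i z => f (k i) z - l z).
  split=> [i|Phi /Erefl[z zP]]; first exact: dual_sub.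
  apply/cvg0_eps => r r0; have [N hN] := fl z r r0; exists N => i /hN.
  by rewrite zP//; exact: dual_sub.
have e20 : 0 < e / 2 by rewrite divr_gt0.
have /cvg0_eps/(_ _ e20)[N1 h1] := TDP y _ yw fw.
have DlT : is_dual (fun z => l (T z)).
  split=> [a u v|z]; first by rewrite Tl; exact: Dl.1.
  by apply: continuous_comp; [exact: Tc|exact: Dl.2].
have [N2 h2] := xw _ DlT _ e20.
pose i := maxn N1 N2; have := h1 i (leq_maxl _ _).
have := h2 (phi (k i)) (yN N2 i (leq_maxr _ _)).
have [_ _] := fP (k i); rewrite /y => -> h3 h4.
have := phie (k i); apply/negP; rewrite -leNgt.
move: h3 h4; rewrite !ler_norml => /andP[_ h3] /andP[_ h4]; lra.
Qed.

(** * Weakly null sequences of functionals *)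

Section schur_property.
Variable R : realType.

Lemma ulim_partial_sums_tail (b : nat -> R) C K c : (forall N, `|\sum_(k < N) b k| <= C) ->
  (forall M, (K <= M)%N -> c <= \sum_(k < M) b k) -> c <= ulim (fun N => \sum_(k < N) b k).
Proof. by move=> bC cb; exact: (ulim_eventually_ge bC cb). Qed.

(* Gliding hump: the signs of successive disjoint blocks of rows are glued into
   one bounded sequence, which contradicts weak convergence. *)
Lemma l1_schur (a : nat -> nat -> R) :
  (forall n, exists C, forall N, \sum_(k < N) `|a n k| <= C) ->
  (forall s : nat -> R, (forall k, `|s k| <= 1) -> forall e, 0 < e ->
    exists n0, forall n, (n0 <= n)%N -> `|ulim (fun N => \sum_(k < N) s k * a n k)| <= e) ->
  forall e, 0 < e -> exists n0, forall n, (n0 <= n)%N -> forall N, \sum_(k < N) `|a n k| <= e.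
Proof.
move=> /choice[C aC] aw e e0; apply: contrapT => nn.
have sC (s : nat -> R) n N : (forall k, `|s k| <= 1) -> `|\sum_(k < N) s k * a n k| <= C n.
  move=> s1; apply: le_trans (ler_norm_sum _ _ _) _; apply: le_trans (aC n N).
  by apply: ler_sum => i _; rewrite normrM ler_piMl.
have col k r : 0 < r -> exists n0, forall n, (n0 <= n)%N -> `|a n k| <= r.
  move=> r0; pose s i : R := (i == k)%:R.
  have s1 i : `|s i| <= 1 by rewrite /s; case: (_ == _); rewrite ?normr1 ?normr0.
  have [n0 h] := aw s s1 r r0; exists n0 => n /h; apply: le_trans.
  have E N : (k < N)%N -> \sum_(i < N) s i * a n i = a n k.
    move=> kN; rewrite (bigD1 (Ordinal kN))//= {1}/s eqxx mul1r big1 ?addr0// => i ik.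
    by rewrite /s (_ : (i == k :> nat) = false) ?mul0r//; exact: negbTE ik.
  have -> // : ulim (fun N => \sum_(i < N) s i * a n i) = a n k.
  by apply: (@ulim_eventually_cst _ _ _ (C n) k.+1) => [N|N]; [exact: sC|exact: E].
have cols K r : 0 < r -> exists n0, forall n, (n0 <= n)%N -> \sum_(k < K) `|a n k| <= r.
  elim: K r => [|K IH] r r0; first by exists 0%N => n _; rewrite big_ord0 ltW.
  have r20 : 0 < r / 2 by rewrite divr_gt0.
  have [n1 h1] := IH _ r20; have [n2 h2] := col K _ r20; exists (maxn n1 n2) => n.
  rewrite geq_max big_ord_recr/= => /andP[/h1 ? /h2 ?]; lra.
have e8 : 0 < e / 8 by rewrite divr_gt0.
have next (jK : nat * nat) : exists nK : nat * nat, [/\ (jK.1 <= nK.1)%N, (jK.2 < nK.2)%N,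
    \sum_(k < jK.2) `|a nK.1 k| <= e / 8, e < \sum_(k < nK.2) `|a nK.1 k| &
    forall M, (nK.2 <= M)%N -> \sum_(k < M) `|a nK.1 k| - \sum_(k < nK.2) `|a nK.1 k| <= e / 8].
  case: jK => j K /=; have [n1 h1] := cols K _ e8.
  have [n [nn1 [N hN]]] : exists n, (maxn n1 j <= n)%N /\ exists N, e < \sum_(k < N) `|a n k|.
    apply: contrapT => h; apply: nn; exists (maxn n1 j) => n hn N.
    by rewrite leNgt; apply/negP => h'; apply: h; exists n; split=> //; exists N.
  have [N' hN'] := partial_sums_tail (fun k => normr_ge0 (a n k)) (aC n) e8.
  exists (n, maxn K.+1 (maxn N N')) => /=; move: nn1; rewrite geq_max => /andP[nn1 jn]; split=> //.
  - by rewrite leq_max leqnn.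
  - exact: h1.
  - apply: (lt_le_trans hN); rewrite (big_ord_widen _ (fun k => `|a n k|) (leq_trans (leq_maxl N N') (leq_maxr K.+1 _))).
    by rewrite big_mkcond/=; apply: ler_sum => i _; case: ifP.
  - move=> M hM; apply: hN' => //.
    exact: leq_trans (leq_maxr N N') (leq_maxr K.+1 _).
have /choice[F FP] := next.
pose fix K j := if j is i.+1 then (F (i, K i)).2 else 0%N.
pose n j := (F (j, K j)).1.
have nP j := FP (j, K j); rewrite /= in nP.
have KS j : (K j < K j.+1)%N by case: (nP j).
have Kmono i j : (i <= j)%N -> (K i <= K j)%N.
  elim: j => [|j IH]; first by rewrite leqn0 => /eqP->.
  by rewrite leq_eqVlt => /predU1P[->//|/IH h]; exact: leq_trans h (ltnW (KS j)).
have Kge j : (j <= K j)%N by elim: j => // j IH; exact: leq_ltn_trans IH (KS j).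
have Jex k : exists j, (k < K j.+1)%N by exists k; exact: leq_ltn_trans (Kge k) (KS k).
(* The sign of column [k] is read in the row attached to the block that contains [k]. *)
pose s k := Num.sg (a (n (ex_minn (Jex k))) k).
have s1 k : `|s k| <= 1 by rewrite normr_sg lern1 leq_b1.
have sE j k : (K j <= k)%N -> (k < K j.+1)%N -> s k * a (n j) k = `|a (n j) k|.
  move=> Kk kK; rewrite /s; case: ex_minnP => m km mmin.
  have -> : m = j; last by rewrite -normrEsg.
  apply/eqP; rewrite eqn_leq mmin//= leqNgt; apply/negP => mj.
  by have := leq_trans km (leq_trans (Kmono _ _ mj) Kk); rewrite ltnn.
have e20 : 0 < e / 2 by rewrite divr_gt0.
have [j0 hj0] := aw s s1 _ e20.
have [jn _ small big tail] := nP j0; rewrite -/(n j0) in jn small big tail.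
have KE : (F (j0, K j0)).2 = K j0.+1 by [].
rewrite KE in big tail.
have := hj0 _ jn; rewrite leNgt => /negP; apply.
(* The row has mass more than [e] up to [K j0.+1]. The columns before [K j0] cost at most twice
   their mass [e / 8], and those after the block at most [e / 8], which leaves
   [5 / 8 * e > e / 2]. *)
apply: (@lt_le_trans _ _ (5 / 8 * e)); first by lra.
apply: le_trans (ler_norm _).
apply: (@ulim_partial_sums_tail (fun k => s k * a (n j0) k) (C (n j0)) (K j0.+1)).
  by move=> N; exact: sC.
move=> M hM.
have block : \sum_(k < K j0.+1) `|a (n j0) k| - 2 * \sum_(k < K j0) `|a (n j0) k| <=
    \sum_(k < K j0.+1) s k * a (n j0) k.
  rewrite (big_ord_widen _ (fun k => `|a (n j0) k|) (ltnW (KS j0))) [X in 2 * X]big_mkcond/=.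
  rewrite mulr_sumr -sumrB; apply: ler_sum => k _; case: ltnP => h.
    have : - (s k * a (n j0) k) <= `|a (n j0) k|.
      by apply: le_trans (ler_norm _) _; rewrite normrN normrM ler_piMl.
    lra.
  by rewrite sE// mulr0 subr0.
have rest : `|\sum_(k < M) s k * a (n j0) k - \sum_(k < K j0.+1) s k * a (n j0) k| <=
    \sum_(k < M) `|a (n j0) k| - \sum_(k < K j0.+1) `|a (n j0) k|.
  rewrite (big_ord_widen _ (fun k => `|a (n j0) k|) hM) [X in _ <= _ - X]big_mkcond/=.
  rewrite (big_ord_widen _ (fun k => s k * a (n j0) k) hM) [X in `|_ - X|]big_mkcond/= -!sumrB.
  apply: le_trans (ler_norm_sum _ _ _) _; apply: ler_sum => k _; case: ifP => _.
    by rewrite !subrr normr0.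
  by rewrite !subr0 normrM ler_piMl.
move: rest; rewrite ler_norml => /andP[rest _].
move: (tail M hM) rest block small big; clear; lra.
Qed.

Variable E : completeNormedModType R.

Lemma eval_bidual (x : E) : is_bidual (fun f : E -> R => f x).
Proof. by split=> //; exists `|x| => f Df; rewrite mulrC; exact: dual_normP. Qed.

Lemma dual_weakly_null_pointwise (f : nat -> E -> R) x : dual_weakly_null f ->
  forall e, 0 < e -> exists N, forall n, (N <= n)%N -> `|f n x| <= e.
Proof. by move=> [_ /(_ _ (eval_bidual x))/cvg0_eps]. Qed.

Lemma eventually_bounded (a : nat -> R) :
  (forall e, 0 < e -> exists N, forall n, (N <= n)%N -> `|a n| <= e) ->
  exists C, forall n, `|a n| <= C.
Proof.
move=> /(_ 1 ltr01)[N hN]; exists (\sum_(i < N) `|a i| + 1) => n.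
have [Nn|nN] := leqP N n.
  by apply: le_trans (hN n Nn) _; rewrite lerDr sumr_ge0.
rewrite (bigD1 (Ordinal nN))//= -addrA lerDl addr_ge0// sumr_ge0//.
Qed.

Lemma weakly_null_bounded (x : nat -> E) : weakly_cvg x 0 ->
  exists M, 0 <= M /\ forall n, `|x n| <= M.
Proof.
move=> /weakly_null_eps xw; apply: weakly_bounded => f Df.
exact/eventually_bounded/xw.
Qed.

Lemma dual_weakly_null_bounded (f : nat -> E -> R) : dual_weakly_null f ->
  exists M, 0 <= M /\ forall n x, `|f n x| <= M * `|x|.
Proof.
move=> fw; apply: dual_pointwise_bounded; first exact: fw.1.
by move=> x; apply/eventually_bounded/dual_weakly_null_pointwise.
Qed.

(** The map sending [f] to the sequence of the [f (y k)] is bounded from the dual into l^1, so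
    weakly null sequences go to norm null ones by the Schur property. Each bounded [s] defines a
    bidual functional, the ultralimit of the partial sums of [s k * f (y k)]. *)
Lemma dual_schur (y : nat -> E) C (f : nat -> E -> R) :
  (forall (s : nat -> R) N, (forall i, `|s i| <= 1) -> `|\sum_(i < N) s i *: y i| <= C) ->
  dual_weakly_null f -> forall e, 0 < e ->
  exists n0, forall n, (n0 <= n)%N -> forall N, \sum_(k < N) `|f n (y k)| <= e.
Proof.
move=> yC [Df fw]; apply: (@l1_schur (fun n k => f n (y k))) => [n|s s1].
  by exists (dual_norm (f n) * C); exact: (dual_sum_bound (Df n) yC).
apply/cvg0_eps.
have pb g : is_dual g -> forall N, `|\sum_(k < N) s k * g (y k)| <= C * dual_norm g.
  move=> Dg N; rewrite mulrC.
  have -> : \sum_(k < N) s k * g (y k) = g (\sum_(k < N) s k *: y k).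
    by rewrite (dual_sum Dg); apply: eq_bigr => k _; rewrite (dualZ Dg).
  by apply: le_trans (dual_normP Dg _) _; rewrite ler_wpM2l ?dual_norm_ge0// yC.
apply: (fw (fun g => ulim (fun N => \sum_(k < N) s k * g (y k)))).
split=> [a g h Dg Dh|]; last by exists C => g Dg; apply: ulim_norm_le; exact: pb.
rewrite -(ulim_linear a (pb g Dg) (pb h Dh)); congr ulim; apply/funext => N.
by rewrite mulr_sumr -big_split/=; apply: eq_bigr => k _; ring.
Qed.

Lemma dual_weakly_null_subseq (f : nat -> E -> R) (phi : nat -> nat) :
  (forall i, (i <= phi i)%N) -> dual_weakly_null f -> dual_weakly_null (fun i => f (phi i)).
Proof.
move=> phii [Df fw]; split=> // Phi /fw /cvg0_eps h; apply/cvg0_eps => e /h[N hN].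
by exists N => i Ni; apply: hN; exact: leq_trans (phii i).
Qed.

Lemma weakly_null_subseq (x : nat -> E) (phi : nat -> nat) :
  (forall i, (i <= phi i)%N) -> weakly_cvg x 0 -> weakly_cvg (fun i => x (phi i)) 0.
Proof.
move=> phii /weakly_null_eps xw; apply/weakly_null_eps => f Df e e0.
have [N hN] := xw f Df e e0.
by exists N => i Ni; apply: hN; exact: leq_trans (phii i).
Qed.

Lemma operator_of_bound (T : E -> E) C : is_linear_map T -> 0 <= C ->
  (forall x, `|T x| <= C * `|x|) -> is_operator T.
Proof. by move=> Tl C0 TC; split=> //; apply/(bounded_operator Tl); exists C. Qed.

End schur_property.

Section rank_one.
Variables (R : realType) (E : completeNormedModType R) (L : lattice_ops E).
Hypothesis HL : is_banach_lattice L.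
Hypothesis TDP : forall T : E -> E, is_operator T -> positive_op L T -> weak_DP T -> uaw_DP L T.

Lemma uaw_DP_dual_order_continuous : dual_order_continuous L.
Proof.
move=> d f M dd dM pf e e0; apply: contrapT => nN.
have {}nN N : exists n, (N <= n)%N /\ e < f (d n).
  apply: contrapT => nn; apply: nN; exists N => n Nn.
  by rewrite leNgt; apply/negP => h; apply: nn; exists n.
(* The rank one operator needs a nonzero positive vector for its range; a term on which [f] exceeds
   [e] is one. *)
have [n0 [_ n0e]] := nN 0%N; pose y := d n0.
have y0 : 0 < `|y|.
  by rewrite normr_gt0; apply/eqP => yE; move: n0e; rewrite -/y yE (dual0 pf.1) ltNge ltW.
suff /cvg0_eps/(_ _ (mulr_gt0 e0 y0))[N hN] : (fun n => `|f (d n) *: y|) @ \oo --> (0 : R).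
  have [n [/hN]] := nN N; rewrite normr_id normrZ ler_pM2r// => h1 h2.
  by have := le_trans (ler_norm _) h1; rewrite leNgt h2.
apply: (TDP (T := fun x => f x *: y)); last first.
- exact: disjoint_uaw_null.
- by exists M.
- move=> x g /weakly_null_eps xw gw; apply/cvg0_eps => r r0.
  have [N1 h1] := xw f pf.1 r r0; have [N2 h2] := dual_weakly_null_pointwise y gw ltr01.
  exists (maxn N1 N2) => n; rewrite geq_max => /andP[/h1 h3 /h2 h4].
  by rewrite (dualZ (gw.1 n)) normrM -[leRHS]mulr1; exact: ler_pM.
- move=> x x0; apply: (lscale_ge0 HL); first exact: pf.2.
  by have [+ _] := dd; apply.
apply: (@operator_of_bound _ _ _ (dual_norm f * `|y|)).
- by move=> a x z; rewrite (dualD pf.1) (dualZ pf.1) scalerDl scalerA.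
- by rewrite mulr_ge0 ?dual_norm_ge0//; exact: pf.1.
- by move=> x; rewrite normrZ mulrAC ler_wpM2r//; exact: (dual_normP pf.1).
Qed.

End rank_one.

(** * Order bounded disjoint sequences *)

Lemma not_cvg0_subsequence (R : realType) (a : nat -> R) : ~ a @ \oo --> (0 : R) ->
  exists (e : R) (phi : nat -> nat), [/\ 0 < e, forall i, (i <= phi i)%N & forall i, e < `|a (phi i)|].
Proof.
move=> na; apply: contrapT => h; apply: na; apply/cvg0_eps => e e0.
apply: contrapT => nN; apply: h; exists e.
have [|phi [phie phiS]] := @increasing_subsequence (fun n => e < `|a n|).
  move=> N; apply: contrapT => nn; apply: nN; exists N => n Nn.
  by rewrite leNgt; apply/negP => h; apply: nn; exists n.
by exists phi; split=> // i; exact: increasing_ge_id.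
Qed.

Section factorization_through_linfty.
Variables (R : realType) (E : completeNormedModType R).
Implicit Types (s t : nat -> R).

Definition bounded_seq s := exists K, forall k, `|s k| <= K.

(** A bounded operator on l^oo without building that space: [J] is total on sequences, and
    constrained only on the bounded ones. *)
Definition linfty_operator (J : (nat -> R) -> E) (C : R) :=
  (forall a s t, bounded_seq s -> bounded_seq t ->
     J (fun k => a * s k + t k) = a *: J s + J t) /\
  (forall s K, (forall k, `|s k| <= K) -> `|J s| <= K * C).

Variables (J : (nat -> R) -> E) (C : R).
Hypothesis JC : linfty_operator J C.

Lemma linfty_operator0 : J (fun=> 0) = 0.
Proof.
apply/eqP; rewrite -normr_le0; have := JC.2 (fun=> 0) 0; rewrite mul0r; apply=> k.
by rewrite normr0.
Qed.

Lemma linfty_operator_sum (s : nat -> nat -> R) (c : nat -> R) N :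
  (forall i, bounded_seq (s i)) ->
  bounded_seq (fun k => \sum_(i < N) c i * s i k) /\
  J (fun k => \sum_(i < N) c i * s i k) = \sum_(i < N) c i *: J (s i).
Proof.
move=> sb; elim: N => [|N [[K IHb] IH]].
  have -> : (fun k => \sum_(i < 0) c i * s i k) = fun=> 0 by apply/funext => k; rewrite big_ord0.
  by rewrite big_ord0 linfty_operator0; split=> //; exists 0 => k; rewrite normr0.
have -> : (fun k => \sum_(i < N.+1) c i * s i k) =
    fun k => c N * s N k + (\sum_(i < N) c i * s i k).
  by apply/funext => k; rewrite big_ord_recr/= addrC.
split; last by rewrite JC.1// ?IH ?big_ord_recr/= 1?addrC//; exists K.
have [K' sK'] := sb N; exists (`|c N| * K' + K) => k.
by apply: le_trans (ler_normD _ _) _; rewrite lerD// normrM ler_wpM2l.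
Qed.

(* The submeasure of a set of indices is the largest value of the functionals
   on the unit ball of sequences supported there; [submeasure_le f B e] says
   that it is at most [e]. *)
Definition submeasure_le (f : nat -> E -> R) (B : set nat) (e : R) := forall n s,
  (forall k, `|s k| <= 1) -> (forall k, ~ B k -> s k = 0) -> `|f n (J s)| <= e.

Variable f : nat -> E -> R.
Hypothesis fw : dual_weakly_null f.

Lemma submeasure_leW (A B : set nat) a b : A `<=` B -> a <= b ->
  submeasure_le f B a -> submeasure_le f A b.
Proof.
move=> AB ab Ba n s s1 sA; apply: le_trans ab; apply: Ba => // k nBk.
by apply: sA => /AB.
Qed.

Lemma submeasure_le0 e : 0 <= e -> submeasure_le f set0 e.
Proof.
move=> e0 n s _ s0; have -> : s = fun=> 0 by apply/funext => k; apply: s0.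
by rewrite linfty_operator0 (dual0 (fw.1 n)) normr0.
Qed.

Lemma submeasure_leU (A B : set nat) a b : submeasure_le f A a -> submeasure_le f B b ->
  submeasure_le f (A `|` B) (a + b).
Proof.
move=> Aa Bb n s s1 sAB.
pose sA k := if k \in A then s k else 0.
pose sB k := if k \in A then 0 else s k.
have sA1 k : `|sA k| <= 1 by rewrite /sA; case: ifP => // _; rewrite normr0.
have sB1 k : `|sB k| <= 1 by rewrite /sB; case: ifP => // _; rewrite normr0.
have -> : s = fun k => 1 * sA k + sB k.
  by apply/funext => k; rewrite /sA /sB mul1r; case: ifP; rewrite ?addr0 ?add0r.
rewrite JC.1; [|by exists 1|by exists 1].
rewrite (dualD (fw.1 n)) scale1r; apply: le_trans (ler_normD _ _) _; apply: lerD.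
  by apply: Aa => // k nAk; rewrite /sA ifF//; apply/negP => /set_mem.
apply: Bb => // k nBk; rewrite /sB; case: ifP => // /negbT nA.
by apply: sAB => -[/mem_set Ak|//]; rewrite Ak in nA.
Qed.

(** If each [B j] carried a value above [e], attained by a functional of index [n j] on a sequence
    [s j], the vectors [J (s j)] would have bounded signed sums. Then [dual_schur] bounds the
    indices [n j], and each of the finitely many functionals left tends to zero along these
    vectors. *)
Lemma submeasure_exhaustive (B : nat -> set nat) e : 0 < e ->
  (forall i j k, (i < j)%N -> B i k -> ~ B j k) -> exists j, submeasure_le f (B j) e.
Proof.
move=> e0 Bdis; apply: contrapT => nB.
have H j : exists ns : nat * (nat -> R), [/\ forall k, `|ns.2 k| <= 1,
    forall k, ~ B j k -> ns.2 k = 0 & e < `|f ns.1 (J ns.2)|].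
  apply: contrapT => h; apply: nB; exists j => n s s1 sB; rewrite leNgt; apply/negP => h'.
  by apply: h; exists (n, s).
have /choice[ns nsP] := H.
pose y j := J (ns j).2.
have yC (c : nat -> R) N : (forall i, `|c i| <= 1) -> `|\sum_(i < N) c i *: y i| <= 1 * C.
  move=> c1; have sb i : bounded_seq (ns i).2 by exists 1; case: (nsP i).
  have [_ <-] := linfty_operator_sum c N sb.
  apply: JC.2 => k; have [[i [iN Bik]]|nB'] := pselect (exists i, (i < N)%N /\ B i k).
    rewrite (bigD1 (Ordinal iN))//= big1 ?addr0.
      by rewrite normrM -[leRHS]mulr1; apply: ler_pM => //; case: (nsP i).
    move=> j ji; have [_ + _] := nsP j; move=> ->; first by rewrite mulr0.
    have /orP[lt|lt] : (j < i)%N || (i < j)%N by rewrite -neq_ltn; exact: ji.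
      by move=> Bj; exact: Bdis lt Bj Bik.
    exact: Bdis lt Bik.
  rewrite big1 ?normr0// => i _; have [_ + _] := nsP i; move=> ->; first by rewrite mulr0.
  by move=> Bik; apply: nB'; exists i.
have [n0 hn0] := dual_schur yC fw e0.
have ltn j : ((ns j).1 < n0)%N.
  rewrite ltnNge; apply/negP => h; have := hn0 _ h j.+1; rewrite big_ord_recr/=.
  have [_ _ h1] := nsP j; have : 0 <= \sum_(k < j) `|f (ns j).1 (y k)| by exact: sumr_ge0.
  rewrite /y; move: h1; lra.
have col n : exists N, forall j, (N <= j)%N -> `|f n (y j)| <= e.
  apply: (@bounded_sums_terms_to0 _ (fun j => `|f n (y j)|) (dual_norm (f n) * (1 * C))) => //.
  exact: (dual_sum_bound (fw.1 n) yC).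
have [N hN] : exists N, forall n, (n < n0)%N -> forall j, (N <= j)%N -> `|f n (y j)| <= e.
  elim: (n0) => [|m [N IH]]; first by exists 0%N.
  have [N' hN'] := col m; exists (maxn N N') => n; rewrite ltnS leq_eqVlt => /predU1P[->|nm] j.
    by rewrite geq_max => /andP[_]; exact: hN'.
  by rewrite geq_max => /andP[+ _]; exact: IH.
have [_ _] := nsP N; apply/negP; rewrite -leNgt; exact: hN (ltn N) N (leqnn N).
Qed.

Let U (A : nat -> set nat) p q : set nat := [set k | exists2 j, (p <= j < q)%N & A j k].

(** Otherwise the unions grow infinitely often by sets of submeasure above [e], and these increments
    are disjoint, against exhaustivity. *)
Lemma submeasure_finite_cover (A : nat -> set nat) p e : 0 < e ->
  exists q, (p < q)%N /\ forall q', submeasure_le f (U A p q' `\` U A p q) e.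
Proof.
move=> e0; apply: contrapT => h.
have H q : exists q', (p < q)%N -> (q < q')%N /\ ~ submeasure_le f (U A p q' `\` U A p q) e.
  have [pq|_] := boolP (p < q)%N; last by exists 0%N.
  have [q' nq'] : exists q', ~ submeasure_le f (U A p q' `\` U A p q) e.
    by apply/existsNP => hq; apply: h; exists q.
  exists q' => _; split=> //; rewrite ltnNge; apply/negP => qq'; apply: nq'.
  apply: (@submeasure_leW _ set0 e) => //; last by apply: submeasure_le0; exact: ltW.
  move=> k [[j /andP[pj jq'] Aj]] []; exists j => //.
  by rewrite pj (leq_trans jq').
have /choice[F FP] := H.
pose fix Q i := if i is j.+1 then F (Q j) else p.+1.
have Qp i : (p < Q i)%N.
  by elim: i => [|i IH] /=; [exact: ltnSn|exact: ltn_trans (FP _ IH).1].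
have Qmono i j : (i <= j)%N -> (Q i <= Q j)%N.
  elim: j => [|j IH]; first by rewrite leqn0 => /eqP->.
  rewrite leq_eqVlt => /predU1P[->//|/IH hij]; apply: (leq_trans hij); apply: ltnW.
  exact: (FP _ (Qp j)).1.
have [||i hi] := @submeasure_exhaustive (fun i => U A p (Q i.+1) `\` U A p (Q i)) e => //.
  move=> i j k ij [[l /andP[pl lQ] Al] _] [_]; apply; exists l => //.
  by rewrite pl (leq_trans lQ)// Qmono.
by have [_] := FP _ (Qp i); apply.
Qed.

(* If the sets [A n] had submeasure bounded below, finite unions of them would
   have the finite intersection property, and evaluation along a sequence of
   points of these intersections would be a functional not vanishing on [x]. *)
Theorem linfty_factor_weak_DP (g : nat -> E -> R) (x : nat -> E) :
  (forall k, is_dual (g k)) -> (forall k z, `|g k z| <= `|z|) -> weakly_cvg x 0 ->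
  forall e : R, 0 < e -> exists n, `|f n (J (fun k => g k (x n)))| <= e.
Proof.
move=> Dg g1 xw e e0; apply: contrapT => nn.
have {}nn n : e < `|f n (J (fun k => g k (x n)))|.
  by rewrite ltNge; apply/negP => h; apply: nn; exists n.
have [K [K0 xK]] := weakly_null_bounded xw.
have [M [M0 fM]] := dual_weakly_null_bounded fw.
have C0 : 0 <= C.
  have : `|J (fun=> 0)| <= 1 * C by apply: JC.2 => k; rewrite normr0.
  by rewrite mul1r; exact: le_trans.
(* The coordinates of size at most [eta] contribute at most [e / 2]. The others, divided by [K + 1],
   form a sequence in the unit ball supported in [A n], so the submeasure of [A n] exceeds
   [e' = e / (2 * (K + 1))]. *)
pose eta := e / (2 * (M * C + 1)).
have MC : 0 < M * C + 1 by rewrite ltr_wpDl// mulr_ge0.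
have eta0 : 0 < eta by rewrite divr_gt0// mulr_gt0.
have etaM : M * (eta * C) <= e / 2.
  have -> : e / 2 = (M * C + 1) * eta by rewrite /eta; field; rewrite gt_eqF.
  by rewrite mulrCA [leLHS]mulrC mulrDl mul1r lerDl ltW.
pose e' := e / (2 * (K + 1)).
have K1 : 0 < K + 1 by rewrite ltr_wpDl.
have e'0 : 0 < e' by rewrite divr_gt0// mulr_gt0.
pose A n : set nat := [set k | eta < `|g k (x n)|].
have nA n : ~ submeasure_le f (A n) e'.
  move=> h; have := nn n.
  pose zA k := if k \in A n then g k (x n) / (K + 1) else 0.
  pose zB k := if k \in A n then 0 else g k (x n).
  have zA1 k : `|zA k| <= 1.
    rewrite /zA; case: ifP => _; last by rewrite normr0.
    rewrite normrM normfV (gtr0_norm K1) ler_pdivrMr// mul1r.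
    by apply: le_trans (g1 _ _) _; apply: le_trans (xK n) _; rewrite lerDl.
  have zB1 k : `|zB k| <= eta.
    rewrite /zB; case: ifP => [_|/negbT kA]; first by rewrite normr0 ltW.
    by rewrite leNgt; apply/negP => h'; move/negP: kA; apply; exact: mem_set.
  have -> : (fun k => g k (x n)) = fun k => (K + 1) * zA k + zB k.
    apply/funext => k; rewrite /zA /zB; case: ifP => _; rewrite ?mulr0 ?add0r ?addr0//.
    by rewrite mulrC divfK// gt_eqF.
  rewrite JC.1; [|by exists 1|by exists eta].
  rewrite (dualD (fw.1 n)) (dualZ (fw.1 n)).
  have h1 : `|f n (J zA)| <= e'.
    by apply: h => // k kA; rewrite /zA ifF//; apply/negP => /set_mem.
  have h2 : `|f n (J zB)| <= M * (eta * C).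
    by apply: le_trans (fM n _) _; rewrite ler_wpM2l// JC.2.
  have h3 : (K + 1) * `|f n (J zA)| <= e / 2.
    have -> : e / 2 = (K + 1) * e' by rewrite /e'; field; rewrite gt_eqF.
    by rewrite ler_wpM2l// ltW.
  move=> h4; have := lt_le_trans h4 (ler_normD _ _).
  rewrite normrM (gtr0_norm K1); lra.
have step (pk : nat * nat) : exists q, (pk.1 < q)%N /\
    forall q', submeasure_le f (U A pk.1 q' `\` U A pk.1 q) (e' / 2 * 2^-1 ^+ pk.2.+1).
  by apply: submeasure_finite_cover; rewrite mulr_gt0 ?half_pow_gt0// divr_gt0.
have /choice[F FP] := step.
(* Consecutive blocks [B k] of the sets [A j], each containing the next one up to submeasure
   [e' / 2 * 2^-k.+1]. These errors sum to at most [e' / 2], so the first [k] blocks meet inside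
   [B k], which contains [A (q k)]. *)
pose fix q k := if k is i.+1 then F (q i, i) else 0%N.
have qS k : (q k < q k.+1)%N := (FP (q k, k)).1.
have qge k : (k <= q k)%N by elim: k => // k IH; exact: leq_ltn_trans IH (qS k).
pose B k := U A (q k) (q k.+1).
have BD k : submeasure_le f (B k.+1 `\` B k) (e' / 2 * 2^-1 ^+ k.+1).
  apply: submeasure_leW (lexx _) ((FP (q k, k)).2 (q k.+2)) => t [[j /andP[j1 j2] Aj] nB].
  by split=> //; exists j => //; rewrite j2 andbT (leq_trans (ltnW (qS k))).
pose D k : set nat := [set t | forall i, (i <= k)%N -> B i t].
have DB k : submeasure_le f (B k `\` D k) (e' / 2 * (1 - 2^-1 ^+ k)).
  elim: k => [|k IH].
    rewrite expr0 subrr mulr0; apply: submeasure_leW (lexx 0) (submeasure_le0 (lexx 0)).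
    by move=> t [Bt]; apply=> i; rewrite leqn0 => /eqP->.
  have -> : e' / 2 * (1 - 2^-1 ^+ k.+1) = e' / 2 * 2^-1 ^+ k.+1 + e' / 2 * (1 - 2^-1 ^+ k).
    by rewrite (half_powS R k); ring.
  apply: submeasure_leW (lexx _) (submeasure_leU (BD k) IH) => t [Bt nD].
  have [Bk|nBk] := pselect (B k t); last by left.
  right; split=> // Dt; apply: nD => i; rewrite leq_eqVlt => /predU1P[->//|].
  by rewrite ltnS; exact: Dt.
have /choice[t tD] : forall k, exists t : nat, D k t.
  move=> k; apply: contrapT => nD; apply: (nA (q k)).
  apply: submeasure_leW (DB k); last first.
    have h : e' / 2 * (1 - 2^-1 ^+ k) <= e' / 2 * 1.
      by apply: ler_wpM2l; [rewrite divr_ge0// ltW|rewrite gerBl ltW// half_pow_gt0].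
    by apply: (le_trans h); rewrite mulr1 ler_pdivrMr// ler_pMr// ler1n.
  move=> t At; split; last by move=> Dt; apply: nD; exists t.
  by exists (q k) => //; rewrite leqnn qS.
pose phi z := ulim (fun k => g (t k) z).
have Dphi : is_dual phi.
  apply: (@bounded_is_dual _ _ _ 1) => // [a y z|z].
    rewrite /phi -(ulim_linear a (fun n => g1 (t n) y) (fun n => g1 (t n) z)).
    by congr ulim; apply/funext => n; rewrite (dualD (Dg _)) (dualZ (Dg _)).
  by rewrite mul1r; apply: ulim_norm_le => n; exact: g1.
have eta2 : 0 < eta / 2 by rewrite divr_gt0.
have /weakly_null_eps/(_ _ Dphi _ eta2)[N hN] := xw.
have [|k [Nk hk]] := @ulim_approx R (q N.+1) N (fun j k => g (t k) (x j)) _ eta2.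
  by move=> j _; exists `|x j| => k; exact: g1.
have [j /andP[j1 j2]] := tD k N Nk; rewrite /A /= => h1.
have := hk j j2; have := hN j (leq_trans (qge N) j1); rewrite -/(phi (x j)) => h2 h3.
have := ler_normD (g (t k) (x j) - phi (x j)) (phi (x j)); rewrite subrK; lra.
Qed.

End factorization_through_linfty.

Section order_bounded_disjoint.
Variables (R : realType) (E : completeNormedModType R) (L : lattice_ops E).
Hypothesis HL : is_banach_lattice L.
Hypothesis Hsigma : dedekind_sigma_complete L.

Local Notation "x [<=] y" := (lle L x y) (at level 70, no associativity).
Local Notation "x [\/] y" := (ljoin L x y) (at level 50, left associativity).
Local Notation "x [/\] y" := (lmeet L x y) (at level 48, left associativity).
Local Notation labs := (labs L).

Lemma lsum_mono (a : nat -> E) N p : (forall i, 0 [<=] a i) -> (N <= p)%N ->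
  \sum_(i < N) a i [<=] \sum_(i < p) a i.
Proof.
move=> a0; elim: p => [|p IH]; first by rewrite leqn0 => /eqP->; exact: lle_refl.
rewrite leq_eqVlt => /predU1P[->|/IH h]; first exact: lle_refl.
by rewrite big_ord_recr/=; apply: (lle_trans HL h); exact: lle_addl.
Qed.

(** The sum of the [s n *: d n] is an order sum, as norm convergence is not known. With [w] the
    supremum of the partial sums [W N], [J s] is the only element within [K *: (w - W N)] of each
    partial sum, since these bounds have infimum zero. Existence is the supremum for the nonnegative
    coefficients [s k + K], minus [K *: w]. *)
Lemma order_sum_operator (d : nat -> E) (u : E) :
  (forall i, 0 [<=] d i) -> (forall N, \sum_(i < N) d i [<=] u) ->
  exists (J : (nat -> R) -> E) (w : E), linfty_operator J `|w| /\
    forall s K, (forall i, 0 <= s i <= K) -> forall n, s n *: d n [<=] J s.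
Proof.
move=> d0 du.
pose W N := \sum_(i < N) d i.
pose S N (s : nat -> R) := \sum_(i < N) s i *: d i.
have [w [Ww wlub]] : exists w, (forall N, W N [<=] w) /\ forall v, (forall N, W N [<=] v) -> w [<=] v.
  by apply: (Hsigma (x := W)); exists u.
have w0 : 0 [<=] w by have := Ww 0%N; rewrite /W big_ord0.
have inf0 x K N0 : (forall N, (N0 <= N)%N -> x [<=] K *: (w - W N)) -> x [<=] 0.
  move=> h; have [K0|K0] := leP K 0.
    apply: (lle_trans HL (h N0 (leqnn _))); rewrite -(scale0r (w - W N0)).
    by apply: lscale_mono => //; exact/(lsub_ge0 HL).
  have : w [<=] w - K^-1 *: x.
    apply: wlub => N; apply: (lle_trans HL (@lsum_mono d _ _ d0 (leq_maxl N N0))).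
    have := @lle_scale _ _ _ HL K^-1 _ _ _ (h _ (leq_maxr N N0)).
    rewrite invr_ge0 (ltW K0) scalerA mulVf ?gt_eqF// scale1r => /(_ isT).
    by rewrite -/(W _); move: (_ *: x) (W _) => v z; lattice.
  move=> h1; have : K^-1 *: x [<=] 0 by move: h1; move: (_ *: x) => v; lattice.
  move=> /(@lle_scale _ _ _ HL K _ _ (ltW K0)).
  by rewrite scaler0 scalerA mulfV ?gt_eqF// scale1r.
have Jex (s : nat -> R) K : (forall k, `|s k| <= K) ->
    exists y, forall N, labs (y - S N s) [<=] K *: (w - W N).
  move=> sK; have K0 : 0 <= K by exact: le_trans (sK 0%N).
  pose s' k := s k + K.
  have s'0 k : 0 <= s' k by have := sK k; rewrite ler_norml /s' => /andP[]; lra.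
  have s'K k : s' k <= 2 * K by have := sK k; rewrite ler_norml /s' => /andP[]; lra.
  have S'E N : S N s' = S N s + K *: W N.
    rewrite /S /W scaler_sumr -big_split/=; apply: eq_bigr => i _.
    by rewrite -scalerDl.
  have t0 i : 0 [<=] s' i *: d i by exact: lscale_ge0.
  have gap N p : (N <= p)%N -> S p s' [<=] S N s' + (2 * K) *: (W p - W N).
    move=> Np; have t0' i : 0 [<=] (2 * K - s' i) *: d i by apply: lscale_ge0; rewrite ?subr_ge0.
    have := lsum_mono t0' Np.
    have E1 M : \sum_(i < M) (2 * K - s' i) *: d i = (2 * K) *: W M - S M s'.
      by rewrite /W scaler_sumr -sumrB; apply: eq_bigr => i _; rewrite scalerBl.
    by rewrite !E1 scalerBr; move: (_ *: W N) (_ *: W p) => v v'; lattice.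
  have gapw N p : S p s' [<=] S N s' + (2 * K) *: (w - W N).
    have [Np|/ltnW pN] := leqP N p.
      apply: (lle_trans HL (gap _ _ Np)); apply: lle_add => //; first exact: lle_refl.
      apply: lle_scale => //; first by rewrite mulr_ge0.
      exact: lle_addr.
    apply: (lle_trans HL (lsum_mono t0 pN)); apply: lle_addl => //.
    by apply: lscale_ge0; rewrite ?mulr_ge0//; exact/(lsub_ge0 HL).
  have [y' [yub ylub]] : exists y', (forall N, S N s' [<=] y') /\
      forall v, (forall N, S N s' [<=] v) -> y' [<=] v.
    apply: (Hsigma (x := fun N => S N s')); exists ((2 * K) *: w) => N.
    by have := gapw 0%N N; rewrite /S /W !big_ord0 add0r subr0.
  exists (y' - K *: w) => N; have := yub N; have := ylub _ (gapw N); rewrite S'E.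
  by rewrite !scalerBr -!scalerA; move: (K *: w) (K *: W N) => v v'; lattice.
pose Jspec s y := exists K, forall N, labs (y - S N s) [<=] K *: (w - W N).
have Juniq s y y' : Jspec s y -> Jspec s y' -> y = y'.
  move=> [K hK] [K' hK']; have : labs (y - y') [<=] 0.
    apply: (inf0 _ (K + K') 0%N) => N _; rewrite scalerDl; move: (hK N) (hK' N).
    by move: (_ *: (w - W N)) (_ *: (w - W N)) => v v'; lattice.
  by move=> h; apply: (lle_anti HL); move: h; lattice.
have /choice[J JP] : forall s, exists y, (exists y, Jspec s y) -> Jspec s y.
  by move=> s; have [[y hy]|h] := pselect (exists y, Jspec s y); [exists y|exists 0 => /h].
have JK s K : (forall k, `|s k| <= K) -> forall N, labs (J s - S N s) [<=] K *: (w - W N).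
  move=> sK; have [y yP] := Jex s K sK; have ys : Jspec s y by exists K.
  by rewrite (Juniq s (J s) y) => //; apply: JP; exists y.
exists J, w; split; first split.
- move=> a s t [K sK] [K' tK'].
  have sbd k : `|a * s k + t k| <= `|a| * K + K'.
    by apply: le_trans (ler_normD _ _) _; rewrite normrM lerD// ler_wpM2l.
  apply: (Juniq (fun k => a * s k + t k)); first by exists (`|a| * K + K'); exact: JK.
  exists (`|a| * K + K') => N.
  have -> : S N (fun k => a * s k + t k) = a *: S N s + S N t.
    by rewrite /S scaler_sumr -big_split/=; apply: eq_bigr => i _; rewrite scalerDl scalerA.
  have := @lle_scale _ _ _ HL _ _ _ (normr_ge0 a) (JK s K sK N).
  rewrite -labs_scale// scalerBr scalerA scalerDl; move: (JK t K' tK' N).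
  by move: (_ *: J s) (a *: S N s) (_ *: (w - W N)) (_ *: (w - W N)) => v v' v'' v'''; lattice.
- move=> s K sK; have K0 : 0 <= K by exact: le_trans (sK 0%N).
  rewrite -[K]ger0_norm// -normrZ; apply: (lnorm_abs_le HL).
  by have := JK s K sK 0%N; rewrite /S /W !big_ord0 !subr0.
move=> s K sK n.
have s0 i : 0 <= s i by case/andP: (sK i).
have sK' i : `|s i| <= K by rewrite ger0_norm//; case/andP: (sK i).
have : s n *: d n - J s [<=] 0.
  apply: (inf0 _ K n.+1) => N nN; have := JK s K sK' N.
  have : s n *: d n [<=] S N s.
    by apply: (@lsum_ge_term _ _ _ HL N (fun i => s i *: d i)) => // i; exact: lscale_ge0.
  by move: (_ *: d n) (_ *: (w - W N)) => v v'; lattice.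
by move: (_ *: d n) => v; lattice.
Qed.

Hypothesis TDP : forall T : E -> E, is_operator T -> positive_op L T -> weak_DP T -> uaw_DP L T.

(** With [g n] norming [d n], the operator satisfies [|d n| *: d n [<=] T (d n)], so the square of
    [|d n|] is at most [|T (d n)|], which tends to zero. *)
Lemma order_bounded_disjoint_to0 (d : nat -> E) u : disjoint_seq L d -> (forall n, d n [<=] u) ->
  forall e, 0 < e -> exists N, forall n, (N <= n)%N -> `|d n| <= e.
Proof.
move=> dd du; have [d0 _] := dd.
have u0 : 0 [<=] u by exact: lle_trans (d0 0%N) (du 0%N).
have [J [w [JC Jd]]] := order_sum_operator d0 (fun N => disjoint_sum_le HL dd u0 (fun n _ => du n)).
have /choice[g gP] : forall k, exists f, [/\ positive_dual L f, forall x, `|f x| <= `|x| &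
    f (d k) = `|d k|] by move=> k; exact: positive_norming.
have Dg k : is_dual (g k) by have [[]] := gP k.
have g1 k z : `|g k z| <= `|z| by have [_ + _] := gP k; apply.
pose T x := J (fun k => g k x).
have gb x : bounded_seq (fun k => g k x) by exists `|x|.
have Tl : is_linear_map T.
  move=> a x y; rewrite /T -JC.1//; congr J; apply/funext => k.
  by rewrite (dualD (Dg k)) (dualZ (Dg k)).
have Tpos x n : 0 [<=] x -> g n x *: d n [<=] T x.
  move=> x0; apply: (Jd _ `|x|) => i; have [[_ pg] _ _] := gP i.
  by rewrite pg//= (le_trans (ler_norm _)).
have To : is_operator T.
  apply: (@operator_of_bound _ _ _ `|w|) => // x.
  by rewrite mulrC; exact: JC.2.
have Tp : positive_op L T.
  move=> x x0; apply: (lle_trans HL _ (Tpos x 0%N x0)); apply: lscale_ge0 => //.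
  by have [[_ pg] _ _] := gP 0%N; exact: pg.
have TwDP : weak_DP T.
  move=> x f xw fw; apply: contrapT => /not_cvg0_subsequence[e [phi [e0 phii he]]].
  have [n] := linfty_factor_weak_DP JC (dual_weakly_null_subseq phii fw) Dg g1
    (weakly_null_subseq phii xw) e0.
  by apply/negP; rewrite -ltNge; exact: he.
have dM n : `|d n| <= `|u| by exact: (lnorm_le_pos HL).
have /cvg0_eps h := TDP To Tp TwDP (ex_intro _ `|u| dM) (disjoint_uaw_null HL dd).
move=> e e0; have [N hN] := h _ (mulr_gt0 e0 e0); exists N => n /hN; rewrite normr_id => h1.
have h2 : `|d n| * `|d n| <= `|T (d n)|.
  have [_ _ gd] := gP n.
  rewrite -{1}(normr_id (d n)) -normrZ; apply: (lnorm_le_pos HL).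
    exact: lscale_ge0.
  by have := Tpos (d n) n (d0 n); rewrite gd.
rewrite leNgt; apply/negP => h3; have := le_trans h2 h1; rewrite leNgt.
by rewrite ltr_pM// ltW.
Qed.

End order_bounded_disjoint.

(** * Disjointification and monotone sequences *)

Section rosenthal.
Variable R : realType.

Definition other_values (sigma : nat -> nat) n : set nat :=
  [set k | exists2 j, j <> n & k = sigma j].

(* Split the current index set into infinitely many infinite pieces.  If no
   piece works, picking one bad index from each piece lowers the bound on the
   mass of the other indices by [e]. *)
Lemma rosenthal_disjointification (mu : nat -> set nat -> R) M e : 0 < e ->
  (forall n A, 0 <= mu n A <= M) -> (forall n A B, A `<=` B -> mu n A <= mu n B) ->
  (forall n A B, (forall k, A k -> ~ B k) -> mu n A + mu n B <= mu n (A `|` B)) ->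
  exists sigma, injective sigma /\ forall n, mu (sigma n) (other_values sigma n) <= e.
Proof.
move=> e0 muM mumono muadd.
suff main k : forall sigma, injective sigma ->
    (forall n, mu (sigma n) (other_values sigma n) <= k%:R * e) ->
    exists tau, injective tau /\ forall n, mu (tau n) (other_values tau n) <= e.
  apply: (main (Num.bound (M / e)) id) => // n.
  have /andP[h0 h1] := muM n (other_values id n); apply: (le_trans h1).
  rewrite -ler_pdivrMr//; apply: ltW; apply: archi_boundP.
  by rewrite divr_ge0 ?(le_trans h0 h1) ?(ltW e0).
elim: k => [|k IH] sigma sinj smu.
  by exists sigma; split=> // n; apply: le_trans (smu n) _; rewrite mul0r ltW.
pose piece (p i : nat) := sigma (pickle (p, i)).
have pinj p : injective (piece p).
  by move=> i j /sinj /(pcan_inj pickleK) [].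
have [[p hp]|np] := pselect (exists p, forall i, mu (piece p i) (other_values (piece p) i) <= e).
  by exists (piece p).
have /choice[i ip] : forall p, exists i, e < mu (piece p i) (other_values (piece p) i).
  move=> p; apply: contrapT => h; apply: np; exists p => i; rewrite leNgt; apply/negP => h'.
  by apply: h; exists i.
pose tau p := piece p (i p).
apply: (IH tau) => [p q /sinj /(pcan_inj pickleK) []//|p].
have dis t : other_values tau p t -> ~ other_values (piece p) (i p) t.
  by move=> [q qp ->] [j jp] /sinj /(pcan_inj pickleK) [].
have := muadd (tau p) _ _ dis.
have sub : other_values tau p `|` other_values (piece p) (i p) `<=`
    other_values sigma (pickle (p, i p)).
  move=> t [[q qp ->]|[j jp ->]].
    by exists (pickle (q, i q)) => // /(pcan_inj pickleK) [].
  by exists (pickle (p, j)) => // /(pcan_inj pickleK) [].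
have := mumono (tau p) _ _ sub; have := smu (pickle (p, i p)); have := ip p.
rewrite -/(tau p) -[sigma _]/(tau p) -natr1 mulrDl mul1r.
move: (mu (tau p) _) (mu (tau p) _) (mu (tau p) _) (mu _ _) => a b c d; lra.
Qed.

Lemma injective_bound (sigma : nat -> nat) N : exists p, forall n, (n < N)%N -> (sigma n < p)%N.
Proof.
elim: N => [|N [p IH]]; first by exists 0%N.
exists (maxn p (sigma N).+1) => n; rewrite ltnS leq_eqVlt leq_max => /predU1P[->|/IH ->//].
by rewrite leqnn orbT.
Qed.

End rosenthal.

Section monotone_convergence.
Variables (R : realType) (E : completeNormedModType R) (L : lattice_ops E).
Hypothesis HL : is_banach_lattice L.
Implicit Types (x y z u : E) (v : nat -> E) (A B : set nat).

Local Notation "x [<=] y" := (lle L x y) (at level 70, no associativity).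
Local Notation "x [\/] y" := (ljoin L x y) (at level 50, left associativity).
Local Notation "x [/\] y" := (lmeet L x y) (at level 48, left associativity).
Local Notation labs := (labs L).

Lemma increasing_le (x : nat -> E) n m : (forall n, x n [<=] x n.+1) -> (n <= m)%N -> x n [<=] x m.
Proof.
move=> xS; elim: m => [|m IH]; first by rewrite leqn0 => /eqP->; exact: lle_refl.
rewrite leq_eqVlt => /predU1P[->|/IH h]; first exact: lle_refl.
exact: (lle_trans HL h).
Qed.

Lemma increasing_cvg_of_increments (x : nat -> E) : (forall n, x n [<=] x n.+1) ->
  (forall v (phi : nat -> nat) (e : R), 0 < e -> (forall i, 0 [<=] v i) -> (forall i, e < `|v i|) ->
     (forall N, \sum_(i < N) v i = x (phi N) - x 0%N) -> False) ->
  exists l : E, x @ \oo --> l.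
Proof.
move=> xS incr; apply: cauchy_seq_cvg => e e0; apply: contrapT => nN.
have e20 : 0 < e / 2 by rewrite divr_gt0.
have /choice[h hP] : forall N, exists n, (N <= n)%N /\ e / 2 < `|x n - x N|.
  move=> N; apply: contrapT => nn; apply: nN; exists N => n m Nn Nm.
  have small k : (N <= k)%N -> `|x k - x N| <= e / 2.
    by move=> Nk; rewrite leNgt; apply/negP => hk; apply: nn; exists k.
  have -> : x n - x m = (x n - x N) - (x m - x N) by rewrite opprB addrA subrK.
  by apply: le_trans (ler_normB _ _) _; have := small n Nn; have := small m Nm; lra.
pose phi i := iter i h 0%N.
apply: (incr (fun i => x (phi i.+1) - x (phi i)) phi (e / 2)) => // [i|i|N].
- by apply/(lsub_ge0 HL); apply: increasing_le => //; exact: (hP (phi i)).1.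
- exact: (hP (phi i)).2.
elim: N => [|N IH]; first by rewrite big_ord0 subrr.
by rewrite big_ord_recr/= IH addrC addrA subrK.
Qed.

Definition masked A v i := if i \in A then v i else 0.

Lemma masked_ge0 A v i : (forall i, 0 [<=] v i) -> 0 [<=] masked A v i.
Proof. by move=> v0; rewrite /masked; case: ifP => // _; exact: lle_refl. Qed.

Lemma masked_sum_le A v N : (forall i, 0 [<=] v i) ->
  \sum_(i < N) masked A v i [<=] \sum_(i < N) v i.
Proof.
move=> v0; apply: (@lsum_le _ _ _ HL N (masked A v) v) => i _; rewrite /masked.
by case: ifP => // _; exact: lle_refl.
Qed.

Lemma masked_sumS A B v N : (forall i, 0 [<=] v i) -> A `<=` B ->
  \sum_(i < N) masked A v i [<=] \sum_(i < N) masked B v i.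
Proof.
move=> v0 AB; apply: (@lsum_le _ _ _ HL N (masked A v) (masked B v)) => i _; rewrite /masked.
case: ifP => [/set_mem/AB/mem_set->|_]; first exact: lle_refl.
by case: ifP => // _; exact: lle_refl.
Qed.

Lemma masked_sumU A B v N : (forall k, A k -> ~ B k) ->
  \sum_(i < N) masked (A `|` B) v i = \sum_(i < N) masked A v i + \sum_(i < N) masked B v i.
Proof.
move=> AB; rewrite -big_split/=; apply: eq_bigr => i _; rewrite /masked in_setU.
case: (boolP (_ \in A)) => [/set_mem/AB iA|_] /=; last by rewrite add0r.
by rewrite (memNset iA) addr0.
Qed.

Lemma masked_sum_mono A v N p : (forall i, 0 [<=] v i) -> (N <= p)%N ->
  \sum_(i < N) masked A v i [<=] \sum_(i < p) masked A v i.
Proof. by move=> v0 Np; apply: (lsum_mono HL) => // i; exact: masked_ge0. Qed.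

Lemma masked_sum_range (sigma : nat -> nat) v n N : (forall i, 0 [<=] v i) ->
  \sum_(i < N) masked (range sigma) v i [<=]
  v (sigma n) + \sum_(i < N) masked (other_values sigma n) v i.
Proof.
move=> v0; have E1 : \sum_(i < N) masked [set sigma n] v i [<=] v (sigma n).
  elim: N => [|N IH]; first by rewrite big_ord0.
  have [NE|NE] := eqVneq N (sigma n).
    rewrite big_ord_recr/= big1 ?add0r.
      by rewrite /masked NE; case: ifP => _; [exact: lle_refl|exact: v0].
    move=> i _; rewrite /masked memNset// => /= iE.
    by have := ltn_ord i; rewrite iE NE ltnn.
  by rewrite big_ord_recr/= {2}/masked memNset ?addr0// => /= h; rewrite h eqxx in NE.
apply: (lle_trans HL _ (lle_add HL E1 (lle_refl HL _))); rewrite -big_split/=.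
apply: (@lsum_le _ _ _ HL N (masked (range sigma) v)
  (fun i => masked [set sigma n] v i + masked (other_values sigma n) v i)) => i _.
have m0 B : 0 [<=] masked B v i by exact: masked_ge0.
rewrite {1}/masked; case: ifP => [/set_mem[j _ ij]|_]; last exact: ladd_ge0.
have [jn|jn] := pselect (j = n).
  rewrite {1}/masked mem_set; first exact: lle_addl.
  by rewrite /= -ij jn.
rewrite [X in _ [<=] _ + X]/masked mem_set; first exact: lle_addr0.
by exists j.
Qed.

Lemma masked_range_ge (sigma : nat -> nat) v n m N : injective sigma -> (forall i, 0 [<=] v i) ->
  n <> m -> (sigma n < N)%N -> (sigma m < N)%N ->
  v (sigma n) + v (sigma m) [<=] \sum_(i < N) masked (range sigma) v i.
Proof.
move=> sinj v0 nm nN mN.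
have one B k : B k -> (k < N)%N -> v k [<=] \sum_(i < N) masked B v i.
  move=> Bk kN; have := @lsum_ge_term _ _ _ HL N (masked B v) k (fun i => masked_ge0 B i v0) kN.
  by rewrite {1}/masked mem_set.
have dis k : [set sigma n] k -> ~ [set sigma m] k by move=> /= -> /sinj.
apply: (lle_trans HL (lle_add HL (one [set sigma n] _ erefl nN) (one [set sigma m] _ erefl mN))).
rewrite -masked_sumU//; apply: masked_sumS => // k [->|->]; [by exists n|by exists m].
Qed.

Definition order_disjoint_null := forall (d : nat -> E) u, disjoint_seq L d ->
  (forall n, d n [<=] u) -> forall e, 0 < e -> exists N, forall n, (N <= n)%N -> `|d n| <= e.

Definition order_continuous_norm := forall (x : nat -> E) u, (forall n, x n [<=] x n.+1) ->
  (forall n, x n [<=] u) -> exists l : E, x @ \oo --> l.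

(** Increments of norm above [e] are disjointified. With [y A] the supremum of the partial sums over
    [A] and [f n] norming [v n], Rosenthal's lemma for [mu n A = f n (y A)] makes the other selected
    increments weigh at most [e / 2] under [f (sigma n)]. *)
Lemma order_disjoint_null_ocn : dedekind_sigma_complete L -> order_disjoint_null ->
  order_continuous_norm.
Proof.
move=> Hsig disj0 x u xS xu; apply: increasing_cvg_of_increments => // v phi e e0 v0 ve vx.
pose P A N := \sum_(i < N) masked A v i.
have Pu A N : P A N [<=] u - x 0%N.
  apply: (lle_trans HL (masked_sum_le A N v0)); rewrite vx.
  by apply: lle_addr => //; exact: xu.
have u0 : 0 [<=] u - x 0%N by have := Pu set0 0%N; rewrite /P big_ord0.
have /choice[y yP] : forall A, exists y, (forall N, P A N [<=] y) /\
    forall z, (forall N, P A N [<=] z) -> y [<=] z.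
  by move=> A; apply: (Hsig (P A)); exists (u - x 0%N); exact: Pu.
have y0 A : 0 [<=] y A by have := (yP A).1 0%N; rewrite /P big_ord0.
have /choice[f fP] : forall k, exists f, [/\ positive_dual L f, forall x, `|f x| <= `|x| &
    f (v k) = `|v k|] by move=> k; exact: positive_norming.
have pf n : positive_dual L (f n) by case: (fP n).
pose mu n A := f n (y A).
have [|n A|n A B AB|n A B AB|sigma [sinj smu]] :=
  @rosenthal_disjointification R mu `|u - x 0%N| (e / 2).
- by rewrite divr_gt0.
- rewrite (pf n).2//=; have [_ + _] := fP n; move=> h; apply: le_trans (ler_norm _) _.
  apply: (le_trans (h _)); apply: (lnorm_le_pos HL) => //.
  exact/(yP A).2.
- apply: (pdual_mono HL (pf n)); apply: (yP A).2 => N.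
  by apply: (lle_trans HL (masked_sumS N v0 AB)); exact: (yP B).1.
- rewrite /mu -(dualD (pf n).1); apply: (pdual_mono HL (pf n)).
  suff : y A [<=] y (A `|` B) - y B by move: (y A) (y B) (y (_ `|` _)) => a b c; lattice.
  apply: (yP A).2 => N.
  suff : y B [<=] y (A `|` B) - P A N by move: (P A N) (y B) (y (_ `|` _)) => a b c; lattice.
  apply: (yP B).2 => N'.
  have := (yP (A `|` B)).1 (maxn N N'); rewrite {1}/P masked_sumU//.
  have := @masked_sum_mono A v _ _ v0 (leq_maxl N N').
  have := @masked_sum_mono B v _ _ v0 (leq_maxr N N').
  rewrite -!/(P _ _); move: (P A N) (P B N') (P A _) (P B _) (y _) => a b c d z; lattice.
(* Disjoint because [v (sigma n) + v (sigma m) [<=] y (range sigma)] for [n <> m], so the two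
   differences have a nonpositive sum. Under [f (sigma n)], [w n] keeps at least
   [2 |v| - (|v| + e / 2)], which is more than [e / 2]. *)
pose w n := (2 *: v (sigma n) - y (range sigma)) [\/] 0.
have yge n m : n <> m -> v (sigma n) + v (sigma m) [<=] y (range sigma).
  move=> nm; pose N := (maxn (sigma n) (sigma m)).+1.
  apply: (lle_trans HL (masked_range_ge sinj v0 nm _ _) ((yP (range sigma)).1 N)).
    by rewrite ltnS leq_maxl.
  by rewrite ltnS leq_maxr.
have wd : disjoint_seq L w.
  split=> [n|n m nm]; first exact: ljoinr.
  have : v (sigma n) + v (sigma m) [<=] y (range sigma) by apply: yge => h; rewrite h ltnn in nm.
  by rewrite /w; move: (v _) (v _) (y _) => a b c; lattice.
have wu n : w n [<=] 2 *: (u - x 0%N).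
  have : v (sigma n) [<=] u - x 0%N.
    have h := @lsum_ge_term _ _ _ HL (sigma n).+1 v _ v0 (ltnSn _).
    by apply: (lle_trans HL h); rewrite vx; apply: lle_addr => //; exact: xu.
  by move: (y0 (range sigma)) u0; rewrite /w; move: (v _) (y _) (u - _) => a b c; lattice.
have fw n : e / 2 <= `|w n|.
  have [_ + fv] := fP (sigma n); move=> h; apply: le_trans (h _); apply: le_trans (ler_norm _).
  have h1 : f (sigma n) (2 *: v (sigma n) - y (range sigma)) <= f (sigma n) (w n).
    by apply: (pdual_mono HL (pf _)); exact: ljoinl.
  have h2 : f (sigma n) (y (range sigma)) <= f (sigma n) (v (sigma n)) + mu (sigma n) (other_values sigma n).
    rewrite /mu -(dualD (pf _).1); apply: (pdual_mono HL (pf _)); apply: (yP _).2 => N.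
    apply: (lle_trans HL (masked_sum_range sigma n N v0)).
    by apply: lle_add => //; [exact: lle_refl|exact: (yP _).1].
  move: h1; rewrite (dualB (pf _).1) (dualZ (pf _).1) fv.
  have := smu n; have := ve (sigma n); rewrite fv in h2; lra.
have e40 : 0 < e / 4 by rewrite divr_gt0.
have [N hN] := disj0 _ _ wd wu _ e40.
have := hN N (leqnn N); have := fw N; lra.
Qed.

(** A disjoint sequence bounded below in norm with bounded partial sums would span a copy of c_0. *)
Definition sum_disjoint_null := forall (d : nat -> E) M, disjoint_seq L d ->
  (forall N, `|\sum_(i < N) d i| <= M) ->
  forall e, 0 < e -> exists N, forall n, (N <= n)%N -> `|d n| <= e.

(** The defining property of KB-spaces, for sequences. *)
Definition bounded_increasing_cvg := forall (x : nat -> E) M, (forall n, x n [<=] x n.+1) ->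
  (forall n, `|x n| <= M) -> exists l : E, x @ \oo --> l.

Lemma decreasing_cvg (x : nat -> E) u : order_continuous_norm -> (forall n, x n.+1 [<=] x n) ->
  (forall n, u [<=] x n) -> exists l : E, x @ \oo --> l.
Proof.
move=> ocn xS xu.
have [n|n|l xl] := ocn (fun n => - x n) (- u); [exact: lle_opp|exact: lle_opp|].
exists (- l); have -> : x = fun n => - - x n by apply/funext => n; rewrite opprK.
exact: cvgN.
Qed.

Lemma disjoint_reindexed_sum (d w : nat -> E) (sigma : nat -> nat) (c : R) N : disjoint_seq L w ->
  0 <= c -> (forall i, 0 [<=] d i) -> (forall n, w n [<=] c *: d (sigma n)) ->
  exists p, \sum_(i < N) w i [<=] c *: \sum_(i < p) d i.
Proof.
move=> wd c0 d0 wdc; have [p hp] := injective_bound sigma N; exists p.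
apply: disjoint_sum_le => // [|n nN].
  by apply: lscale_ge0 => //; exact: lsum_ge0.
apply: (lle_trans HL (wdc n)); apply: lle_scale => //.
by apply: lsum_ge_term => //; exact: hp.
Qed.

(** As in [order_disjoint_null_ocn], but the suprema [y A] need not exist without an order bound.
    The real supremum of the [f n (P A N)] replaces [f n (y A)], and [w n] is the norm limit of the
    decreasing [t n N], given by order continuity of the norm. *)
Lemma sum_disjoint_null_cvg : order_continuous_norm -> sum_disjoint_null -> bounded_increasing_cvg.
Proof.
move=> ocn sdn x M xS xM; apply: increasing_cvg_of_increments => // v phi e e0 v0 ve vx.
pose P A N := \sum_(i < N) masked A v i.
have P0 A N : 0 [<=] P A N by apply: (lsum_ge0 HL) => i; exact: masked_ge0.
have vM N : `|\sum_(i < N) v i| <= 2 * M.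
  by rewrite vx; apply: le_trans (ler_normB _ _) _; have := xM (phi N); have := xM 0%N; lra.
have PM A N : `|P A N| <= 2 * M.
  by apply: le_trans (vM N); apply: (lnorm_le_pos HL) => //; exact: masked_sum_le.
have /choice[f fP] : forall k, exists f, [/\ positive_dual L f, forall x, `|f x| <= `|x| &
    f (v k) = `|v k|] by move=> k; exact: positive_norming.
have pf n : positive_dual L (f n) by case: (fP n).
have fPM n A N : f n (P A N) <= 2 * M.
  have [_ + _] := fP n; move=> h; apply: le_trans (ler_norm _) _.
  exact: le_trans (h _) (PM A N).
pose mu n A := sup (range (fun N => f n (P A N))).
have hs n A : has_sup (range (fun N => f n (P A N))).
  by split; [exists (f n (P A 0%N)), 0%N|exists (2 * M) => _ [N _ <-]].
have mu_ge n A N : f n (P A N) <= mu n A by apply: (ub_le_sup (hs n A).2); exists N.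
have mu_le n A c : (forall N, f n (P A N) <= c) -> mu n A <= c.
  by move=> h; apply: (sup_le_ub (hs n A).1) => _ [N _ <-].
have [|n A|n A B AB|n A B AB|sigma [sinj smu]] := @rosenthal_disjointification R mu (2 * M) (e / 2).
- by rewrite divr_gt0.
- rewrite mu_le// andbT; apply: le_trans (mu_ge n A 0%N); exact: (pf n).2.
- apply: (mu_le) => N; apply: le_trans (mu_ge n B N); apply: (pdual_mono HL (pf n)).
  exact: masked_sumS.
- rewrite -lerBrDr; apply: (mu_le) => N; rewrite lerBrDr -lerBrDl; apply: (mu_le) => N'.
  rewrite lerBrDl; apply: le_trans (mu_ge n (A `|` B) (maxn N N')).
  rewrite /P masked_sumU// (dualD (pf n).1); apply: lerD; apply: (pdual_mono HL (pf n)).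
    by apply: masked_sum_mono => //; exact: leq_maxl.
  by apply: masked_sum_mono => //; exact: leq_maxr.
pose t n N := (2 *: v (sigma n) - P (range sigma) N) [\/] 0.
have tS n N : t n N.+1 [<=] t n N.
  have := @masked_sum_mono (range sigma) v _ _ v0 (leqnSn N).
  rewrite /t -!/(P _ _); move: (_ *: _) (P _ _) (P _ _) => a b c; lattice.
have /choice[w wP] : forall n, exists l : E, t n @ \oo --> l.
  by move=> n; apply: (@decreasing_cvg _ 0) => // N; exact: ljoinr.
have w_le n N : w n [<=] t n N.
  apply: (lle_lim HL (wP n)); exists N => N' NN'.
  have := @masked_sum_mono (range sigma) v _ _ v0 NN'.
  by rewrite /t -!/(P _ _); move: (_ *: _) (P _ _) (P _ _) => a b c; lattice.
have w0 n : 0 [<=] w n.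
  by apply: (lge_lim HL (wP n)); exists 0%N => N _; exact: ljoinr.
have wd : disjoint_seq L w.
  split=> // n m nm; pose N := (maxn (sigma n) (sigma m)).+1.
  have : v (sigma n) + v (sigma m) [<=] P (range sigma) N.
    apply: masked_range_ge => //; rewrite ?ltnS ?leq_maxl ?leq_maxr//.
    by move=> h; rewrite h ltnn in nm.
  move: (w_le n N) (w_le m N); rewrite /t.
  by move: (v _) (v _) (P _ _) (w n) (w m) => a b c z z'; lattice.
have wv n : w n [<=] 2 *: v (sigma n).
  apply: (lle_trans HL (w_le n 0%N)); rewrite /t /P big_ord0.
  by move: (v0 (sigma n)); move: (v _) => a; lattice.
have wM N : `|\sum_(i < N) w i| <= 2 * (2 * M).
  have [p hp] := disjoint_reindexed_sum N wd (ler0n R 2) v0 wv.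
  apply: le_trans (_ : `|(2 : R) *: \sum_(i < p) v i| <= _).
    by apply: (lnorm_le_pos HL) => //; exact: lsum_ge0.
  by rewrite normrZ ger0_norm// ler_wpM2l.
have fw n : e / 2 <= `|w n|.
  have [_ + fv] := fP (sigma n); move=> h; apply: le_trans (h _); apply: le_trans (ler_norm _).
  apply/ler_addgt0Pr => r r0.
  have /(@cvg_seqP R R^o)/(_ r r0)[N hN] := dual_cvg (pf (sigma n)).1 (wP n).
  have := hN N (leqnn N); rewrite ler_norml => /andP[_ h0].
  have h1 : f (sigma n) (2 *: v (sigma n) - P (range sigma) N) <= f (sigma n) (t n N).
    by apply: (pdual_mono HL (pf _)); exact: ljoinl.
  have h2 : f (sigma n) (P (range sigma) N) <= f (sigma n) (v (sigma n)) + f (sigma n) (P (other_values sigma n) N).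
    rewrite -(dualD (pf _).1); apply: (pdual_mono HL (pf _)).
    exact: masked_sum_range.
  move: h1; rewrite (dualB (pf _).1) (dualZ (pf _).1) fv.
  have := smu n; have := mu_ge (sigma n) (other_values sigma n) N.
  have := ve (sigma n); rewrite fv in h2; lra.
have e40 : 0 < e / 4 by rewrite divr_gt0.
have [N hN] := sdn _ _ wd wM _ e40.
have := hN N (leqnn N); have := fw N; lra.
Qed.

End monotone_convergence.

(** * Disjoint sequences with bounded sums *)

Section disjoint_bounded_sums.
Variables (R : realType) (E : completeNormedModType R) (L : lattice_ops E).
Hypothesis HL : is_banach_lattice L.
Implicit Types (x y z u : E).

Local Notation "x [<=] y" := (lle L x y) (at level 70, no associativity).
Local Notation "x [\/] y" := (ljoin L x y) (at level 50, left associativity).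
Local Notation "x [/\] y" := (lmeet L x y) (at level 48, left associativity).
Local Notation labs := (labs L).

(* The norm of the part of [x] that lives on [c]; it tends to zero along a
   disjoint sequence when order bounded disjoint sequences are norm null. *)
Definition part_norm (c x : E) : R := sup (range (fun k : nat => `|(x [\/] 0) [/\] (k%:R *: c)|)).

Section part_norm_facts.
Variable c : E.
Hypothesis c0 : 0 [<=] c.

Let kc0 (k : nat) : 0 [<=] k%:R *: c. Proof. exact: lscale_ge0. Qed.

Let term_le x (k : nat) : `|(x [\/] 0) [/\] (k%:R *: c)| <= `|x [\/] 0|.
Proof.
apply: (lnorm_le_pos HL); last exact: lmeetl.
by apply: lmeet_glb => //; exact: ljoinr.
Qed.

Let has_sup_part x : has_sup (range (fun k : nat => `|(x [\/] 0) [/\] (k%:R *: c)|)).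
Proof.
by split; [exists `|(x [\/] 0) [/\] (0%:R *: c)|, 0%N|exists `|x [\/] 0| => _ [k _ <-]].
Qed.

Lemma part_norm_ge x (k : nat) : `|(x [\/] 0) [/\] (k%:R *: c)| <= part_norm c x.
Proof. by apply: (ub_le_sup (has_sup_part x).2); exists k. Qed.

Lemma part_norm_le x r : (forall k : nat, `|(x [\/] 0) [/\] (k%:R *: c)| <= r) -> part_norm c x <= r.
Proof. by move=> h; apply: (sup_le_ub (has_sup_part x).1) => _ [k _ <-]. Qed.

Lemma part_norm_adherent x e : 0 < e ->
  exists k : nat, part_norm c x - e < `|(x [\/] 0) [/\] (k%:R *: c)|.
Proof.
by move=> e0; have [_ [k _ <-] h] := sup_adherent e0 (has_sup_part x); exists k.
Qed.

Lemma part_norm_bounds x : 0 <= part_norm c x <= `|x [\/] 0|.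
Proof.
apply/andP; split; last by apply: part_norm_le => k; exact: term_le.
exact: le_trans (normr_ge0 _) (part_norm_ge x 0%N).
Qed.

Lemma part_norm_self : part_norm c c = `|c|.
Proof.
have cE : c [\/] 0 = c by apply: (lle_anti HL); move: c0; lattice.
apply/eqP; rewrite eq_le; apply/andP; split.
  by have /andP[_] := part_norm_bounds c; rewrite cE.
by have := part_norm_ge c 1%N; rewrite cE scale1r (_ : c [/\] c = c)//; lattice.
Qed.

Lemma part_norm_sublinear : sublinear_on (fun=> True) (part_norm c).
Proof.
split=> [x y _ _|t x t0 _].
  apply: part_norm_le => k.
  apply: le_trans (lerD (part_norm_ge x k) (part_norm_ge y k)); apply: le_trans (ler_normD _ _).
  apply: (lnorm_le_pos HL).
    by apply: lmeet_glb => //; exact: ljoinr.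
  by move: (kc0 k); move: (_ *: c) => v; lattice.
have le s z : 0 < s -> part_norm c (s *: z) <= s * part_norm c z.
  move=> s0; apply: part_norm_le => k.
  pose k' := Num.bound (k%:R / s).
  apply: le_trans (_ : s * `|(z [\/] 0) [/\] (k'%:R *: c)| <= _); last first.
    by rewrite ler_wpM2l ?part_norm_ge// ltW.
  rewrite -[X in X * _]gtr0_norm// -normrZ lmeet_scale// ljoin_scale// scaler0.
  apply: (lnorm_le_pos HL); first by apply: lmeet_glb => //; exact: ljoinr.
  have : k%:R *: c [<=] s *: (k'%:R *: c).
    rewrite scalerA; apply: lscale_mono => //.
    rewrite mulrC -ler_pdivrMr//; apply: ltW; apply: archi_boundP.
    by rewrite divr_ge0// ltW.
  by move: (s *: z) (_ *: _) (_ *: _) => a b d; lattice.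
have [tE|tn0] := eqVneq t 0.
  rewrite tE mul0r scale0r; apply/eqP; rewrite eq_le.
  have /andP[-> h] := part_norm_bounds 0; rewrite andbT; apply: (le_trans h).
  by rewrite (_ : 0 [\/] 0 = 0) ?normr0//; lattice.
have {}t0 : 0 < t by rewrite lt_def tn0.
apply/eqP; rewrite eq_le le//=.
have := le t^-1 (t *: x); rewrite invr_gt0 t0 scalerA mulVf ?gt_eqF// scale1r => /(_ isT).
by rewrite -(ler_pM2l t0) mulrA mulfV ?gt_eqF// mul1r.
Qed.

End part_norm_facts.

Hypothesis disj0 : order_disjoint_null L.
Hypothesis TDP : forall T : E -> E, is_operator T -> positive_op L T -> weak_DP T -> uaw_DP L T.

(** Multiples [k n] nearly attaining the suprema give a disjoint sequence below the positive part of
    [x], hence a norm null one. *)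
Lemma part_norm_to0 (c : nat -> E) x : disjoint_seq L c ->
  forall e, 0 < e -> exists N, forall n, (N <= n)%N -> part_norm (c n) x <= e.
Proof.
move=> [c0 cd] e e0; have e20 : 0 < e / 2 by rewrite divr_gt0.
have /choice[k kP] : forall n, exists k : nat,
    part_norm (c n) x - e / 2 < `|(x [\/] 0) [/\] (k%:R *: c n)|.
  by move=> n; exact: part_norm_adherent.
pose d n := (x [\/] 0) [/\] ((k n)%:R *: c n).
have x0 : 0 [<=] x [\/] 0 by exact: ljoinr.
have kc0 n : 0 [<=] (k n)%:R *: c n by exact: lscale_ge0.
have dd : disjoint_seq L d.
  split=> [n|n m nm]; first exact: lmeet_glb.
  have h1 : ((k n)%:R *: c n) [/\] c m [<=] 0 by apply: (meet_scale0 HL) => //; exact: cd.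
  have : ((k m)%:R *: c m) [/\] ((k n)%:R *: c n) [<=] 0.
    by apply: (meet_scale0 HL) => //; move: h1; move: (_ *: c n) => v; lattice.
  by rewrite /d; move: (_ [\/] 0) (_ *: c n) (_ *: c m) => w v v'; lattice.
have [N hN] := disj0 dd (fun n => lmeetl HL _ _) e20.
exists N => n /hN; have := kP n; rewrite -/(d n); lra.
Qed.

(** Beyond [n] the series is dominated by [M] times the largest later coefficient [|g i x|], so
    pointwise nullity of [g] makes it converge. *)
Lemma disjoint_series_operator (c : nat -> E) (g : nat -> E -> R) M :
  disjoint_seq L c -> (forall N, `|\sum_(i < N) c i| <= M) ->
  (forall n, positive_dual L (g n)) -> (forall n x, `|g n x| <= `|x|) ->
  (forall x e, 0 < e -> exists N, forall n, (N <= n)%N -> `|g n x| <= e) ->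
  exists T : E -> E, is_operator T /\ positive_op L T /\
    (forall x, (fun N => \sum_(i < N) g i x *: c i) @ \oo --> T x).
Proof.
move=> [c0 cd] cM pg g1 g0.
have Dg n : is_dual (g n) := (pg n).1.
have M0 : 0 <= M by exact: le_trans (cM 0%N).
have part (x : E) n m r : (n <= m)%N -> 0 <= r -> (forall i, (n <= i)%N -> `|g i x| <= r) ->
    `|\sum_(i < m) g i x *: c i - \sum_(i < n) g i x *: c i| <= r * M.
  move=> nm r0 hr; pose s i := if (i < n)%N then 0 else g i x.
  have -> : \sum_(i < m) g i x *: c i - \sum_(i < n) g i x *: c i = \sum_(i < m) s i *: c i.
    rewrite (big_ord_widen _ (fun i => g i x *: c i) nm) [X in _ - X]big_mkcond/= -sumrB.
    by apply: eq_bigr => i _; rewrite /s; case: ifP; rewrite ?subrr ?scale0r ?subr0.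
  apply: le_trans (_ : `|r *: \sum_(i < m) c i| <= _); last by rewrite normrZ ger0_norm// ler_wpM2l.
  apply: (lnorm_abs_le HL); apply: signed_sum_le => // i _; rewrite /s.
  by case: ltnP => h; rewrite ?normr0//; exact: hr.
have /choice[T Tl] : forall x, exists l : E, (fun N => \sum_(i < N) g i x *: c i) @ \oo --> l.
  move=> x; apply: cauchy_seq_cvg => e e0.
  have e1 : 0 < e / (2 * (M + 1)) by rewrite divr_gt0// mulr_gt0// ltr_wpDl.
  have [N hN] := g0 x _ e1; exists N => n m Nn Nm.
  have h k (Nk : (N <= k)%N) := part x N k _ Nk (ltW e1) hN.
  rewrite -(subrKA (\sum_(i < N) g i x *: c i)); apply: le_trans (ler_normD _ _) _.
  rewrite [X in _ + X]distrC; apply: le_trans (lerD (h n Nn) (h m Nm)) _.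
  have -> : e / (2 * (M + 1)) * M + e / (2 * (M + 1)) * M = e * (M / (M + 1)).
    by field; rewrite gt_eqF// ltr_wpDl.
  rewrite ler_piMr ?(ltW e0)// ler_pdivrMr ?mul1r ?lerDl// ltr_wpDl//.
exists T; split; last split=> //.
  apply: (@operator_of_bound _ _ _ M) => // [a x y|x].
    have := @cvg_seqZD R E a _ _ _ _ (Tl x) (Tl y).
    have -> : (fun n => a *: (\sum_(i < n) g i x *: c i) + \sum_(i < n) g i y *: c i) =
        (fun n => \sum_(i < n) g i (a *: x + y) *: c i).
      apply/funext => n; rewrite scaler_sumr -big_split/=; apply: eq_bigr => i _.
      by rewrite (dualD (Dg i)) (dualZ (Dg i)) scalerDl scalerA.
    exact: (@cvg_seq_unique R E _ _ _ (Tl _)).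
  apply: (cvg_norm_le (Tl x)); exists 0%N => n _.
  by have := part x 0%N n `|x| (leq0n n) (normr_ge0 x) (fun i _ => g1 i x); rewrite big_ord0 subr0 mulrC.
move=> x x0; apply: (lge_lim HL (Tl x)); exists 0%N => n _.
apply: (@lsum_ge0 _ _ _ HL n (fun i => g i x *: c i)) => i.
by apply: lscale_ge0 => //; exact: (pg i).2.
Qed.

(** A linear minorant [g n] of [part_norm (c n)] that attains its value at [c n] is pointwise null
    and satisfies [g n (c n) = |c n|]. The series operator is weak Dunford-Pettis because
    [|g k (x n)|] is bounded and the sums of [|f n (c k)|] over [k] tend to zero by [dual_schur].
    Again [|c n|] squared is at most [|T (c n)|]. *)
Lemma uaw_DP_sum_disjoint_null : sum_disjoint_null L.
Proof.
move=> d M dd dM e e0; apply: contrapT => nN.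
have [|phi [phie phiS]] := @increasing_subsequence (fun n => e < `|d n|).
  move=> N; apply: contrapT => nn; apply: nN; exists N => n Nn.
  by rewrite leNgt; apply/negP => h; apply: nn; exists n.
have [d0 ddis] := dd.
pose c n := d (phi n).
have cd : disjoint_seq L c by split=> [n|n m nm]; [exact: d0|exact/ddis/phiS].
have [c0 _] := cd.
have cM N : `|\sum_(i < N) c i| <= M.
  have [|p hp] := @disjoint_reindexed_sum _ _ _ HL d c phi 1 N cd ler01 d0.
    by move=> n; rewrite scale1r; exact: lle_refl.
  apply: le_trans (dM p); apply: (lnorm_le_pos HL); first exact: lsum_ge0.
  by rewrite scale1r in hp.
have /choice[g gP] : forall n, exists f, [/\ positive_dual L f, forall x, f x <= part_norm (c n) x &
    f (c n) = `|c n|].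
  move=> n; have [f [pf fp fc]] := @positive_minorant _ _ _ HL _ (c n)
    (part_norm_sublinear (c0 n)) (part_norm_bounds (c0 n)).
  by exists f; rewrite fc part_norm_self.
have pg n : positive_dual L (g n) by case: (gP n).
have Dg n : is_dual (g n) := (pg n).1.
have g1 n x : `|g n x| <= `|x|.
  have le y : g n y <= `|y|.
    have [_ h _] := gP n; apply: le_trans (h y) _.
    by have /andP[_ h2] := part_norm_bounds (c0 n) y; exact: le_trans h2 (lnorm_pos HL y).
  by rewrite ler_norml le andbT lerNl -(dualN (Dg n)) -normrN; exact: le.
have g0 x r : 0 < r -> exists N, forall n, (N <= n)%N -> `|g n x| <= r.
  move=> r0; have [N hN] := part_norm_to0 (labs x) cd r0; exists N => n /hN h.
  apply: le_trans (pdual_abs HL (pg n) x) _; have [_ h2 _] := gP n.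
  exact: le_trans (h2 _) h.
have [T [To [Tp Tl]]] := disjoint_series_operator cd cM pg g1 g0.
have TwDP : weak_DP T.
  move=> x f xw fw; apply/cvg0_eps => r r0.
  have [K [K0 xK]] := weakly_null_bounded xw.
  have r1 : 0 < r / (K + 1) by rewrite divr_gt0// ltr_wpDl.
  have cC (s : nat -> R) N : (forall i, `|s i| <= 1) -> `|\sum_(i < N) s i *: c i| <= M.
    by move=> s1; exact: (signed_sum_norm_le HL c0 s1 (cM N)).
  have [N hN] := dual_schur cC fw r1; exists N => n /hN h.
  have Dfn := fw.1 n.
  apply: (@cvg_norm_le R R^o _ _ _ (dual_cvg Dfn (Tl (x n)))); exists 0%N => m _ /=.
  rewrite (dual_sum Dfn); apply: le_trans (ler_norm_sum _ _ _) _.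
  apply: le_trans (_ : \sum_(i < m) (K + 1) * `|f n (c i)| <= _).
    apply: ler_sum => i _; rewrite (dualZ Dfn) normrM ler_wpM2r//.
    by apply: le_trans (g1 _ _) _; apply: le_trans (xK n) _; rewrite lerDl.
  by rewrite -mulr_sumr mulrC -ler_pdivlMr ?ltr_wpDl.
have cB n : `|c n| <= M.
  have := @lsum_ge_term _ _ _ HL n.+1 c n c0 (ltnSn n) => h.
  by apply: le_trans (cM n.+1); exact: (lnorm_le_pos HL).
have /cvg0_eps h := TDP To Tp TwDP (ex_intro _ M cB) (disjoint_uaw_null HL cd).
have [N hN] := h _ (mulr_gt0 e0 e0); have := hN N (leqnn N); rewrite normr_id => h1.
have h2 : `|c N| * `|c N| <= `|T (c N)|.
  rewrite -{1}(normr_id (c N)) -normrZ; apply: (lnorm_le_pos HL).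
    exact: lscale_ge0.
  apply: (lge_lim HL (Tl (c N))); exists N.+1 => m Nm.
  have [_ _ <-] := gP N.
  apply: (@lsum_ge_term _ _ _ HL m (fun i => g i (c N) *: c i)) => // i.
  by apply: lscale_ge0 => //; exact: (pg i).2.
have := le_trans h2 h1; rewrite leNgt => /negP; apply.
by have := phie N; rewrite -/(c N) => h3; apply: ltr_pM => //; exact: ltW.
Qed.

End disjoint_bounded_sums.

(** * Nonreflexive spaces *)

Section nonreflexive_spaces.
Variables (R : realType) (E : completeNormedModType R).
Implicit Types (f g : E -> R).

Lemma bidual0 (Phi : (E -> R) -> R) : is_bidual Phi -> Phi (fun=> 0) = 0.
Proof.
move=> [Pl _]; have := Pl (-1) _ _ (@dual_zero R E) (@dual_zero R E).
have -> : (fun _ : E => -1 * 0 + 0 : R) = fun=> 0 by apply/funext => x; rewrite mulr0 addr0.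
lra.
Qed.

Lemma bidual_scale (Phi : (E -> R) -> R) a f : is_bidual Phi -> is_dual f ->
  Phi (fun x => a * f x) = a * Phi f.
Proof.
move=> PB Df; have := PB.1 a _ _ Df (@dual_zero R E); rewrite bidual0// addr0 => <-.
by congr Phi; apply/funext => x; rewrite addr0.
Qed.

Lemma bidual_sum (Phi : (E -> R) -> R) (c : nat -> R) (f : nat -> E -> R) n : is_bidual Phi ->
  (forall i, is_dual (f i)) ->
  is_dual (fun x => \sum_(i < n) c i * f i x) /\
  Phi (fun x => \sum_(i < n) c i * f i x) = \sum_(i < n) c i * Phi (f i).
Proof.
move=> PB Df; elim: n => [|n [D IH]].
  have -> : (fun x => \sum_(i < 0) c i * f i x) = fun=> 0 by apply/funext => x; rewrite big_ord0.
  by rewrite big_ord0 bidual0//; split=> //; exact: dual_zero.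
have -> : (fun x => \sum_(i < n.+1) c i * f i x) =
    fun x => c n * f n x + (\sum_(i < n) c i * f i x).
  by apply/funext => x; rewrite big_ord_recr/= addrC.
by rewrite PB.1// IH big_ord_recr/= addrC; split=> //; exact: dual_comb.
Qed.

(* Goldstine's theorem for finitely many functionals, by separation in the
   space of their values. *)
Lemma finite_goldstine (Phi : (E -> R) -> R) (f : nat -> E -> R) C d n : is_bidual Phi ->
  0 <= C -> (forall g, is_dual g -> `|Phi g| <= C * dual_norm g) -> 0 < d ->
  (forall i, is_dual (f i)) ->
  exists x, `|x| <= C + 1 /\ forall i, (i < n)%N -> `|f i x - Phi (f i)| <= d.
Proof.
move=> PB C0 PC d0 Df.
have C1 : 0 < C + 1 by rewrite ltr_wpDl.
(* The penalty satisfies [M * d = C + 1], so a point of cost below [C + 1] is as required. If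
   [p a >= C + 1], a linear [l] below [p] with [C + 1 <= l a] gives a combination of the [f i] of
   norm at most one on which [Phi] exceeds [C]. *)
pose M := (C + 1) / d; have M0 : 0 < M by rewrite divr_gt0.
have M0' := ltW M0.
pose V : lmodType R := (nat -> R^o).
pose a : V := fun i => Phi (f i).
pose cost (v : V) x := `|x| + M * \sum_(i < n) `|v i - f i x|.
have cost0 v x : 0 <= cost v x by rewrite addr_ge0// mulr_ge0// sumr_ge0.
pose p (v : V) := inf (range (cost v)).
have hp v : has_inf (range (cost v)).
  by split; [exists (cost v 0), 0|exists 0 => _ [x _ <-]].
have p_le v x : p v <= cost v x by apply: (ge_inf (hp v).2); exists x.
have p_adh v e : 0 < e -> exists x, cost v x < p v + e.
  by move=> e0; have [_ [x _ <-] h] := inf_adherent e0 (hp v); exists x.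
have p0 v : 0 <= p v by apply: (lb_le_inf (hp v).1) => _ [x _ <-].
have [pa|pa] := ltP (p a) (C + 1).
  have e0 : 0 < C + 1 - p a by rewrite subr_gt0.
  have [x] := p_adh a _ e0; rewrite addrC subrK => xC; exists x; split=> [|i iN].
    apply: le_trans (ltW xC); rewrite lerDl mulr_ge0// sumr_ge0//.
  have : M * `|a i - f i x| <= C + 1.
    apply: le_trans (ltW xC); rewrite /cost (bigD1 (Ordinal iN))//= mulrDr addrCA lerDl.
    by rewrite addr_ge0// mulr_ge0// sumr_ge0.
  have Md : M * d = C + 1 by rewrite /M divfK ?gt_eqF.
  by rewrite distrC -[X in _ <= X -> _]Md ler_pM2l.
exfalso.
have sp : sublinear_on (fun=> True) p.
  split=> [v w _ _|t v t0 _].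
    apply/ler_addgt0Pr => e e0; have e2 : 0 < e / 2 by rewrite divr_gt0.
    have [x xv] := p_adh v _ e2; have [y yw] := p_adh w _ e2.
    apply: (le_trans (p_le _ (x + y))).
    have : cost (v + w) (x + y) <= cost v x + cost w y.
      rewrite /cost addrACA -mulrDr -big_split/=; apply: lerD; first exact: ler_normD.
      rewrite ler_pM2l//; apply: ler_sum => i _; rewrite (dualD (Df i)).
      have -> : (v + w) i - (f i x + f i y) = (v i - f i x) + (w i - f i y).
        by rewrite opprD addrACA.
      exact: ler_normD.
    lra.
  have le s w : 0 < s -> p (s *: w) <= s * p w.
    move=> s0; apply/ler_addgt0Pr => e e0.
    have [x xw] := p_adh w _ (divr_gt0 e0 s0); apply: (le_trans (p_le _ (s *: x))).
    have -> : cost (s *: w) (s *: x) = s * cost w x.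
      rewrite /cost normrZ (gtr0_norm s0) mulrDr; congr (_ + _).
      rewrite [RHS]mulrCA; congr (_ * _); rewrite mulr_sumr; apply: eq_bigr => i _.
      by rewrite (dualZ (Df i)) -[X in _ = X * _](gtr0_norm s0) -normrM mulrBr.
    by have := ltW xw; rewrite -(ler_pM2l s0) [s * (p w + _)]mulrDr [s * (e / s)]mulrCA divff ?gt_eqF// mulr1.
  have [tE|tn0] := eqVneq t 0.
    rewrite tE mul0r scale0r; apply/eqP; rewrite eq_le p0 andbT.
    apply: (le_trans (p_le _ 0)); rewrite /cost normr0 add0r big1 ?mulr0// => i _.
    by rewrite (dual0 (Df i)) subrr normr0.
  have {}t0 : 0 < t by rewrite lt_def tn0.
  apply/eqP; rewrite eq_le le//=.
  have := le t^-1 (t *: v); rewrite invr_gt0 t0 scalerA mulVf ?gt_eqF// scale1r => /(_ isT).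
  by rewrite -(ler_pM2l t0) mulrA mulfV ?gt_eqF// mul1r.
pose K (s : V) r := exists t, [/\ 0 <= t, s = t *: a & r = t * (C + 1)].
have [|||||l [ll lp lK]] := @Mazur_Orlicz R V (fun=> True) I (fun _ _ _ _ _ => I) p K sp => //.
- by exists 0; rewrite scale0r mul0r.
- move=> s r s' r' [t [t0 -> ->]] [t' [t'0 -> ->]]; exists (t + t').
  by rewrite addr_ge0// scalerDl mulrDl.
- move=> t s r t0 [t' [t'0 -> ->]]; exists (t * t').
  by rewrite mulr_ge0// scalerA mulrA.
- by move=> s r [t [t0 -> ->]]; rewrite sp.2// ler_wpM2l.
have la : C + 1 <= l a by apply: lK; exists 1; rewrite scale1r mul1r.
have llin : is_linear_map (l : V -> R^o) by move=> t v w; exact: ll.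
pose b i : V := fun j => (j == i)%:R.
(* On vectors that vanish below [n] the point 0 shows [p <= 0], so [l] depends on the first [n]
   coordinates only. *)
have lE v : l v = \sum_(i < n) l (b i) * v i.
  pose r : V := v - \sum_(i < n) v i *: b i.
  have rE i : (i < n)%N -> r i = 0.
    move=> iN; rewrite /r [LHS]/(v i - _ i).
    have -> : (\sum_(j < n) v j *: b j) i = \sum_(j < n) (v j * (i == j)%:R).
      by rewrite fct_sumE.
    rewrite (bigD1 (Ordinal iN))//= eqxx mulr1 big1; first by rewrite addr0; exact: subrr.
    move=> j ji; rewrite (_ : (i == j :> nat) = false) ?mulr0// eq_sym; exact: negbTE.
  have pr (t : R) : p (t *: r) <= 0.
    apply: (le_trans (p_le _ 0)); rewrite /cost normr0 add0r big1 ?mulr0// => i _.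
    have tr : (t *: r) i = 0 :> R by rewrite [LHS]/(t * r i) rE//; exact: mulr0.
    by rewrite (dual0 (Df i)) tr subr0 normr0.
  have r0 : l r = 0.
    apply/eqP; rewrite eq_le; apply/andP; split.
      by rewrite -[r]scale1r; exact: le_trans (lp _ I) (pr 1).
    rewrite -oppr_le0 -(linear_mapN llin) -scaleN1r.
    exact: le_trans (lp _ I) (pr (-1)).
  have -> : v = r + \sum_(i < n) v i *: b i by rewrite subrK.
  rewrite (linear_mapD llin) r0 add0r (linear_map_sum llin); apply: eq_bigr => i _.
  rewrite (linear_mapZ llin) [LHS]/(v i * l (b i)) mulrC; congr (_ * _).
  have -> : (r + \sum_(j < n) v j *: b j) = v by rewrite subrK.
  by [].
have [Dg gE] := @bidual_sum Phi (fun i => l (b i)) f n PB Df.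
have gN : dual_norm (fun x => \sum_(i < n) l (b i) * f i x) <= 1.
  apply: (dual_norm_le Dg) => x x1.
  have h y : \sum_(i < n) l (b i) * f i y <= `|y|.
    rewrite -(lE (fun i => f i y)); apply: le_trans (lp _ I) _.
    apply: (le_trans (p_le _ y)); rewrite /cost big1 ?mulr0 ?addr0// => i _.
    by rewrite subrr normr0.
  rewrite ler_norml (le_trans (h x) x1) andbT lerNl -(dualN Dg).
  by apply: le_trans (h (- x)) _; rewrite normrN.
have := PC _ Dg; rewrite gE -(lE a) => h.
have := le_trans (ler_norm _) h; have := ler_wpM2l C0 gN; rewrite mulr1; lra.
Qed.

(** The restriction of [Phi] to the functionals vanishing on [F] extends to some [l] of norm at most
    [r]. Then [Phi - l] vanishes wherever the evaluations at [F 0, ..., F n.-1] do, so it is a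
    combination of them. *)
Lemma bidual_near_point (Phi : (E -> R) -> R) (F : nat -> E) n (r : R) : is_bidual Phi -> 0 <= r ->
  (forall f, is_dual f -> (forall i, (i < n)%N -> f (F i) = 0) -> Phi f <= r * dual_norm f) ->
  exists x, forall f, is_dual f -> `|Phi f - f x| <= r * dual_norm f.
Proof.
move=> PB r0 Pr.
pose S (f : E -> R^o) := is_dual f /\ forall i, (i < n)%N -> f (F i) = 0 :> R.
have [Dsub Dhom] := dual_norm_sublinear E.
have psub : sublinear_on (@is_dual R E : (E -> R^o) -> Prop) (fun f => r * dual_norm f).
  split=> [f g Df Dg|t f t0 Df]; first by rewrite -mulrDr ler_wpM2l// Dsub.
  by rewrite Dhom// mulrCA.
have [|||||l [ll lp lS]] := @dominated_extension R (E -> R^o) (@is_dual R E)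
  (@dual_subspace0 R E) (@dual_subspaceS R E) (fun f => r * dual_norm f) S Phi psub.
- by split=> //; exact: dual_subspace0.
- move=> a f g [Df f0] [Dg g0]; split; first exact: dual_subspaceS.
  move=> i iN; have h : a * f (F i) + g (F i) = 0 :> R by rewrite f0// g0// mulr0 addr0.
  exact: h.
- by move=> f [].
- by move=> a f g [Df _] [Dg _]; exact: PB.1.
- by move=> f [Df f0]; exact: Pr.
have lb : is_bidual l by exact: (sublinear_minorant_bidual r0 ll lp).
have [||i||f|c cP] := @linear_combination_of_kernels R (E -> R^o) (@is_dual R E)
    (fun i f => f (F i)) (fun f => Phi f - l f) n.
- exact: dual_subspace0.
- exact: dual_subspaceS.
- by move=> a f g Df Dg; exact: erefl.
- by move=> a f g Df Dg; rewrite PB.1// ll//; ring.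
- by move=> Df f0; rewrite lS ?subrr.
exists (\sum_(i < n) c i *: F i) => f Df.
have -> : f (\sum_(i < n) c i *: F i) = Phi f - l f.
  by rewrite cP// (dual_sum Df); apply: eq_bigr => i _; rewrite (dualZ Df).
rewrite opprB addrC subrK.
have Dn : is_dual (fun x => -1 * f x) := dual_scale (-1) Df.
rewrite ler_norml lp// andbT.
have := lp _ Dn; rewrite (bidual_scale _ lb Df) mulN1r.
have -> : dual_norm (fun x => -1 * f x) = dual_norm f; last by rewrite lerNl.
apply/eqP; rewrite eq_le; apply/andP; split.
  apply: (dual_norm_le Dn) => x x1; rewrite mulN1r normrN.
  by apply: le_trans (dual_normP Df x) _; rewrite ler_piMr// dual_norm_ge0.
apply: (dual_norm_le Df) => x x1; have := dual_normP Dn x; rewrite mulN1r normrN => h.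
by apply: le_trans h _; rewrite ler_piMr// dual_norm_ge0.
Qed.

Lemma bidual_limit_point (Phi : (E -> R) -> R) :
  (forall r : R, 0 < r -> exists x, forall f, is_dual f -> `|Phi f - f x| <= r * dual_norm f) ->
  exists x, forall f, is_dual f -> Phi f = f x.
Proof.
move=> h.
have /choice[x xP] : forall n, exists x, forall f, is_dual f -> `|Phi f - f x| <= 2^-1 ^+ n * dual_norm f.
  by move=> n; apply: h; exact: half_pow_gt0.
have [l xl] : exists l : E, x @ \oo --> l.
  apply: (@geometric_cvg R E x 2) => n.
  have [f [Df f1 fx]] := norming_functional (x n.+1 - x n).
  have N1 : dual_norm f <= 1 by apply: (dual_norm_le Df) => z z1; exact: le_trans (f1 z) z1.
  rewrite -fx (dualB Df).
  have := xP n f Df; have := xP n.+1 f Df; rewrite !ler_norml => /andP[h1 h2] /andP[h3 h4].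
  have q0 := half_pow_gt0 R n; have q1 := half_powS R n; have q2 := half_pow_gt0 R n.+1.
  have := ler_wpM2l (ltW q0) N1; have := ler_wpM2l (ltW q2) N1; rewrite !mulr1; lra.
exists l => f Df; apply/eqP; rewrite -subr_eq0 -normr_le0; apply/ler_addgt0Pr => e e0.
rewrite add0r; have e2 : 0 < e / 2 by rewrite divr_gt0.
have /(@cvg_seqP R R^o)/(_ _ e2)[N hN] := dual_cvg Df xl.
have [N' hN'] := half_pow_small (dual_norm f) e2.
pose m := maxn N N'.
have := hN m (leq_maxl _ _); have := hN' m (leq_maxr _ _); have := xP m f Df.
rewrite !ler_norml => /andP[h1 h2] h3 /andP[h4 h5].
by rewrite mulrC in h3; apply/andP; split; lra.
Qed.

(* James' construction: [f n] is chosen to vanish at the previous points while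
   [Phi] stays large on it, and then [x n] approximates [Phi] on [f 0, ..., f n]. *)
Lemma nonreflexive_sequences : ~ reflexive_space E ->
  exists (theta K : R) (f : nat -> E -> R) (x : nat -> E), [/\ 0 < theta,
    forall n, is_dual (f n), forall n z, `|f n z| <= `|z|, forall n, `|x n| <= K &
    (forall m n, (m <= n)%N -> theta <= f m (x n)) /\
    (forall m n, (n < m)%N -> f m (x n) = 0)].
Proof.
move=> /existsNP[Phi /not_implyP[PB nPhi]].
(* Otherwise [bidual_near_point] brings [Phi] within every [r] of [E], and completeness makes [Phi]
   an evaluation. *)
have [r [r0 rP]] : exists r : R, 0 < r /\ forall (F : nat -> E) n, exists f, [/\ is_dual f,
    forall i, (i < n)%N -> f (F i) = 0, forall z, `|f z| <= `|z| & r <= Phi f].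
  apply: contrapT => h; apply: nPhi; apply: bidual_limit_point => r r0.
  have [F [n Fn]] : exists (F : nat -> E) n, ~ exists f, [/\ is_dual f,
    forall i, (i < n)%N -> f (F i) = 0, forall z, `|f z| <= `|z| & r <= Phi f].
    apply: contrapT => h'; apply: h; exists r; split=> // F n; apply: contrapT => h''.
    by apply: h'; exists F, n.
  apply: (@bidual_near_point Phi F n) => //; first exact: ltW.
  move=> f Df f0; rewrite leNgt; apply/negP => h1; apply: Fn.
  have N0 : 0 < dual_norm f.
    rewrite lt_def dual_norm_ge0// andbT; apply/eqP => NE.
    have f00 : f = fun=> 0.
      apply/funext => z; apply/eqP; rewrite -normr_le0.
      by apply: le_trans (dual_normP Df z) _; rewrite NE mul0r.
    by move: h1; rewrite NE mulr0 f00 bidual0// ltxx.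
  exists (fun z => (dual_norm f)^-1 * f z); split.
  - exact: dual_scale.
  - by move=> i iN; rewrite f0// mulr0.
  - move=> z; rewrite normrM normfV (gtr0_norm N0) mulrC ler_pdivrMr//.
    by rewrite mulrC; exact: dual_normP.
  by rewrite bidual_scale// mulrC ler_pdivlMr// ltW.
have [C [C0 PC]] : exists C, 0 <= C /\ forall g, is_dual g -> `|Phi g| <= C * dual_norm g.
  have [_ [C PC]] := PB; exists `|C|; split=> // g Dg; apply: le_trans (PC g Dg) _.
  by rewrite ler_wpM2r ?dual_norm_ge0// ler_norm.
pose P n (a : nat -> (E -> R) * E) (t : (E -> R) * E) :=
  ([/\ is_dual t.1, forall z, `|t.1 z| <= `|z|, r <= Phi t.1 & `|t.2| <= C + 1] /\
  (forall i, (i < n)%N -> t.1 (a i).2 = 0)) /\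
  ((forall i, (i < n)%N -> r / 2 <= (a i).1 t.2) /\ r / 2 <= t.1 t.2).
have [||a aP] := @history_choice _ (fun=> 0, 0) P.
- move=> n a hist; have [f [Df f0 f1 fr]] := rP (fun i => (a i).2) n.
  pose h i := if (i < n)%N then (a i).1 else f.
  have Dh i : is_dual (h i) by rewrite /h; case: ifP => // /hist[[[]]].
  have r2 : 0 < r / 2 by rewrite divr_gt0.
  have [x [xC hx]] := finite_goldstine n.+1 PB C0 PC r2 Dh.
  have hr i : (i < n.+1)%N -> r <= Phi (h i) -> r / 2 <= h i x.
    by move=> /hx; rewrite ler_norml => /andP[h1 _] h2; lra.
  exists (f, x); split; [split=> //|split].
    move=> i iN; have := hr i (leqW iN); rewrite /h iN; apply.
    by have [[[]]] := hist i iN.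
  by have := hr n (ltnSn n); rewrite /h ltnn; exact.
- move=> n a b t ab [[h1 h2] [h3 h4]]; split; split=> // i iN.
    by rewrite -ab//; exact: h2.
  by rewrite -ab//; exact: h3.
exists (r / 2), (C + 1), (fun n => (a n).1), (fun n => (a n).2); split.
- by rewrite divr_gt0.
- by move=> n; have [[[]]] := aP n.
- by move=> n; have [[[]]] := aP n.
- by move=> n; have [[[]]] := aP n.
split=> m n; last by have [[_ h] _] := aP m; exact: h.
by have [_ [h1 h2]] := aP n; rewrite leq_eqVlt => /predU1P[->//|]; exact: h1.
Qed.

End nonreflexive_spaces.

(** * Convergence with respect to a positive functional *)

Section convergence_for_a_functional.
Variables (R : realType) (E : completeNormedModType R) (L : lattice_ops E).
Hypothesis HL : is_banach_lattice L.
Implicit Types (x y z u e : E) (f g : E -> R).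

Local Notation "x [<=] y" := (lle L x y) (at level 70, no associativity).
Local Notation "x [\/] y" := (ljoin L x y) (at level 50, left associativity).
Local Notation "x [/\] y" := (lmeet L x y) (at level 48, left associativity).
Local Notation labs := (labs L).

Fixpoint run_join (y : nat -> E) n p :=
  if p is p'.+1 then run_join y n p' [\/] y (n + p)%N else y n.

Lemma run_join_ge (y : nat -> E) n p i : (i <= p)%N -> y (n + i)%N [<=] run_join y n p.
Proof.
elim: p => [|p IH].
  by rewrite leqn0 => /eqP ->; rewrite addn0; exact: (lle_refl HL).
rewrite leq_eqVlt => /predU1P[->|]; first exact: ljoinr.
by rewrite ltnS => /IH h; apply: (lle_trans HL h); exact: ljoinl.
Qed.

Lemma run_join_le (y : nat -> E) n p u : (forall i, (i <= p)%N -> y (n + i)%N [<=] u) -> run_join y n p [<=] u.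
Proof.
elim: p => [|p IH] h /=; first by have := h 0%N (leqnn _); rewrite addn0.
by apply: ljoin_lub => //; [apply: IH => i ip; apply: h; exact: leqW|exact: h].
Qed.

Lemma run_join_shift (y : nat -> E) n p : run_join y n.+1 p [<=] run_join y n p.+1.
Proof. by apply: run_join_le => i ip; rewrite addSnnS; exact: run_join_ge. Qed.

Lemma half_pow_sum n p : \sum_(i < p) (2^-1 : R) ^+ (n + i) <= 2 * 2^-1 ^+ n.
Proof.
suff -> : \sum_(i < p) (2^-1 : R) ^+ (n + i) = 2 * 2^-1 ^+ n - 2 * 2^-1 ^+ (n + p).
  by have := half_pow_gt0 R (n + p); lra.
elim: p => [|p IH]; first by rewrite big_ord0 addn0 subrr.
by rewrite big_ord_recr/= IH addnS; have := half_powS R (n + p); lra.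
Qed.

(** A Borel-Cantelli argument: if [f (y n) <= 2^-n] but [g (y n) > r], the suprema of the tails of
    [y] decrease to some [W] with [f W = 0], whereas [g] stays above [r] along them. Order
    continuity of the norm supplies these suprema as norm limits. *)
Lemma abs_continuity f g u : order_continuous_norm L -> positive_dual L f -> positive_dual L g ->
  (forall y, 0 [<=] y -> f y = 0 -> g y = 0) -> 0 [<=] u ->
  forall r : R, 0 < r -> exists d : R, 0 < d /\
    forall y, 0 [<=] y -> y [<=] u -> f y <= d -> g y <= r.
Proof.
move=> ocn pf pg fg u0 r r0; apply: contrapT => h.
have /choice[y yP] : forall n, exists y, [/\ 0 [<=] y, y [<=] u, f y <= 2^-1 ^+ n & r < g y].
  move=> n; apply: contrapT => h'; apply: h; exists (2^-1 ^+ n).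
  split=> [|y y0 yu fy]; first exact: half_pow_gt0.
  by rewrite leNgt; apply/negP => gy; apply: h'; exists y.
have /choice[s sP] : forall n, exists s : E, run_join y n @ \oo --> s.
  move=> n; apply: (ocn _ u) => p; first exact: ljoinl.
  by apply: run_join_le => i _; have [] := yP (n + i)%N.
have s_ge n : y n [<=] s n.
  apply: (lge_lim HL (sP n)); exists 0%N => p _.
  by have := @run_join_ge y n p 0 (leq0n _); rewrite addn0.
have s0 n : 0 [<=] s n by have [y0 _ _ _] := yP n; exact: lle_trans y0 (s_ge n).
have s_dec n : s n.+1 [<=] s n.
  apply: (lle_lim HL (sP n.+1)); exists 0%N => p _; apply: (lge_lim HL (sP n)).
  exists p.+1 => p' pp'; apply: (lle_trans HL (run_join_shift y n p)).
  by apply: run_join_le => i ip; apply: run_join_ge; exact: leq_trans pp'.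
have fs n : f (s n) <= 2 * 2^-1 ^+ n.
  apply: le_trans (ler_norm _) _.
  apply: (@cvg_norm_le R R^o _ _ _ (dual_cvg pf.1 (sP n))); exists 0%N => p _.
  have J0 : 0 [<=] run_join y n p.
    by apply: (lle_trans HL _ (run_join_ge y n (leq0n p))); have [] := yP (n + 0)%N.
  rewrite ger0_norm; last exact: pf.2.
  have yS : run_join y n p [<=] \sum_(i < p.+1) y (n + i)%N.
    apply: run_join_le => i ip; apply: (@lsum_ge_term _ _ _ HL p.+1 (fun i => y (n + i)%N)) => // j.
    by have [] := yP (n + j)%N.
  apply: le_trans (pdual_mono HL pf yS) _; rewrite (dual_sum pf.1).
  apply: le_trans (half_pow_sum n p.+1); apply: ler_sum => i _.
  by have [] := yP (n + i)%N.
have [W sW] := decreasing_cvg HL ocn s_dec s0.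
have W0 : 0 [<=] W by apply: (lge_lim HL sW); exists 0%N.
have fW : f W = 0.
  apply/eqP; rewrite -normr_le0; apply/ler_addgt0Pr => d d0; rewrite add0r.
  have [N hN] := half_pow_small 2 d0.
  apply: (@cvg_norm_le R R^o _ _ _ (dual_cvg pf.1 sW)); exists N => n Nn.
  by rewrite ger0_norm ?pf.2//; exact: le_trans (fs n) (hN n Nn).
have gs := dual_cvg pg.1 sW; rewrite (fg _ W0 fW) in gs.
have /cvg0_eps/(_ _ r0)[N hN] := gs.
have := hN N (leqnn _); have [_ _ _] := yP N; have := pdual_mono HL pg (s_ge N).
by have := ler_norm (g (s N)); lra.
Qed.

(** The limit [v] is the lower limit of [p]: the infima [- s n] of its tails increase and are
    bounded, hence converge. Since [f (p n + s n) <= 2 * 2^-n], the modulus of [h] is small on the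
    part of [p n + s n] below [k *: e] by [abs_continuity], and on the rest by the truncation
    hypothesis. *)
Lemma functional_limit f (p : nat -> E) K e : order_continuous_norm L -> bounded_increasing_cvg L ->
  positive_dual L f -> 0 [<=] e -> (forall n, 0 [<=] p n) -> (forall n, `|p n| <= K) ->
  (forall n, f (labs (p n.+1 - p n)) <= 2^-1 ^+ n) ->
  (forall g, positive_dual L g -> forall r : R, 0 < r ->
     exists k : nat, forall n, g ((p n - k%:R *: e) [\/] 0) <= r) ->
  exists v, forall h, is_dual h -> (forall s, f (labs s) = 0 -> h s = 0) ->
    (fun n => h (p n)) @ \oo --> h v.
Proof.
move=> ocn KB pf e0 p0 pK fp ptrunc.
pose q n := - p n.
have /choice[s sP] : forall n, exists s : E, run_join q n @ \oo --> s.
  move=> n; apply: (ocn _ 0) => r; first exact: ljoinl.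
  by apply: run_join_le => i _; rewrite -[0]oppr0; exact: lle_opp.
have s_ge n : q n [<=] s n.
  apply: (lge_lim HL (sP n)); exists 0%N => r _.
  by have := @run_join_ge q n r 0 (leq0n _); rewrite addn0.
have s_le0 n : s n [<=] 0.
  apply: (lle_lim HL (sP n)); exists 0%N => r _.
  by apply: run_join_le => i _; rewrite -[0]oppr0; exact: lle_opp.
have s_dec n : s n.+1 [<=] s n.
  apply: (lle_lim HL (sP n.+1)); exists 0%N => r _; apply: (lge_lim HL (sP n)).
  exists r.+1 => r' rr'; apply: (lle_trans HL (run_join_shift q n r)).
  by apply: run_join_le => i ir; apply: run_join_ge; exact: leq_trans rr'.
have qT n r i : (i <= r)%N ->
    q (n + i)%N [<=] q n + \sum_(j < r) labs (p (n + j).+1 - p (n + j)%N).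
  elim: r i => [|r IH] i.
    by rewrite leqn0 => /eqP ->; rewrite big_ord0 addr0 addn0; exact: (lle_refl HL).
  rewrite leq_eqVlt big_ord_recr/= addrA => /predU1P[->|].
    rewrite addnS; have := IH r (leqnn _); rewrite /q.
    by move: (\sum_(j < r) _) (p (n + r).+1) (p (n + r)%N) => a b c; lattice.
  by rewrite ltnS => /IH h; apply: (lle_trans HL h); apply: lle_addl => //; exact: labs_ge0.
have fs n : f (p n + s n) <= 2 * 2^-1 ^+ n.
  apply: le_trans (ler_norm _) _.
  have cv : (fun r => f (run_join q n r + p n)) @ \oo --> f (p n + s n).
    by rewrite addrC; apply: (dual_cvg pf.1); apply: cvgD => //; exact: cvg_cst.
  apply: (@cvg_norm_le R R^o _ _ _ cv); exists 0%N => r _.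
  have J0 : 0 [<=] run_join q n r + p n.
    by have := @run_join_ge q n r 0 (leq0n _); rewrite addn0 /q; lattice.
  rewrite ger0_norm; last exact: pf.2.
  have /(lle_addr HL (p n)) := run_join_le (@qT n r).
  rewrite addrAC /q addNr add0r => /(pdual_mono HL pf) h; apply: le_trans h _.
  rewrite (dual_sum pf.1) => //; apply: le_trans (half_pow_sum n r); apply: ler_sum => i _.
  exact: fp.
have [v sv] : exists v : E, (fun n => - s n) @ \oo --> v.
  apply: (KB _ K) => n; first exact: lle_opp.
  apply: le_trans (pK n); apply: (lnorm_le_pos HL).
    by rewrite -oppr0; exact: lle_opp.
  by have := s_ge n; rewrite /q; lattice.
exists v => h Dh fh.
have [g [pg hg _ g_small]] := functional_modulus HL Dh (dual_norm_ge0 Dh) (dual_normP Dh).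
have gf y : 0 [<=] y -> f y = 0 -> g y = 0.
  move=> y0 fy; apply/eqP; rewrite eq_le pg.2// andbT; apply: g_small => // z zy.
  rewrite fh//; apply/eqP; rewrite eq_le pf.2 ?andbT; last exact: labs_ge0.
  by rewrite -fy; exact: (pdual_mono HL pf).
apply/(@cvg_seqP R R^o) => r r0; have r3 : 0 < r / 3 by rewrite divr_gt0.
have [k hk] := ptrunc g pg _ r3.
have ke0 : 0 [<=] k%:R *: e by exact: lscale_ge0.
have [d [d0 hd]] := abs_continuity ocn pf pg gf ke0 r3.
have [N hN] := half_pow_small 2 d0.
have /(@cvg_seqP R R^o)/(_ _ r3)[N' hN'] := dual_cvg Dh sv.
exists (maxn N N') => n; rewrite geq_max => /andP[Nn N'n].
have a0 : 0 [<=] p n + s n by have := s_ge n; rewrite /q; lattice.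
have h1 : `|h (p n + s n)| <= r / 3 + r / 3.
  apply: le_trans (hg _) _; rewrite (labs_pos HL a0).
  have : p n + s n [<=] (p n + s n) [/\] (k%:R *: e) + ((p n - k%:R *: e) [\/] 0).
    by have := s_le0 n; move: (_ *: _) => u; lattice.
  move=> /(pdual_mono HL pg) h1; apply: le_trans h1 _; rewrite (dualD pg.1) lerD//.
  apply: hd; [exact: lmeet_glb|exact: lmeetr|].
  by apply: le_trans (hN n Nn); apply: le_trans (fs n); apply: (pdual_mono HL pf); exact: lmeetl.
have := hN' n N'n; have -> : h (p n) = h (p n + s n) + h (- s n) by rewrite -(dualD Dh) addrK.
move: h1; rewrite !ler_norml => /andP[h1 h2] /andP[h3 h4]; apply/andP; split; lra.
Qed.

End convergence_for_a_functional.

(** * A strictly convex functional *)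

Section barrier.
Variable R : realType.
Implicit Types (a d s t : R).

(** Even, convex and infinite at 1 and -1. Where [z] is at most a multiple of [e], the blow-up keeps
    the relevant slopes [t] at a distance from the ends, and there the second differences are
    controlled. *)
Definition barrier t : R := (1 - t)^-1 + (1 + t)^-1.

Lemma barrier_ge0 t : `|t| < 1 -> 0 <= barrier t.
Proof. by rewrite ltr_norml => /andP[t1 t2]; rewrite addr_ge0// invr_ge0; lra. Qed.

Lemma barrierN t : barrier (- t) = barrier t.
Proof. by rewrite /barrier opprK addrC. Qed.

Lemma inv_second_difference a d s : 0 < d -> d <= a -> 0 <= s -> s <= d / 2 ->
  (a - s)^-1 + (a + s)^-1 <= 2 * a^-1 + 3 * d^-1 ^+ 3 * s ^+ 2.
Proof.
move=> d0 da s0 sd; have a0 : 0 < a by lra.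
have as0 : 0 < a - s by lra.
have as1 : 0 < a + s by lra.
have -> : (a - s)^-1 + (a + s)^-1 = 2 * a^-1 + 2 * (a * ((a - s) * (a + s)))^-1 * s ^+ 2.
  by field; rewrite !gt_eqF.
rewrite lerD2l; apply: ler_wpM2r; first exact: sqr_ge0.
(* The factor 3/4 is also valid; 2/3 turns the final constant into 3. *)
have h : 2 / 3 * d ^+ 3 <= a * ((a - s) * (a + s)).
  have h1 : 3 / 4 * d ^+ 2 <= (a - s) * (a + s) by nra.
  have h2 : 0 <= d ^+ 2 by exact: sqr_ge0.
  by rewrite exprS; nra.
have d3 : 0 < d ^+ 3 by rewrite exprn_gt0.
have -> : 3 * d^-1 ^+ 3 = 2 * (2 / 3 * d ^+ 3)^-1 by field; rewrite gt_eqF.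
by rewrite ler_pM2l// lef_pV2// posrE ?mulr_gt0// ?invr_gt0.
Qed.

Lemma barrier_second_difference d t s : 0 < d -> `|t| <= 1 - d -> 0 <= s -> s <= d / 2 ->
  barrier (t + s) + barrier (t - s) <= 2 * barrier t + 6 * d^-1 ^+ 3 * s ^+ 2.
Proof.
move=> d0; rewrite ler_norml => /andP[t1 t2] s0 sd.
have h1 : d <= 1 - t by lra.
have h2 : d <= 1 + t by lra.
have := inv_second_difference d0 h1 s0 sd; have := inv_second_difference d0 h2 s0 sd.
rewrite /barrier !opprD !addrA !opprK; lra.
Qed.

(** By convexity: the derivative at [1 - d] is [d^-2 - (2 - d)^-2], which is at least [d^-2 - 1]. *)
Lemma barrier_slope d t : 0 < d -> d <= 1 -> 1 - d <= t -> t < 1 ->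
  (d^-1 ^+ 2 - 1) * (t - (1 - d)) <= barrier t - barrier (1 - d).
Proof.
move=> d0 d1 dt t1; rewrite /barrier subKr.
have h1 : (1 - t)^-1 - d^-1 - d^-1 ^+ 2 * (t - (1 - d)) =
    (t - (1 - d)) ^+ 2 * (1 - t)^-1 * d^-1 ^+ 2 by field; rewrite gt_eqF// gt_eqF// subr_gt0.
have h2 : 0 <= (t - (1 - d)) ^+ 2 * (1 - t)^-1 * d^-1 ^+ 2.
  apply: mulr_ge0; last exact: sqr_ge0.
  by apply: mulr_ge0; [exact: sqr_ge0|rewrite invr_ge0; lra].
have a0 : 0 < 1 + t by lra.
have b0 : 0 < 1 + (1 - d) by lra.
have h3 : (1 + t)^-1 - (1 + (1 - d))^-1 + (t - (1 - d)) =
    (t - (1 - d)) * (1 - (1 + t)^-1 * (1 + (1 - d))^-1) by field; rewrite !gt_eqF.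
have h4 : (1 + t)^-1 * (1 + (1 - d))^-1 <= 1.
  by rewrite -invfM invf_le1 ?mulr_gt0//; nra.
have : 0 <= (t - (1 - d)) * (1 - (1 + t)^-1 * (1 + (1 - d))^-1).
  by rewrite mulr_ge0// subr_ge0.
rewrite -h3; move: h2; rewrite -h1; lra.
Qed.

End barrier.

Section strictly_convex_functional.
Variables (R : realType) (E : completeNormedModType R) (L : lattice_ops E).
Hypothesis HL : is_banach_lattice L.
Implicit Types (x y z w u e : E) (f g : E -> R).

Local Notation "x [<=] y" := (lle L x y) (at level 70, no associativity).
Local Notation "x [\/] y" := (ljoin L x y) (at level 50, left associativity).
Local Notation "x [/\] y" := (lmeet L x y) (at level 48, left associativity).
Local Notation labs := (labs L).

(** Rational slopes form a countable set, so the supremum defining the transform exists by Dedekind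
    sigma-completeness. *)
Definition slope (t : R) := (exists a : rat, t = ratr a) /\ `|t| < 1.

Lemma slope_add t s : slope t -> slope s -> `|t + s| < 1 -> slope (t + s).
Proof. by move=> [[a ->] _] [[b ->] _]; split=> //; exists (a + b); rewrite rmorphD. Qed.

Lemma slopeN t : slope t -> slope (- t).
Proof. by move=> [[a ->] t1]; rewrite -rmorphN; split; [exists (- a)|rewrite rmorphN normrN]. Qed.

Lemma slope_inv n : slope (n.+2%:R^-1).
Proof.
split; first by exists (n.+2%:R^-1); rewrite fmorphV rmorph_nat.
by rewrite gtr0_norm ?invr_gt0// invf_lt1// ltr1n.
Qed.

Lemma slope_1sub n : slope (1 - n.+2%:R^-1).
Proof.
have [[a aE] h] := slope_inv n; rewrite gtr0_norm ?invr_gt0// in h.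
split; first by exists (1 - a); rewrite aE raddfB/= rmorph1.
have : 0 < n.+2%:R^-1 :> R by rewrite invr_gt0.
move: h; move: (_^-1) => v v1 v0; rewrite ger0_norm; lra.
Qed.

(* The Legendre transform of the barrier, computed in the lattice: strictly
   convex in [z / e], but of linear growth. *)
Lemma legendre_transform e : dedekind_sigma_complete L -> 0 [<=] e -> exists q : E -> E,
  (forall z t, slope t -> (2 * t) *: z - barrier t *: e [<=] q z) /\
  (forall z u, (forall t, slope t -> (2 * t) *: z - barrier t *: e [<=] u) -> q z [<=] u).
Proof.
move=> Hsigma e0.
pose T (j : nat) : R := if pselect (slope (ratr (odflt 0 (unpickle j : option rat)))) then
  ratr (odflt 0 (unpickle j : option rat)) else 0.
have s0 : slope 0 by split; [exists 0; rewrite rmorph0|rewrite normr0].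
have TP j : slope (T j) by rewrite /T; case: pselect.
have TE t : slope t -> exists j, t = T j.
  by move=> st; have [[a aE] _] := st; exists (pickle a); rewrite /T pickleK/= -aE; case: pselect.
have /choice[q qP] z : exists q, (forall j, (2 * T j) *: z - barrier (T j) *: e [<=] q) /\
    (forall u, (forall j, (2 * T j) *: z - barrier (T j) *: e [<=] u) -> q [<=] u).
  apply: (Hsigma (fun j => (2 * T j) *: z - barrier (T j) *: e)).
  exists (2 *: labs z) => j; have [_ t1] := TP j.
  have : labs ((2 * T j) *: z) [<=] 2 *: labs z.
    rewrite (labs_scale HL); apply: (lscale_mono HL); last exact: labs_ge0.
    by rewrite normrM (ger0_norm (ler0n _ 2)); lra.
  have : 0 [<=] barrier (T j) *: e by apply: lscale_ge0 => //; exact: barrier_ge0.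
  by move: (_ *: e) ((2 * T j) *: z) => a b; lattice.
exists q; split=> [z t /TE[j ->]|z u uP]; first exact: (qP z).1.
by apply: (qP z).2 => j; exact: uP.
Qed.

Section midpoint.
Variables (e : E) (q : E -> E).
Hypotheses (e0 : 0 [<=] e)
  (q_ge : forall z t, slope t -> (2 * t) *: z - barrier t *: e [<=] q z)
  (q_least : forall z u, (forall t, slope t -> (2 * t) *: z - barrier t *: e [<=] u) -> q z [<=] u).

Lemma legendre_bounds z : - (2 *: e) [<=] q z /\ q z [<=] 2 *: labs z.
Proof.
split.
  have := @q_ge z 0; rewrite mulr0 scale0r add0r /barrier subr0 addr0 invr1; apply.
  by split; [exists 0; rewrite rmorph0|rewrite normr0].
apply: q_least => t [_ t1].
have : labs ((2 * t) *: z) [<=] 2 *: labs z.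
  rewrite (labs_scale HL); apply: (lscale_mono HL); last exact: labs_ge0.
  by rewrite normrM (ger0_norm (ler0n _ 2)); lra.
have : 0 [<=] barrier t *: e by apply: lscale_ge0 => //; exact: barrier_ge0.
by move: (_ *: e) ((2 * t) *: z) => a b; lattice.
Qed.

Lemma legendre_convex z w : 2 *: q (2^-1 *: (z + w)) [<=] q z + q w.
Proof.
have : q (2^-1 *: (z + w)) [<=] 2^-1 *: (q z + q w).
  apply: q_least => t st; have := q_ge z st; have := q_ge w st.
  rewrite scalerA mulrAC divff// mul1r scalerDr -!scalerA.
  by move: (t *: z) (t *: w) (_ *: e) => a b c; lattice.
by lattice.
Qed.

(** Testing [z] with slope [t + s] and [w] with [t - s] leaves the surplus [(2 * s) *: (z - w)] over
    the common slope [t], at the price of a second difference of the barrier. *)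
Lemma legendre_two_slopes z w t s : slope (t + s) -> slope (t - s) ->
  2 *: ((2 * t) *: (2^-1 *: (z + w))) + (2 * s) *: (z - w) -
    (barrier (t + s) + barrier (t - s)) *: e [<=] q z + q w.
Proof.
move=> sp sm; have := q_ge z sp; have := q_ge w sm.
have mE : t *: (2^-1 *: (z + w)) = 2^-1 *: (t *: z + t *: w).
  by rewrite scalerA mulrC -scalerA scalerDr.
rewrite -!(scalerA 2) mE [s *: _]scalerBr [(t + s) *: _]scalerDl
  [(t - s) *: _]scalerDl [(_ + barrier _) *: _]scalerDl scaleNr.
move: (t *: z) (t *: w) (s *: z) (s *: w) (barrier (t + s) *: e) (barrier (t - s) *: e).
by move=> a b a' b' c c'; lattice.
Qed.

(** A quantitative strict convexity. Slopes of size at most [1 - d] are perturbed by [s] and by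
    [- s]. A steeper slope is replaced by [1 - d] of the same sign: with [d^-1 = k + 2] the barrier
    grows there at rate at least [d^-2 - 1 >= 2 (k + 1)], so this costs at most twice the excess of
    [labs m] over [k.+1%:R *: e]. *)
Lemma legendre_gap z w k (s : R) : let d := k.+2%:R^-1 in let m := 2^-1 *: (z + w) in
  slope s -> 0 <= s -> s <= d / 2 ->
  (2 * s) *: labs (z - w) + 2 *: q m [<=]
  q z + q w + (6 * d^-1 ^+ 3 * s ^+ 2) *: e + 4 *: ((labs m - k.+1%:R *: e) [\/] 0).
Proof.
move=> d m ss s0 sd; set M := 6 * _ * _.
have d0 : 0 < d by rewrite invr_gt0.
have d1 : d <= 1 by rewrite invf_le1// ler1n.
have core t : slope t -> `|t| <= 1 - d ->
    (2 * s) *: labs (z - w) + 2 *: ((2 * t) *: m - barrier t *: e) [<=] q z + q w + M *: e.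
  move=> st td.
  have sp : slope (t + s).
    apply: slope_add => //; apply: le_lt_trans (ler_normD _ _) _.
    by rewrite (ger0_norm s0); lra.
  have sm : slope (t - s).
    apply: slope_add => //; first exact: slopeN.
    by apply: le_lt_trans (ler_normB _ _) _; rewrite (ger0_norm s0); lra.
  have h1 := legendre_two_slopes z w sp sm.
  have h2 := @legendre_two_slopes z w t (- s); rewrite opprK in h2; have {}h2 := h2 sm sp.
  have h3 : (barrier (t + s) + barrier (t - s)) *: e [<=] (2 * barrier t) *: e + M *: e.
    rewrite -scalerDl; apply: (lscale_mono HL) => //.
    exact: barrier_second_difference.
  have h4 : (2 * s) *: labs (z - w) = labs ((2 * s) *: (z - w)).
    by rewrite (labs_scale HL) ger0_norm// mulr_ge0.
  rewrite h4; move: h1 h2 h3; rewrite mulrN scaleNr [barrier (t - s) + _]addrC -/m -!(scalerA 2).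
  move: (((_ : R) + _) *: e) (M *: e) (s *: (z - w)) (t *: m) (barrier t *: e).
  by move=> a b c c' d'; lattice.
pose P := (labs m - k.+1%:R *: e) [\/] 0.
have P0 : 0 [<=] P by exact: ljoinr.
have tail t u : u [<=] labs m -> 1 - d <= t -> t < 1 ->
    (2 * t) *: u - barrier t *: e [<=]
    (2 * (1 - d)) *: u - barrier (1 - d) *: e + 2 *: P.
  move=> um dt t1.
  have h1 : (2 * (t - (1 - d)) * k.+1%:R) *: e [<=] (barrier t - barrier (1 - d)) *: e.
    apply: (lscale_mono HL) => //; apply: le_trans (barrier_slope d0 d1 dt t1).
    rewrite mulrAC ler_wpM2r ?subr_ge0// /d invrK.
    have := ler0n R k; rewrite -[k.+2%:R]natr1 -[k.+1%:R]natr1; nra.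
  have h2 : (2 * (t - (1 - d))) *: P [<=] 2 *: P by apply: (lscale_mono HL) => //; lra.
  have h3 : (2 * (t - (1 - d))) *: (u - k.+1%:R *: e) [<=] (2 * (t - (1 - d))) *: P.
    apply: lle_scale => //; first lra.
    by rewrite /P; move: um; move: (_ *: e) => v; lattice.
  have tE : (2 * t) *: u = (2 * (1 - d)) *: u + (2 * (t - (1 - d))) *: u.
    by rewrite -scalerDl; congr (_ *: _); ring.
  move: h1 h2 h3; rewrite tE [_ *: (u - _)]scalerBr [_ *: (_ *: e)]scalerA [_ *: e in X in _ [<=] X -> _]scalerBl.
  move: (_ *: P) (_ *: e) (_ *: e) (_ *: e) (_ *: u) (_ *: u) => a b c c' a' b'; lattice.
have mh : 2 *: q m [<=] q z + q w + M *: e + 4 *: P - (2 * s) *: labs (z - w).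
  have : q m [<=] 2^-1 *: (q z + q w + M *: e + 4 *: P - (2 * s) *: labs (z - w)).
    apply: q_least => t st.
    have [td|] := leP `|t| (1 - d).
      by move: (core t st td) P0; move: (_ *: labs _) (M *: e) (_ *: m - _) => a b c; lattice.
    have tau0 : 0 <= 1 - d by rewrite subr_ge0.
    have st1 : slope (1 - d) by exact: slope_1sub.
    have t1 := st.2.
    case: (ger0P t) => [t0 td|t0 td].
      have := tail t m (labs_ge HL m) (ltW td); rewrite ger0_norm// in t1 => /(_ t1).
      have := core (1 - d) st1; rewrite ger0_norm// => /(_ (lexx _)).
      move: (_ *: labs _) (M *: e) (_ *: m - _) (_ *: m - _) => a b c c'; lattice.
    have := tail (- t) (- m) (labs_geN HL m) (ltW td); rewrite ltr0_norm// in t1 => /(_ t1).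
    have := core (- (1 - d)) (slopeN st1); rewrite normrN ger0_norm// => /(_ (lexx _)).
    rewrite !barrierN !mulrN !scaleNr !scalerN !opprK.
    move: (_ *: labs _) (M *: e) (_ *: m) (_ *: m) (_ *: e) (_ *: e) => a b c c' a' b'; lattice.
  by move: (_ *: labs _) (M *: e) => a b; lattice.
by move: mh; rewrite -/P; move: (_ *: labs _) (M *: e) => a b; lattice.
Qed.

End midpoint.
(** [G] is [f] composed with the Legendre transform, and the constant [2 * f e] offsets its lower
    bound. After division of [legendre_gap] by [2 * s], a defect of at most [s * r] contributes at
    most [r / 2], and so does the term quadratic in [s]. *)
Lemma strictly_convex_functional f e : dedekind_sigma_complete L -> positive_dual L f ->
  0 [<=] e -> exists G : E -> R, (forall z, 0 <= G z <= 2 * f (labs z) + 2 * f e) /\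
  forall (k : nat) (r : R), 0 < r -> exists d : R, 0 < d /\
    forall z w, G z + G w - 2 * G (2^-1 *: (z + w)) <= d ->
      f (labs (z - w) [/\] e) <= r + f ((labs (2^-1 *: (z + w)) - k%:R *: e) [\/] 0).
Proof.
move=> Hsigma pf e0; have [q [q_ge q_least]] := legendre_transform Hsigma e0.
have fe0 := pf.2 _ e0.
exists (fun z => f (q z) + 2 * f e); split=> [z|k r r0].
  have [/(pdual_mono HL pf) h1 /(pdual_mono HL pf) h2] := legendre_bounds e0 q_ge q_least z.
  by move: h1 h2; rewrite (dualN pf.1) !(dualZ pf.1) => h1 h2; apply/andP; split; lra.
pose d : R := k.+2%:R^-1; pose M := 6 * d^-1 ^+ 3.
have d0 : 0 < d by rewrite invr_gt0.
have M0 : 0 < M by rewrite mulr_gt0// exprn_gt0// invr_gt0.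
(* [s = 1 / (l + 2)] is a slope: the first bound is what [legendre_gap] asks of [s], the second
   makes [M * s / 2 * f e] at most [r / 2]. *)
have [l [l1 l2]] : exists l : nat, l.+2%:R^-1 <= d / 2 /\ M * f e * l.+2%:R^-1 <= r.
  have C0 : 0 <= M * f e / r.
    by apply: divr_ge0; [apply: mulr_ge0 => //; exact: ltW|exact: ltW].
  exists (k.+2 * 2 + Num.bound (M * f e / r))%N; split.
    by rewrite /d -invfM -natrM lef_pV2 ?posrE// ler_nat; do 2 apply: leqW; exact: leq_addr.
  rewrite ler_pdivrMr// -ler_pdivrMl// [r^-1 * _]mulrC; apply: le_trans (ltW (archi_boundP C0)) _.
  by rewrite ler_nat; do 2 apply: leqW; exact: leq_addl.
pose s : R := l.+2%:R^-1; have s0 : 0 < s by rewrite invr_gt0.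
exists (s * r); split=> [|z w]; first exact: mulr_gt0.
set m := 2^-1 *: (z + w) => h.
pose D := q z + q w - 2 *: q m.
have D0 : 0 [<=] D.
  by have := legendre_convex q_ge q_least z w; rewrite /D -/m; lattice.
have fD : f D <= s * r.
  apply: le_trans h; rewrite /D (dualB pf.1) (dualD pf.1) (dualZ pf.1); lra.
pose p := labs m - k.+1%:R *: e.
pose Y := (2 * s)^-1 *: D + (M * s / 2) *: e.
have Y0 : 0 [<=] Y.
  apply: ladd_ge0 => //; apply: lscale_ge0 => //; first by rewrite invr_ge0 mulr_ge0// ltW.
  by apply: mulr_ge0; rewrite ?invr_ge0//; apply: mulr_ge0; exact: ltW.
have XY : labs (z - w) [<=] Y + (2 / s) *: (p [\/] 0).
  have g := legendre_gap e0 q_ge q_least z w (slope_inv l) (ltW s0) l1.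
  have : (2 * s) *: labs (z - w) [<=] D + (M * s ^+ 2) *: e + 4 *: (p [\/] 0).
    move: g; rewrite -/d -/M -/s -/m -/p /D.
    by move: (_ *: labs _) (_ *: e) => a b; lattice.
  have s2 : 0 <= (2 * s)^-1 by rewrite invr_ge0 mulr_ge0// ltW.
  move=> /(lle_scale HL s2); rewrite scalerA mulVf ?mulf_neq0 ?gt_eqF// scale1r.
  rewrite [_ *: (D + _ + _)]scalerDr [_ *: (D + _)]scalerDr !(scalerA (2 * s)^-1).
  have -> : (2 * s)^-1 * (M * s ^+ 2) = M * s / 2 by field; rewrite gt_eqF.
  by have -> : (2 * s)^-1 * 4 = 2 / s by (field; rewrite gt_eqF).
(* The large factor [2 / s] disappears after the meet with [e]: where [p] is positive, [e] is below
   [p + e = labs m - k%:R *: e], and elsewhere the term is zero. This is why [p] is cut at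
   [k.+1]. *)
have pp : ((2 / s) *: (p [\/] 0)) [/\] ((- p) [\/] 0) [<=] 0.
  apply: meet_scale0 => //; first by rewrite divr_ge0// ltW.
  - exact: ljoinr.
  - exact: ljoinr.
  - by lattice.
have : labs (z - w) [/\] e [<=] Y + ((labs m - k%:R *: e) [\/] 0).
  have -> : labs m - k%:R *: e = p + e.
    by rewrite /p -addrA -natr1 scalerDl scale1r opprD addrNK.
  by clearbody Y p; move: XY pp Y0 e0; move: (_ *: (p [\/] 0)) (labs (z - w)) => v X; lattice.
move=> /(pdual_mono HL pf); rewrite (dualD pf.1) /Y (dualD pf.1) !(dualZ pf.1) => h1.
apply: le_trans h1 _; rewrite lerD2r.
have h2 : (2 * s)^-1 * f D <= r / 2.
  rewrite -[leRHS](mulKf (_ : 2 * s != 0)) ?mulf_neq0 ?gt_eqF// ler_wpM2l//.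
    by rewrite invr_ge0 mulr_ge0// ltW.
  lra.
have : M * s / 2 * f e = M * f e * s / 2 by ring.
by move: l2; rewrite -/s; lra.
Qed.

End strictly_convex_functional.

(** * Reflexivity *)

Section reflexivity.
Variables (R : realType) (E : completeNormedModType R) (L : lattice_ops E).
Hypothesis HL : is_banach_lattice L.
Implicit Types (y z w u e : E) (f g : E -> R) (x : nat -> E).

Local Notation "x [<=] y" := (lle L x y) (at level 70, no associativity).
Local Notation "x [\/] y" := (ljoin L x y) (at level 50, left associativity).
Local Notation "x [/\] y" := (lmeet L x y) (at level 48, left associativity).
Local Notation labs := (labs L).

(** Convex combinations of the tail from [n] with dyadic coefficients; the convexity estimate
    involves midpoints only. *)
Inductive midpoints x n : E -> Prop :=
| midpoint_term m : (n <= m)%N -> midpoints x n (x m)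
| midpoint_half z w : midpoints x n z -> midpoints x n w -> midpoints x n (2^-1 *: (z + w)).

Lemma midpoints_sub x n m z : (n <= m)%N -> midpoints x m z -> midpoints x n z.
Proof.
move=> nm; elim=> [j mj|w w' _ IH _ IH']; last exact: midpoint_half.
by apply: midpoint_term; exact: leq_trans mj.
Qed.

Lemma midpoints_norm x K n z : (forall n, `|x n| <= K) -> midpoints x n z -> `|z| <= K.
Proof.
move=> xK; elim=> [m _|w w' _ wK _ w'K]; first exact: xK.
rewrite normrZ ger0_norm ?invr_ge0//; have := ler_normD w w'; lra.
Qed.

Lemma midpoints_truncation x f e (r : R) n z : positive_dual L f ->
  (forall n, f ((labs (x n) - e) [\/] 0) <= r) -> midpoints x n z -> f ((labs z - e) [\/] 0) <= r.
Proof.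
move=> pf xr; elim=> [m _|w w' _ wr _ w'r]; first exact: xr.
have : (labs (2^-1 *: (w + w')) - e) [\/] 0 [<=]
    2^-1 *: (((labs w - e) [\/] 0) + ((labs w' - e) [\/] 0)).
  have : labs (2^-1 *: (w + w')) [<=] 2^-1 *: (labs w + labs w') by lattice.
  by move: (labs _) (labs w) (labs w') => a b c; lattice.
move=> /(pdual_mono HL pf); rewrite (dualZ pf.1) (dualD pf.1); lra.
Qed.

(** [z n] minimises [G] up to [2^-n] over the midpoints of the tail from [n]. The infima [I n]
    increase and are bounded, and [G] is at least [I n] at the midpoint of [z n] and [z m], so the
    defect tends to zero. *)
Lemma midpoints_cauchy x f e K : dedekind_sigma_complete L -> positive_dual L f -> 0 [<=] e ->
  (forall n, `|x n| <= K) ->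
  (forall r : R, 0 < r -> exists k : nat, forall n, f ((labs (x n) - k%:R *: e) [\/] 0) <= r) ->
  exists z : nat -> E, (forall n, midpoints x n (z n)) /\
    forall r : R, 0 < r -> exists N, forall n m, (N <= n)%N -> (n <= m)%N ->
      f (labs (z m - z n)) <= r.
Proof.
move=> Hsigma pf e0 xK xtrunc.
have [G [G0 Gconv]] := strictly_convex_functional HL Hsigma pf e0.
pose V n : set R := [set G z | z in [set z | midpoints x n z]].
have x_mid n : midpoints x n (x n) by exact: midpoint_term.
have Vinf n : has_inf (V n).
  by split; [exists (G (x n)), (x n)|exists 0 => _ [z _ <-]; have /andP[] := G0 z].
pose I n := inf (V n).
have I_le n z : midpoints x n z -> I n <= G z by move=> h; apply: (ge_inf (Vinf n).2); exists z.
have /choice[z zP] n : exists z, midpoints x n z /\ G z <= I n + 2^-1 ^+ n.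
  have [_ [z mz <-] h] := inf_adherent (half_pow_gt0 R n) (Vinf n).
  by exists z; split=> //; exact: ltW.
exists z; split=> [n|r r0]; first exact: (zP n).1.
have I_inc n : I n <= I n.+1.
  apply: (lb_le_inf (Vinf n.+1).1) => _ [w mw <-]; apply: I_le.
  exact: midpoints_sub mw.
have I_bd n : I n <= 2 * (dual_norm f * K) + 2 * f e.
  apply: le_trans (I_le n _ (x_mid n)) _; have /andP[_ h] := G0 (x n); apply: le_trans h _.
  rewrite lerD2r ler_pM2l//; apply: le_trans (pdual_le_norm pf _) _.
  by rewrite (lnorm_abs HL) ler_wpM2l// dual_norm_ge0//; exact: pf.1.
have small r' : 0 < r' -> exists N, forall n m, (N <= n)%N -> (n <= m)%N ->
    f (labs (z m - z n) [/\] e) <= r'.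
  move=> r'0; have r2 : 0 < r' / 2 by rewrite divr_gt0.
  have [k hk] := xtrunc _ r2; have [d [d0 hd]] := Gconv k _ r2.
  have d3 : 0 < d / 3 by rewrite divr_gt0.
  have [N hN] := increasing_bounded_cauchy I_inc I_bd d3.
  have [N' hN'] := half_pow_small 1 d3.
  exists (maxn N N') => n m; rewrite geq_max => /andP[Nn N'n] nm.
  have mz : midpoints x n (z m) := midpoints_sub nm (zP m).1.
  have mid := midpoint_half mz (zP n).1.
  have := hd (z m) (z n); have := midpoints_truncation pf hk mid.
  have := I_le n _ mid; have := (zP n).2; have := (zP m).2; have := hN n m Nn nm.
  have := hN' n N'n; have := hN' m (leq_trans N'n nm); rewrite !mul1r.
  move=> h1 h2 h3 h4 h5 h6 h7 h8; have := h8 _; lra.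
have r3 : 0 < r / 3 by rewrite divr_gt0.
have [k hk] := xtrunc _ r3.
have k0 : 0 < (2 * k%:R + 1 : R) by rewrite ltr_wpDl// mulr_ge0.
have [N hN] := small _ (divr_gt0 r3 k0).
exists N => n m Nn nm; have {hN} := hN n m Nn nm.
have := midpoints_truncation pf hk (zP n).1; have := midpoints_truncation pf hk (zP m).1.
(* Where [labs (z m - z n)] exceeds [e], it is at most [labs (z m) + labs (z n)], that is [2 * k]
   times [e] plus the two truncation excesses. *)
have : labs (z m - z n) [<=] (2 * k%:R + 1) *: (labs (z m - z n) [/\] e) +
    (((labs (z m) - k%:R *: e) [\/] 0) + ((labs (z n) - k%:R *: e) [\/] 0)).
  rewrite lmeet_scale//.
  have : (2 * k%:R + 1) *: e = 2 *: (k%:R *: e) + e by rewrite scalerDl scale1r scalerA.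
  have : labs (z m - z n) [<=] (2 * k%:R + 1) *: labs (z m - z n).
    rewrite -[X in X [<=] _]scale1r; apply: (lscale_mono HL); last exact: labs_ge0.
    by rewrite lerDr mulr_ge0.
  have : labs (z m - z n) [<=] labs (z m) + labs (z n) by lattice.
  move: e0; move: ((2 * _ + _) *: labs _) ((2 * _ + _) *: e) (k%:R *: e).
  move: (labs (z m - z n)) (labs (z m)) (labs (z n)) => c a b X e' e''.
  by move=> e0 h h' ->; move: e0 h h'; lattice.
move=> /(pdual_mono HL pf); rewrite !(dualD pf.1) (dualZ pf.1).
move=> h1 h2 h3 h4; apply: le_trans h1 _.
have := ler_wpM2l (ltW k0) h4; rewrite mulrCA divff ?gt_eqF// mulr1; lra.
Qed.

Lemma midpoints_ge x f (c : R) n z : is_dual f -> (forall m, (n <= m)%N -> c <= f (x m)) ->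
  midpoints x n z -> c <= f z.
Proof.
move=> Df fx; elim=> [m /fx//|w w' _ wc _ w'c].
by rewrite (dualZ Df) (dualD Df); lra.
Qed.

Lemma order_continuous_norms_reflexive : dedekind_sigma_complete L -> order_continuous_norm L ->
  bounded_increasing_cvg L -> dual_order_continuous L -> reflexive_space E.
Proof.
move=> Hsigma ocn KB docn; apply: contrapT.
move=> /nonreflexive_sequences[theta [K [f [x [th0 Df f1 xK [fge f0]]]]]].
have /choice[g gP] m : exists g, [/\ positive_dual L g, forall z, `|f m z| <= g (labs z) &
    forall z, `|g z| <= `|z|].
  have f1' z : `|f m z| <= 1 * `|z| by rewrite mul1r.
  have [g [pg fg g1 _]] := functional_modulus HL (Df m) ler01 f1'.
  by exists g; split=> // z; have := g1 z; rewrite mul1r.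
have [F [DF FP]] : exists F, is_dual F /\
    forall z, (fun n => \sum_(i < n) 2^-1 ^+ i * g i z) @ \oo --> F z.
  apply: dual_geometric_series => [i|i|i]; first by have [[]] := gP i.
    by have [] := gP i.
  by rewrite ger0_norm// ltW// half_pow_gt0.
have gF m z : 0 [<=] z -> 2^-1 ^+ m * g m z <= F z.
  move=> z0; apply/ler_addgt0Pr => r r0.
  have /(@cvg_seqP R R^o)/(_ _ r0)[N hN] := FP z.
  have := hN (maxn N m.+1) (leq_maxl _ _); rewrite ler_norml => /andP[_].
  rewrite (bigD1 (Ordinal (leq_maxr N m.+1)))//=.
  have : 0 <= \sum_(i < maxn N m.+1 | i != Ordinal (leq_maxr N m.+1)) 2^-1 ^+ i * g i z.
    apply: sumr_ge0 => i _; apply: mulr_ge0; first by rewrite ltW// half_pow_gt0.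
    by have [pg _ _] := gP i; exact: pg.2.
  lra.
have pF : positive_dual L F.
  split=> // z z0; apply: le_trans (gF 0%N z z0); rewrite mul1r.
  by have [pg _ _] := gP 0%N; exact: pg.2.
have fF m z : F (labs z) = 0 -> f m z = 0.
  move=> Fz; have [_ fg _] := gP m; apply/eqP; rewrite -normr_le0; apply: le_trans (fg z) _.
  by rewrite -(pmulr_rle0 _ (half_pow_gt0 R m)) -Fz; apply: gF; exact: labs_ge0.
have absK n : `|labs (x n)| <= K by rewrite (lnorm_abs HL).
have abs0 n : 0 [<=] labs (x n) by exact: labs_ge0.
have [e [e0 xe]] := dominating_element HL abs0 absK.
have trunc h : positive_dual L h -> forall r : R, 0 < r ->
    exists k : nat, forall n, h ((labs (x n) - k%:R *: e) [\/] 0) <= r.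
  move=> ph; apply: (uniform_truncation HL ph _ abs0 absK e0) => [d dd dK|n].
    exact: (docn _ _ _ dd dK ph).
  by exists (2 ^+ n).
have [z [mz zC]] := midpoints_cauchy Hsigma pF e0 xK (trunc F pF).
have /choice[N NP] : forall i, exists N, forall n m, (N <= n)%N -> (n <= m)%N ->
    F (labs (z m - z n)) <= 2^-1 ^+ i by move=> i; exact/zC/half_pow_gt0.
(* The partial sums make [phi] increasing with [N i <= phi i] and [i <= phi i]. *)
pose phi i := (\sum_(j < i.+1) (N j).+1)%N.
have phiS i : phi i.+1 = (phi i + (N i.+1).+1)%N by rewrite /phi big_ord_recr.
have phi_ge i : (i <= phi i)%N.
  by elim: i => // i IH; rewrite phiS addnS ltnS (leq_trans IH)// leq_addr.
have phi_N i : (N i <= phi i)%N by rewrite /phi big_ord_recr/= (leq_trans (leqnSn _))// leq_addl.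
pose q i := z (phi i).
have Fq i : F (labs (q i.+1 - q i)) <= 2^-1 ^+ i.
  by apply: NP => //; rewrite phiS leq_addr.
have lim (a : nat -> E) : (forall i, labs (a i) = labs (q i)) ->
    (forall i, labs (a i.+1 - a i) = labs (q i.+1 - q i)) ->
    exists v, forall h, is_dual h -> (forall s, F (labs s) = 0 -> h s = 0) ->
      (fun i => h (a i [\/] 0)) @ \oo --> h v.
  move=> aq aqS; apply: (functional_limit HL ocn KB pF e0 (K := K)).
  - by move=> i; exact: ljoinr.
  - move=> i; apply: le_trans (lnorm_pos HL _) _; rewrite -(lnorm_abs HL) aq (lnorm_abs HL).
    exact: midpoints_norm xK (mz _).
  - move=> i; apply: le_trans (Fq i); rewrite -aqS; apply: (pdual_mono HL pF).
    by move: (a i.+1) (a i) => b c; lattice.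
  move=> h ph r r0; have [k hk] := trunc h ph r r0; exists k => i.
  apply: le_trans (midpoints_truncation ph hk (mz (phi i))); apply: (pdual_mono HL ph).
  rewrite -/(q i) -aq; have : 0 [<=] k%:R *: e by exact: lscale_ge0.
  by move: (_ *: e) (a i) => u b; lattice.
have [v1 v1P] := lim q (fun=> erefl) (fun=> erefl).
have [||v2 v2P] := lim (fun i => - q i).
- by move=> i; move: (q i) => b; lattice.
- by move=> i; move: (q i.+1) (q i) => b c; lattice.
(* [functional_limit] applies to positive sequences, so the positive and negative parts of [q] have
   separate limits. *)
pose zeta := v1 - v2.
have q_cvg h : is_dual h -> (forall s, F (labs s) = 0 -> h s = 0) ->
    (fun i => h (q i)) @ \oo --> h zeta.
  move=> Dh hF; have -> : (fun i => h (q i)) = fun i => h (q i [\/] 0) - h ((- q i) [\/] 0).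
    apply/funext => i; rewrite -(dualB Dh); congr h.
    by move: (q i) => b; lattice.
  rewrite /zeta (dualB Dh); apply: cvgB; [exact: v1P|exact: v2P].
have fzeta m : theta <= f m zeta.
  apply/ler_addgt0Pr => r r0.
  have /(@cvg_seqP R R^o)/(_ _ r0)[N' hN'] := q_cvg _ (Df m) (fF m).
  have := hN' (maxn N' m) (leq_maxl _ _); rewrite ler_norml => /andP[_].
  have : theta <= f m (q (maxn N' m)).
    apply: (midpoints_ge (Df m) _ (mz _)) => j hj; apply: fge.
    apply: leq_trans hj; apply: leq_trans (phi_ge _); exact: leq_maxr.
  lra.
pose S s := (fun m => f m s) @ \oo --> (0 : R).
have SS a y w : S y -> S w -> S (a *: y + w).
  move=> Sy Sw; have := @cvg_seqZD R R^o a _ _ _ _ Sy Sw.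
  rewrite scaler0 addr0 /S => h; have -> // : (fun m => f m (a *: y + w)) =
    fun m => a *: (f m y : R^o) + f m w.
  by apply/funext => m; rewrite (dualD (Df m)) (dualZ (Df m)).
have S0 : S 0.
  by rewrite /S; under eq_fun do rewrite (dual0 (Df _)); exact: cvg_cst.
have Sq n w : midpoints x n w -> S w.
  elim=> [m _|w1 w2 _ S1 _ S2].
    by apply/cvg0_eps => r r0; exists m.+1 => j mj; rewrite f0// normr0 ltW.
  by rewrite -[_ *: _]addr0; apply: (SS) => //; rewrite -[w1]scale1r; exact: SS.
have th3 : 0 < theta / 3 by rewrite divr_gt0.
(* A functional [h] vanishing on [S] is absolutely continuous with respect to [F]: if
   [F (labs s) = 0], all the [f m s] are zero and [s] belongs to [S]. So [h (q i)], which is zero,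
   converges to [h zeta]. *)
have [|s [Ss zs]] := closure_of_annihilator S0 SS (x := zeta) _ th3.
  move=> h Dh _ hS; have hF s : F (labs s) = 0 -> h s = 0.
    move=> Fs; apply: hS; rewrite /S; under eq_fun do rewrite fF//; exact: cvg_cst.
  have := q_cvg h Dh hF; under eq_fun do rewrite (hS _ (Sq _ _ (mz _))).
  by move=> /(cvg_seq_unique (@cvg_cst R^o 0 _ _ _)) <-.
have /cvg0_eps/(_ _ th3)[M hM] := Ss.
have := hM M (leqnn _); have := le_trans (f1 M (zeta - s)) zs.
rewrite (dualB (Df M)) !ler_norml => /andP[h1 h2] /andP[h3 h4].
by have := fzeta M; lra.
Qed.

End reflexivity.

Theorem theorem4p1 (R : realType) (E : completeNormedModType R)
  (L : lattice_ops E) (HL : is_banach_lattice L)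
  (Hsigma : dedekind_sigma_complete L) :
  reflexive_space E <->
  (forall T : E -> E, is_operator T -> positive_op L T -> weak_DP T ->
     uaw_DP L T).
Proof.
split=> [Erefl T opT _ wT|TDP]; first exact: reflexive_weak_DP_uaw_DP.
have odn : order_disjoint_null L := order_bounded_disjoint_to0 HL Hsigma TDP.
have ocn := order_disjoint_null_ocn HL Hsigma odn.
have sdn := uaw_DP_sum_disjoint_null HL odn TDP.
have KB := sum_disjoint_null_cvg HL ocn sdn.
have docn := uaw_DP_dual_order_continuous HL TDP.
exact: (order_continuous_norms_reflexive HL).
Qed.
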